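(* Let $\mathsf{Q}$ be a small preadditive category that is Hom-finite, locally bounded, has a Serre functor and satisfies the strong retraction property, with nilpotent pseudo-radical $\mathfrak{r}$, and let $R$ be any ring. If $X\in{}^{\perp}(\mathsf{Cot}(\mathsf{Q},R)\cap\mathsf{E})$, then $X(q)$ is a flat $R$-module for each $q\in\mathsf{Q}$. Moreover, the converse holds whenever $R$ has finite weak global dimension: in that case, if $X\in{}_{\mathsf{Q},R}\mathsf{Mod}$ and $X(q)$ is a flat $R$-module for each $q\in\mathsf{Q}$, then $X\in{}^{\perp}(\mathsf{Cot}(\mathsf{Q},R)\cap\mathsf{E})$.
   Context: Here the base ring is $\mathbb{Z}$. ${}_{\mathsf{Q},R}\mathsf{Mod}$ is the category of additive functors from $\mathsf{Q}$ to left $R$-modules, and ${}_{\mathsf{Q}}\mathsf{Mod}$ is the category of additive functors from $\mathsf{Q}$ to abelian groups; $(-)^{\natural}:{}_{\mathsf{Q},R}\mathsf{Mod}\to{}_{\mathsf{Q}}\mathsf{Mod}$ is the forgetful functor. Conditions on $\mathsf{Q}$: - Hom-finite: each $\mathsf{Q}(p,q)$ is a finitely generated projective $\mathbb{Z}$-module. - Locally bounded: for every $q\in\mathsf{Q}$ there are only finitely many objects of $\mathsf{Q}$ mapping nontrivially into or out of $q$. - Serre functor: an additive auto-equivalence $\mathbb{S}:\mathsf{Q}\to\mathsf{Q}$ with isomorphisms $\mathsf{Q}(p,q)\cong\mathrm{Hom}_{\mathbb{Z}}(\mathsf{Q}(q,\mathbb{S}(p)),\mathbb{Z})$, natural in $p,q$.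 - Strong retraction property: for each $q$ the unit map $\mathbb{Z}\to\mathsf{Q}(q,q)$, $x\mapsto x\cdot\mathrm{id}_q$, admits a $\mathbb{Z}$-module retraction, and there is a (fixed) collection of subgroups $\mathfrak{r}_q$ with $\mathsf{Q}(q,q)=(\mathbb{Z}\cdot\mathrm{id}_q)\oplus\mathfrak{r}_q$, $\mathfrak{r}_q\circ\mathfrak{r}_q\subseteq\mathfrak{r}_q$ for all $q$, and $\mathsf{Q}(q,p)\circ\mathsf{Q}(p,q)\subseteq\mathfrak{r}_q$ for all $p\neq q$. - Pseudo-radical: the ideal $\mathfrak{r}$ with $\mathfrak{r}(q,q)=\mathfrak{r}_q$ and $\mathfrak{r}(p,q)=\mathsf{Q}(p,q)$ for $p\neq q$; nilpotent means $\mathfrak{r}^N=0$ for some $N\in\mathbb{N}$. Exact objects: $\mathsf{E}=\{X\in{}_{\mathsf{Q},R}\mathsf{Mod}\mid\mathrm{pd}_{\mathsf{Q}}X^{\natural}<\infty\text{ or }\mathrm{id}_{\mathsf{Q}}X^{\natural}<\infty\}$, where $\mathrm{pd}_{\mathsf{Q}}$, $\mathrm{id}_{\mathsf{Q}}$ are projective and injective dimension in ${}_{\mathsf{Q}}\mathsf{Mod}$. Flat and cotorsion objects: $F\in{}_{\mathsf{Q},R}\mathsf{Mod}$ is flat if every epimorphism $M\to F$ is pure, i.e. $\mathrm{Hom}(T,M)\to\mathrm{Hom}(T,F)$ is surjective for every finitely presented $T$ (equivalently, $F$ is a filtered colimit of finitely generated projective objects). $\mathsf{Cot}(\mathsf{Q},R)=\{N\mid\mathrm{Ext}^1_{\mathsf{Q},R}(F,N)=0\text{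 for all flat }F\}$. For a class $\mathsf{D}$, ${}^{\perp}\mathsf{D}=\{M\mid\mathrm{Ext}^1_{\mathsf{Q},R}(M,D)=0\ \forall D\in\mathsf{D}\}$. *)

(* Defs.v *)
From HB Require Import structures.
From mathcomp Require Import all_boot all_order all_algebra.
From mathcomp Require Import boolp classical_sets cardinality.

Set Implicit Arguments.
Unset Strict Implicit.
Unset Printing Implicit Defensive.

Import GRing.Theory.
Local Open Scope classical_set_scope.
Local Open Scope ring_scope.

Record preadditive := Preadditive {
  ob :> Type;
  mor : ob -> ob -> zmodType;
  idm : forall q, mor q q;
  hcomp : forall p q r, mor q r -> mor p q -> mor p r;
  comp1m : forall p q (f : mor p q), hcomp (idm q) f = f;
  compm1 : forall p q (f : mor p q), hcomp f (idm p) = f;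
  compA : forall p q r s (h : mor r s) (g : mor q r) (f : mor p q),
    hcomp h (hcomp g f) = hcomp (hcomp h g) f;
  compDl : forall p q r (g g' : mor q r) (f : mor p q),
    hcomp (g + g') f = hcomp g f + hcomp g' f;
  compDr : forall p q r (g : mor q r) (f f' : mor p q),
    hcomp g (f + f') = hcomp g f + hcomp g f' }.

Notation "g \oc f" := (hcomp g f) (at level 40, left associativity).

Record addfun (Q Q' : preadditive) := AddFun {
  fob :> Q -> Q';
  fmor : forall p q, mor p q -> mor (fob p) (fob q);
  fmorD : forall p q (f g : mor p q), fmor (f + g) = fmor f + fmor g;
  fmor1 : forall q, fmor (idm q) = idm (fob q);
  fmorM : forall p q r (g : mor q r) (f : mor p q),
    fmor (g \oc f) = fmor g \oc fmor f }.

Definition fid (Q : preadditive) : addfun Q Q :=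
  @AddFun Q Q id (fun p q f => f) (fun _ _ _ _ => erefl) (fun _ => erefl)
    (fun _ _ _ _ _ => erefl).

Section Fcomp.
Variables (Q Q' Q'' : preadditive) (G : addfun Q' Q'') (F : addfun Q Q').

Let gf p q (f : mor p q) : mor (G (F p)) (G (F q)) := fmor G (fmor F f).

Let gfD p q (f g : mor p q) : gf (f + g) = gf f + gf g.
Proof. by rewrite /gf !fmorD. Qed.

Let gf1 q : gf (idm q) = idm (G (F q)).
Proof. by rewrite /gf !fmor1. Qed.

Let gfM p q r (g : mor q r) (f : mor p q) : gf (g \oc f) = gf g \oc gf f.
Proof. by rewrite /gf !fmorM. Qed.

Definition fcomp : addfun Q Q'' := AddFun gfD gf1 gfM.
End Fcomp.

Definition nat_iso (Q Q' : preadditive) (F G : addfun Q Q') : Prop :=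
  exists (a : forall q, mor (F q) (G q)) (b : forall q, mor (G q) (F q)),
    [/\ forall p q (f : mor p q), a q \oc fmor F f = fmor G f \oc a p,
        forall q, b q \oc a q = idm (F q)
      & forall q, a q \oc b q = idm (G q)].

Definition autoequivalence (Q : preadditive) (S : addfun Q Q) : Prop :=
  exists T : addfun Q Q,
    nat_iso (fcomp S T) (fid Q) /\ nat_iso (fcomp T S) (fid Q).

(* [phi p q] is the map from Q(p, q) to Hom_Z(Q(q, S p), Z). *)
Definition serre_functor (Q : preadditive) (S : addfun Q Q) : Prop :=
  autoequivalence S /\
  exists phi : forall p q : Q, mor p q -> {additive mor q (S p) -> int},
  [/\ forall p q (f g : mor p q) h, phi p q (f + g) h = phi p q f h + phi p q g h,
      forall p q (l : {additive mor q (S p) -> int}),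
        exists! f : mor p q, forall h, phi p q f h = l h,
      forall p q q' (g : mor q q') (f : mor p q) (h : mor q' (S p)),
        phi p q' (g \oc f) h = phi p q f (h \oc g)
    & forall p p' q (u : mor p' p) (f : mor p q) (h : mor q (S p')),
        phi p' q (f \oc u) h = phi p q f (fmor S u \oc h)].

Definition has_serre_functor (Q : preadditive) : Prop :=
  exists S : addfun Q Q, serre_functor S.

Definition lmod_projective (R : pzRingType) (P : lmodType R) : Prop :=
  forall (A B : lmodType R) (e : {linear A -> B}) (g : {linear P -> B}),
    (forall b, exists a, e a = b) ->
    exists h : {linear P -> A}, forall x, e (h x) = g x.

Definition lmod_fg (R : pzRingType) (M : lmodType R) : Prop :=
  exists (n : nat) (e : 'I_n -> M), forall x, exists c : 'I_n -> R,
    x = \sum_(i < n) c i *: e i.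

(* [zmodule M] is the abelian group M with its canonical int-module structure. *)
Definition hom_finite (Q : preadditive) : Prop :=
  forall p q : Q, lmod_fg (zmodule (mor p q)) /\ lmod_projective (zmodule (mor p q)).

Definition locally_bounded (Q : preadditive) : Prop :=
  forall q : Q, finite_set
    [set p : Q | (exists f : mor p q, f <> 0) \/ (exists f : mor q p, f <> 0)].

Definition strong_retraction (Q : preadditive)
    (r : forall q : Q, set (mor q q)) : Prop :=
  (forall q : Q, exists rho : {additive mor q q -> int},
     forall n : int, rho (idm q *~ n) = n) /\
  [/\ forall q, r q 0 /\ (forall f g, r q f -> r q g -> r q (f - g)),
      forall q (f : mor q q), exists (n : int) (g : mor q q),
        r q g /\ f = idm q *~ n + g,
      forall q (n : int), r q (idm q *~ n) -> idm q *~ n = 0,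
      forall q (f g : mor q q), r q f -> r q g -> r q (g \oc f)
    & forall (p q : Q) (f : mor p q) (g : mor q p), p <> q -> r p (g \oc f)].

Inductive pseudo_radical (Q : preadditive) (r : forall q : Q, set (mor q q)) :
    forall p q : Q, mor p q -> Prop :=
| prad_diag q (f : mor q q) : r q f -> pseudo_radical r f
| prad_offdiag p q (f : mor p q) : p <> q -> pseudo_radical r f.

(* Product of two ideals: finite sums of composites. *)
Inductive ideal_mul (Q : preadditive) (I J : forall p q : Q, mor p q -> Prop)
    (p q : Q) : mor p q -> Prop :=
| ideal_mul0 : ideal_mul I J (0 : mor p q)
| ideal_mulD s (g : mor s q) (f : mor p s) (h : mor p q) :
    I s q g -> J p s f -> ideal_mul I J h -> ideal_mul I J (g \oc f + h).

Fixpoint ideal_exp (Q : preadditive) (I : forall p q : Q, mor p q -> Prop)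
    (n : nat) : forall p q : Q, mor p q -> Prop :=
  if n is n'.+1 then ideal_mul I (ideal_exp I n') else fun _ _ _ => True.

Definition ideal_nilpotent (Q : preadditive)
    (I : forall p q : Q, mor p q -> Prop) : Prop :=
  exists N : nat, forall (p q : Q) (f : mor p q), ideal_exp I N f -> f = 0.

Record qmod (Q : preadditive) (R : pzRingType) := QMod {
  mob :> Q -> lmodType R;
  mact : forall p q, mor p q -> {linear mob p -> mob q};
  mactD : forall p q (f g : mor p q) x, mact (f + g) x = mact f x + mact g x;
  mact1 : forall q x, mact (idm q) x = x;
  mactM : forall p q r (g : mor q r) (f : mor p q) x,
    mact (g \oc f) x = mact g (mact f x) }.

Record qhom (Q : preadditive) (R : pzRingType) (X Y : qmod Q R) := QHom {
  qfun :> forall q : Q, {linear X q -> Y q};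
  qnat : forall p q (f : mor p q) x,
    qfun q (mact X f x) = mact Y f (qfun p x) }.

Section Forget.
Variables (Q : preadditive) (R : pzRingType) (X : qmod Q R).

Section Act.
Variables (p q : Q) (f : mor p q).
Definition forget_act (x : zmodule (X p)) : zmodule (X q) := mact X f x.

Let forget_actB : zmod_morphism forget_act.
Proof. by move=> x y; exact: (raddfB (mact X f)). Qed.
HB.instance Definition _ := GRing.isZmodMorphism.Build _ _ forget_act forget_actB.

Let forget_actZ : scalable forget_act.
Proof. by move=> n x; rewrite !scalezrE /forget_act raddfMz. Qed.
HB.instance Definition _ :=
  GRing.isScalable.Build int _ _ *:%R forget_act forget_actZ.
End Act.

(* Additive functors to abelian groups are represented as [qmod Q int]. *)
Definition forget : qmod Q int :=
  @QMod Q int (fun q => zmodule (X q)) (fun p q f => forget_act f)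
    (@mactD Q R X) (@mact1 Q R X) (@mactM Q R X).
End Forget.

Section Homological.
Variables (Q : preadditive) (R : pzRingType).
Implicit Types X Y M N P E F T : qmod Q R.

(* Monomorphisms, epimorphisms and exactness in a category of additive
   functors are tested objectwise. *)
Definition qmono X Y (f : qhom X Y) : Prop := forall q, injective (f q).

Definition qepi X Y (f : qhom X Y) : Prop := forall q y, exists x, f q x = y.

Definition qexact X Y M (f : qhom X Y) (g : qhom Y M) : Prop :=
  forall q y, g q y = 0 <-> exists x, f q x = y.

Definition qzero X : Prop := forall q (x : X q), x = 0.

Definition qprojective P : Prop :=
  forall A B (e : qhom A B) (g : qhom P B), qepi e ->
  exists h : qhom P A, forall q x, e q (h q x) = g q x.

Definition qinjective E : Prop :=
  forall A B (i : qhom A B) (g : qhom A E), qmono i ->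
  exists h : qhom B E, forall q x, h q (i q x) = g q x.

Definition finite_pd X : Prop :=
  exists (n : nat) (P : nat -> qmod Q R)
         (d : forall i, qhom (P i.+1) (P i)) (e : qhom (P 0%N) X),
  [/\ forall i, qprojective (P i), forall i, (n < i)%N -> qzero (P i),
      qepi e, qexact (d 0%N) e & forall i, qexact (d i.+1) (d i)].

Definition finite_id X : Prop :=
  exists (n : nat) (I : nat -> qmod Q R)
         (d : forall i, qhom (I i) (I i.+1)) (e : qhom X (I 0%N)),
  [/\ forall i, qinjective (I i), forall i, (n < i)%N -> qzero (I i),
      qmono e, qexact e (d 0%N) & forall i, qexact (d i) (d i.+1)].

(* Ext^1 in the sense of Yoneda; its zero element is the class of the split
   extensions. *)
Definition Ext1_zero M N : Prop :=
  forall E (i : qhom N E) (p : qhom E M), qmono i -> qexact i p -> qepi p ->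
  exists s : qhom M E, forall q x, p q (s q x) = x.

(* Some finite family is contained in no proper subfunctor. *)
Definition qfg X : Prop :=
  exists (n : nat) (o : 'I_n -> Q) (x : forall i, X (o i)),
  forall S : forall q, set (X q),
    (forall q, S q 0) ->
    (forall q (a : R) y z, S q y -> S q z -> S q (a *: y + z)) ->
    (forall p q (f : mor p q) y, S p y -> S q (mact X f y)) ->
    (forall i, S (o i) (x i)) ->
  forall q y, S q y.

Definition qfp T : Prop :=
  exists P1 P0 (d : qhom P1 P0) (e : qhom P0 T),
  [/\ qprojective P1 /\ qfg P1, qprojective P0 /\ qfg P0, qepi e & qexact d e].

Definition qpure M F (e : qhom M F) : Prop :=
  forall T, qfp T -> forall g : qhom T F,
  exists h : qhom T M, forall q x, e q (h q x) = g q x.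

Definition qflat F : Prop := forall M (e : qhom M F), qepi e -> qpure e.

Definition cotorsion N : Prop := forall F, qflat F -> Ext1_zero F N.

Definition left_perp (D : qmod Q R -> Prop) M : Prop :=
  forall N, D N -> Ext1_zero M N.
End Homological.

Definition exact_object (Q : preadditive) (R : pzRingType) (X : qmod Q R) : Prop :=
  finite_pd (forget X) \/ finite_id (forget X).

Section FlatModules.
Variable R : pzRingType.
Implicit Types (A B : lmodType R^c) (M : lmodType R).

(* Right R-modules are left modules over the opposite ring [R^c]. *)
Record balanced A M (G : zmodType) (b : A -> M -> G) : Prop := Balanced {
  balancedDl : forall a a' m, b (a + a') m = b a m + b a' m;
  balancedDr : forall a m m', b a (m + m') = b a m + b a m';
  balancedZ : forall (r : R) a m, b ((r : R^c) *: a) m = b a (r *: m) }.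

(* The element \sum a (x) m, for (a, m) in s, of the tensor product of A and M
   is zero; by the universal property, this means that every balanced map
   kills s. *)
Definition tensor_zero A M (s : seq (A * M)) : Prop :=
  forall (G : zmodType) (b : A -> M -> G), balanced b ->
    \sum_(u <- s) b u.1 u.2 = 0.

(* Tensoring with M preserves injectivity. *)
Definition lmod_flat M : Prop :=
  forall A B (j : {linear A -> B}), injective j ->
  forall s : seq (A * M),
    tensor_zero [seq (j u.1, u.2) | u <- s] -> tensor_zero s.

(* Every module has a flat resolution of length at most n, with n uniform. *)
Definition finite_weak_gldim : Prop :=
  exists n : nat, forall M : lmodType R,
  exists (F : nat -> lmodType R) (d : forall i, {linear F i.+1 -> F i})
         (e : {linear F 0%N -> M}),
  [/\ forall i, lmod_flat (F i), forall i, (n < i)%N -> forall x : F i, x = 0,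
      forall m, exists x, e x = m,
      forall x, e x = 0 <-> exists y, d 0%N y = x
    & forall i x, d i x = 0 <-> exists y, d i.+1 y = x].
End FlatModules.

(* Main.v *)
Require Import Defs.
From HB Require Import structures.
From mathcomp Require Import all_boot all_order all_algebra.
From mathcomp Require Import boolp classical_sets cardinality.

Set Implicit Arguments.
Unset Strict Implicit.
Unset Printing Implicit Defensive.

Import GRing.Theory Num.Theory.
Local Open Scope ring_scope.

(** Flatness is expressed through characters, that is, homomorphisms to Q/Z. A
    module M is flat if and only if the right module M^+ of its characters is
    injective; in terms of pairings, every balanced map A x M -> Q/Z extends along
    every monomorphism A -> B of right modules ([flat_charflat]).

    Orthogonal functors have flat values ([left_perp_flat]). For a right module C
    let N be the functor coinduced at q from C^+. It is cotorsion: if E is an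
    extension of a flat functor by N, then N(q) is pure in E(q), so the pairing of
    C with N(q) extends to E(q), and by adjunction this is a retraction of E onto
    N ([dual_coind_cotorsion]). It is exact: C^+ is the kernel of an epimorphism
    between divisible groups, and coinduction over the integers turns divisible
    groups into injective functors ([dual_coind_exact]). If A is a submodule of B
    with quotient C, then C^+, B^+ and A^+ give an exact sequence of coinduced
    functors, and X lifts maps along it, having no extensions by N. By adjunction
    balanced maps on A x X(q) extend to B x X(q).

    For the converse, the Serre functor provides dual bases which make the functors
    coinduced from objects S(q) also induced from the objects q ([duality],
    [ind]). So these have universal properties on both sides, and every functor K
    embeds in an induced functor emb_ob K made of the values of K, with a quotient
    cosyz K; the embedding splits at every object. Exact objects are acyclic:
    their Tor groups against right functors with projective values vanish
    ([acyclic_exact]), because induced functors have this property and it passes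
    along finite resolutions.

    An acyclic functor K with flat tops K(q) / rad K(q) is flat ([qflat_of_top]).
    Indeed, the characters of the tops form the socle of the right functor K^+ and
    are injective modules. The socle is essential, as the radical is nilpotent, and
    K^+ is its injective hull, as Tor_1(Q(-,q) / rad(-,q), K) = 0. Hence K^+ is a
    direct summand of M^+ for every epimorphism M -> K ([character_retraction]),
    which makes the epimorphism pure. If R has finite weak global dimension and K
    has flat values, the tops are flat, because top K is the kernel of an
    epimorphism from a value of K to the top of cosyz K, and this can be repeated
    ([top_ses], [top_flat]). So acyclic functors with flat values are flat.

    Let now N be cotorsion and exact, with cosyzygies N_0 = N, N_1, N_2 and so on.
    Their values are cotorsion modules, so by adjunction the functors emb_ob N_k
    have no extensions by flat-valued functors, and N_k has none if N_(k+1) has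
    none ([flat_perp_kernel]). When n bounds the weak global dimension, N_n has
    none: the iterated extension of N_(n+1) by N is trivial on acyclic functors of
    flat dimension at most n, which is proved along a projective resolution that
    ends in a flat functor, where N being cotorsion applies ([lift_to_emb]). *)

(** * Additive groups and modules *)

Lemma dchoice (T : Type) (V : T -> Type) (P : forall t, V t -> Prop) :
  (forall t, exists y, P t y) -> exists f : forall t, V t, forall t, P t (f t).
Proof.
by move=> tP; exists (fun t => projT1 (cid (tP t))) => t; exact: projT2 (cid _).
Qed.

Lemma dchoice2 (T : Type) (U : T -> Type) (V : forall t, U t -> Type)
    (P : forall t (u : U t), V t u -> Prop) :
  (forall t u, exists y, P t u y) ->
  exists f : forall t (u : U t), V t u, forall t u, P t u (f t u).
Proof.
move=> tP; exists (fun t u => projT1 (cid (tP t u))) => t u.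
exact: projT2 (cid _).
Qed.

Section LinearOfFunction.
Variables (R : pzRingType) (A B : lmodType R) (f : A -> B).

Definition lin_fun (fL : linear f) := f.
Variable fL : linear f.
HB.instance Definition _ := GRing.isLinear.Build R A B *:%R (lin_fun fL) fL.
Definition lin : {linear A -> B} := lin_fun fL.
End LinearOfFunction.
Arguments lin_fun {R A B f} fL /.

Lemma additive0 (A B : zmodType) (f : A -> B) :
  (forall x y, f (x + y) = f x + f y) -> f 0 = 0.
Proof. by move=> fD; apply: (addIr (f 0)); rewrite -fD !add0r. Qed.

Lemma additiveN (A B : zmodType) (f : A -> B) :
  (forall x y, f (x + y) = f x + f y) -> forall x, f (- x) = - f x.
Proof.
move=> fD x; apply: (addIr (f x)).
by rewrite -fD !addNr (additive0 fD).
Qed.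

Section AdditiveMaps.
Variables A M : zmodType.

(** Homomorphisms of abelian groups, as a type that carries the pointwise
    structure. *)
Record ahom := AHom { af :> A -> M; afD : forall x y, af (x + y) = af x + af y }.

Lemma ahomP (f g : ahom) : f =1 g -> f = g.
Proof.
case: f g => f fD [g gD] /= /funext fg; subst g.
by congr AHom; exact: Prop_irrelevance.
Qed.

Lemma ahom_zmod_morphism (f : ahom) : zmod_morphism f.
Proof. by move=> x y; rewrite afD (additiveN (@afD f)). Qed.
HB.instance Definition _ (f : ahom) :=
  GRing.isZmodMorphism.Build A M (af f) (ahom_zmod_morphism f).

Lemma af0 (f : ahom) : f 0 = 0. Proof. exact: raddf0. Qed.
Lemma afB (f : ahom) x y : f (x - y) = f x - f y. Proof. exact: raddfB. Qed.
Lemma afMz (f : ahom) x n : f (x *~ n) = f x *~ n. Proof. exact: raddfMz. Qed.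

HB.instance Definition _ := gen_eqMixin ahom.
HB.instance Definition _ := gen_choiceMixin ahom.

Definition ahom0 : ahom := @AHom (fun=> 0) (fun _ _ => esym (addr0 0)).
Definition ahom_add (f g : ahom) : ahom.
Proof.
by exists (fun x => f x + g x) => x y; rewrite !raddfD addrACA.
Defined.
Definition ahom_opp (f : ahom) : ahom.
Proof. by exists (fun x => - f x) => x y; rewrite raddfD opprD. Defined.

Let addA : associative ahom_add.
Proof. by move=> f g h; apply: ahomP => x /=; rewrite addrA. Qed.
Let addC : commutative ahom_add.
Proof. by move=> f g; apply: ahomP => x /=; rewrite addrC. Qed.
Let add0 : left_id ahom0 ahom_add.
Proof. by move=> f; apply: ahomP => x /=; rewrite add0r. Qed.
Let addN : left_inverse ahom0 ahom_opp ahom_add.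
Proof. by move=> f; apply: ahomP => x /=; rewrite addNr. Qed.
HB.instance Definition _ := GRing.isZmodule.Build ahom addA addC add0 addN.

Lemma ahomDE (f g : ahom) x : (f + g) x = f x + g x. Proof. by []. Qed.
Lemma ahomNE (f : ahom) x : (- f) x = - f x. Proof. by []. Qed.
End AdditiveMaps.

Section AdditiveMapsScale.
Variables (A : zmodType) (R : pzRingType) (M : lmodType R).

Definition ahom_scale (a : R) (f : ahom A M) : ahom A M.
Proof. by exists (fun x => a *: f x) => x y; rewrite raddfD scalerDr. Defined.

Let scaleA a b f : ahom_scale a (ahom_scale b f) = ahom_scale (a * b) f.
Proof. by apply: ahomP => x /=; rewrite scalerA. Qed.
Let scale1 : left_id 1 ahom_scale.
Proof. by move=> f; apply: ahomP => x /=; rewrite scale1r. Qed.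
Let scaleDr : right_distributive ahom_scale +%R.
Proof. by move=> a f g; apply: ahomP => x /=; rewrite scalerDr. Qed.
Let scaleDl f : {morph ahom_scale^~ f : a b / a + b}.
Proof. by move=> a b; apply: ahomP => x /=; rewrite scalerDl. Qed.
HB.instance Definition _ := GRing.Zmodule_isLmodule.Build R (ahom A M)
  scaleA scale1 scaleDr scaleDl.

Lemma ahomZE (a : R) (f : ahom A M) x : (a *: f) x = a *: f x.
Proof. by []. Qed.
End AdditiveMapsScale.

Section DependentProduct.
Variable J : Type.

Definition dprod (V : J -> Type) := forall j, V j.

Lemma dprodP (V : J -> Type) (f g : dprod V) : (forall j, f j = g j) -> f = g.
Proof. exact: functional_extensionality_dep. Qed.

Section Zmod.
Variable V : J -> zmodType.
HB.instance Definition _ := gen_eqMixin (dprod V).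
HB.instance Definition _ := gen_choiceMixin (dprod V).

Let dadd (f g : dprod V) : dprod V := fun j => f j + g j.
Let dopp (f : dprod V) : dprod V := fun j => - f j.
Let d0 : dprod V := fun j => 0.
Let addA : associative dadd.
Proof. by move=> f g h; apply: dprodP => j; exact: addrA. Qed.
Let addC : commutative dadd.
Proof. by move=> f g; apply: dprodP => j; exact: addrC. Qed.
Let add0 : left_id d0 dadd.
Proof. by move=> f; apply: dprodP => j; exact: add0r. Qed.
Let addN : left_inverse d0 dopp dadd.
Proof. by move=> f; apply: dprodP => j; exact: addNr. Qed.
HB.instance Definition _ := GRing.isZmodule.Build (dprod V) addA addC add0 addN.

Lemma dprod0E j : (0 : dprod V) j = 0. Proof. by []. Qed.
Lemma dprodDE (f g : dprod V) j : (f + g) j = f j + g j. Proof. by []. Qed.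
Lemma dprodNE (f : dprod V) j : (- f) j = - f j. Proof. by []. Qed.

Lemma dprod_sumE I (s : seq I) (P : pred I) (F : I -> dprod V) j :
  (\sum_(i <- s | P i) F i) j = \sum_(i <- s | P i) F i j.
Proof. by elim/big_rec2: _ => // i y z _ <-. Qed.
End Zmod.

Section Lmod.
Variables (R : pzRingType) (V : J -> lmodType R).
Let dscale (a : R) (f : dprod V) : dprod V := fun j => a *: f j.
Let scaleA a b f : dscale a (dscale b f) = dscale (a * b) f.
Proof. by apply: dprodP => j; exact: scalerA. Qed.
Let scale1 : left_id 1 dscale.
Proof. by move=> f; apply: dprodP => j; exact: scale1r. Qed.
Let scaleDr : right_distributive dscale +%R.
Proof. by move=> a f g; apply: dprodP => j; exact: scalerDr. Qed.
Let scaleDl f : {morph dscale^~ f : a b / a + b}.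
Proof. by move=> a b; apply: dprodP => j; exact: scalerDl. Qed.
HB.instance Definition _ := GRing.Zmodule_isLmodule.Build R (dprod V)
  scaleA scale1 scaleDr scaleDl.

Lemma dprodZE a (f : dprod V) j : (a *: f) j = a *: f j. Proof. by []. Qed.
End Lmod.

(** The family supported at a single index; equality of indices is decided
    classically. *)
Definition dsingle (V : J -> zmodType) j (v : V j) : dprod V := fun j' =>
  if pselect (j = j') is left e then eq_rect j (fun k => V k : Type) v j' e
  else 0.

Lemma dsingle_same (V : J -> zmodType) j (v : V j) : dsingle v j = v.
Proof.
rewrite /dsingle; case: pselect => // e.
by rewrite (Prop_irrelevance e erefl).
Qed.

Lemma dsingle_neq (V : J -> zmodType) j j' (v : V j) :
  j <> j' -> dsingle v j' = 0.
Proof. by rewrite /dsingle; case: pselect. Qed.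
End DependentProduct.

Lemma dsingle_eq (J : Type) (V : J -> zmodType) j (v : V j) (w : dprod V) :
  w j = v -> (forall j', j <> j' -> w j' = 0) -> w = dsingle v.
Proof.
move=> wj w0; apply: dprodP => j'; have [jj'|jj'] := pselect (j = j').
  by subst j'; rewrite dsingle_same.
by rewrite dsingle_neq // w0.
Qed.

Lemma dsingleD (J : Type) (V : J -> zmodType) j (v w : V j) :
  dsingle (v + w) = dsingle v + dsingle w.
Proof.
symmetry; apply: dsingle_eq => [|j' jj']; rewrite dprodDE ?dsingle_same //.
by rewrite !dsingle_neq // addr0.
Qed.

Lemma dprod_decomp (J : finType) (V : J -> zmodType) (w : dprod V) :
  w = \sum_j dsingle (w j).
Proof.
apply: dprodP => j; rewrite dprod_sumE (bigD1 j) //= dsingle_same big1 ?addr0 //.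
by move=> j' j'j; rewrite dsingle_neq // => jj'; rewrite jj' eqxx in j'j.
Qed.

Section Submodules.
Variables (R : pzRingType) (V : lmodType R).

Record submodule := Submodule {
  smem :> V -> Prop;
  smem0 : smem 0;
  smemL : forall a x y, smem x -> smem y -> smem (a *: x + y) }.

Variable S : submodule.

Lemma smemD x y : S x -> S y -> S (x + y).
Proof. by move=> Sx Sy; rewrite -[x]scale1r; exact: smemL. Qed.
Lemma smemZ a x : S x -> S (a *: x).
Proof. by move=> Sx; rewrite -[a *: x]addr0; apply: smemL => //; exact: smem0. Qed.
Lemma smemN x : S x -> S (- x).
Proof. by rewrite -scaleN1r; exact: smemZ. Qed.
Lemma smemB x y : S x -> S y -> S (x - y).
Proof. by move=> Sx Sy; apply: smemD => //; exact: smemN. Qed.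

Record subm := SubM { sincl : V; sinclP : S sincl }.

Lemma sincl_inj : injective sincl.
Proof.
by case=> x Sx [y Sy] /= xy; subst y; congr SubM; exact: Prop_irrelevance.
Qed.

HB.instance Definition _ := gen_eqMixin subm.
HB.instance Definition _ := gen_choiceMixin subm.

Let sadd x y := SubM (smemD (sinclP x) (sinclP y)).
Let sopp x := SubM (smemN (sinclP x)).
Let addA : associative sadd.
Proof. by move=> x y z; apply: sincl_inj; exact: addrA. Qed.
Let addC : commutative sadd.
Proof. by move=> x y; apply: sincl_inj; exact: addrC. Qed.
Let add0 : left_id (SubM (smem0 S)) sadd.
Proof. by move=> x; apply: sincl_inj; exact: add0r. Qed.
Let addN : left_inverse (SubM (smem0 S)) sopp sadd.
Proof. by move=> x; apply: sincl_inj; exact: addNr. Qed.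
HB.instance Definition _ := GRing.isZmodule.Build subm addA addC add0 addN.

Let sscale a x := SubM (smemZ a (sinclP x)).
Let scaleA a b x : sscale a (sscale b x) = sscale (a * b) x.
Proof. by apply: sincl_inj; exact: scalerA. Qed.
Let scale1 : left_id 1 sscale.
Proof. by move=> x; apply: sincl_inj; exact: scale1r. Qed.
Let scaleDr : right_distributive sscale +%R.
Proof. by move=> a x y; apply: sincl_inj; exact: scalerDr. Qed.
Let scaleDl x : {morph sscale^~ x : a b / a + b}.
Proof. by move=> a b; apply: sincl_inj; exact: scalerDl. Qed.
HB.instance Definition _ := GRing.Zmodule_isLmodule.Build R subm
  scaleA scale1 scaleDr scaleDl.

Lemma sincl_linear : linear sincl. Proof. by []. Qed.
HB.instance Definition _ := GRing.isLinear.Build R subm V *:%R sincl sincl_linear.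

(** A coset is represented by an element chosen from it, so that the carrier of
    the quotient consists of the chosen representatives. *)
Definition qrep (x : V) : V := xget 0 [set y | S (x - y)]%classic.

Lemma qrepP x : S (x - qrep x).
Proof.
rewrite /qrep; case: xgetP => [y -> //|/(_ x)[]].
by rewrite /= subrr; exact: smem0.
Qed.

Lemma qrep_eq x y : S (x - y) -> qrep x = qrep y.
Proof.
move=> Sxy; congr xget; apply/seteqP; split=> z /= Sz.
  by rewrite -(subrK x y) -opprB -addrA; apply: smemD => //; exact: smemN.
by rewrite -(subrK y x) -addrA; apply: smemD.
Qed.

Record quot := Quot { qval : V; qvalP : qrep qval = qval }.

Definition qpi (x : V) : quot.
Proof. by exists (qrep x); apply: qrep_eq; rewrite -opprB; exact: smemN (qrepP x). Defined.

Lemma qval_inj : injective qval.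
Proof.
by case=> x Sx [y Sy] /= xy; subst y; congr Quot; exact: Prop_irrelevance.
Qed.

Lemma qvalK x : qpi (qval x) = x.
Proof. by apply: qval_inj; exact: qvalP. Qed.

Lemma qpi_eq x y : S (x - y) -> qpi x = qpi y.
Proof. by move=> Sxy; apply: qval_inj; exact: qrep_eq. Qed.

Lemma qval_qpi x : S (qval (qpi x) - x).
Proof. by rewrite -opprB; exact: smemN (qrepP x). Qed.

HB.instance Definition _ := gen_eqMixin quot.
HB.instance Definition _ := gen_choiceMixin quot.

Let qadd x y := qpi (qval x + qval y).
Let qopp x := qpi (- qval x).
Let qscale a x := qpi (a *: qval x).

Let qaddE x y : qadd (qpi x) (qpi y) = qpi (x + y).
Proof.
apply: qpi_eq; rewrite opprD addrACA.
by apply: smemD; exact: qval_qpi.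
Qed.
Let qoppE x : qopp (qpi x) = qpi (- x).
Proof. by apply: qpi_eq; rewrite -opprD; apply: smemN; exact: qval_qpi. Qed.
Let qscaleE a x : qscale a (qpi x) = qpi (a *: x).
Proof. by apply: qpi_eq; rewrite -scalerBr; apply: smemZ; exact: qval_qpi. Qed.

Let q_addA : associative qadd.
Proof.
move=> x y z; rewrite -[x]qvalK -[y]qvalK -[z]qvalK.
by rewrite !qaddE addrA.
Qed.
Let q_addC : commutative qadd.
Proof. by move=> x y; rewrite -[x]qvalK -[y]qvalK !qaddE addrC. Qed.
Let q_add0 : left_id (qpi 0) qadd.
Proof. by move=> x; rewrite -[x]qvalK !qaddE add0r. Qed.
Let q_addN : left_inverse (qpi 0) qopp qadd.
Proof. by move=> x; rewrite -[x]qvalK qoppE !qaddE addNr. Qed.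
HB.instance Definition _ := GRing.isZmodule.Build quot q_addA q_addC q_add0 q_addN.

Let q_scaleA a b x : qscale a (qscale b x) = qscale (a * b) x.
Proof. by rewrite -[x]qvalK !qscaleE scalerA. Qed.
Let q_scale1 : left_id 1 qscale.
Proof. by move=> x; rewrite -[x]qvalK !qscaleE scale1r. Qed.
Let q_scaleDr : right_distributive qscale +%R.
Proof.
move=> a x y; rewrite -[x]qvalK -[y]qvalK [X in qscale a X]qaddE !qscaleE.
by rewrite [RHS]qaddE scalerDr.
Qed.
Let q_scaleDl x : {morph qscale^~ x : a b / a + b}.
Proof.
by move=> a b; rewrite -[x]qvalK !qscaleE [RHS]qaddE scalerDl.
Qed.
HB.instance Definition _ := GRing.Zmodule_isLmodule.Build R quot
  q_scaleA q_scale1 q_scaleDr q_scaleDl.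

Lemma qpi_linear : linear qpi.
Proof. by move=> a x y; rewrite -[RHS]/(qadd (qscale _ _) _) qscaleE qaddE. Qed.
HB.instance Definition _ := GRing.isLinear.Build R V quot *:%R qpi qpi_linear.

Lemma qpi_eq0 x : qpi x = 0 <-> S x.
Proof.
split=> [x0|Sx]; last by apply: qpi_eq; rewrite subr0.
have := qval_qpi x; rewrite x0 -opprB => /smemN; rewrite opprK.
have := qval_qpi 0; rewrite subr0 => S0 /smemD /(_ S0); rewrite subrK.
by [].
Qed.

Lemma quot_lift (W : lmodType R) (f : {linear V -> W}) :
  (forall x, S x -> f x = 0) ->
  exists g : {linear quot -> W}, forall x, g (qpi x) = f x.
Proof.
move=> fS.
have gE x : f (qval (qpi x)) = f x.
  by apply: subr0_eq; rewrite -linearB fS //; exact: qval_qpi.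
have gL : linear (fun x => f (qval x)).
  move=> a x y; rewrite -linearP; apply: subr0_eq; rewrite -linearB fS //.
  by rewrite -{1}[x]qvalK -{1}[y]qvalK -linearP; exact: qval_qpi.
by exists (lin gL).
Qed.
End Submodules.

(** * Divisible groups and characters *)

Definition divisible (D : zmodType) : Prop :=
  forall (n : int) (d : D), n != 0 -> exists d' : D, d' *~ n = d.

Lemma int_subgroup (P : int -> Prop) :
  P 0 -> (forall a b, P a -> P b -> P (a - b)) ->
  exists k : nat, forall n, P n <-> exists m, n = k%:Z * m.
Proof.
move=> P0 PB.
have PN a : P a -> P (- a) by move=> Pa; rewrite -sub0r; exact: PB.
have PM a (m : int) : P a -> P (a * m).
  move=> Pa; have Pm (j : nat) : P (a * j%:Z).
    elim: j => [|j IH]; first by rewrite mulr0.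
    by rewrite -addn1 PoszD mulrDr mulr1 -[X in _ + X]opprK; apply: PB (PN _ _).
  by case: (intP m) => [|j|j]; rewrite ?mulr0 ?mulrN //; exact: PN.
pose good (n : nat) := `[< (0 < n)%N /\ P n >].
have [ex|ngood] := pselect (exists n, good n); last first.
  exists 0%N => n; split=> [Pn|[m ->]]; last by rewrite mul0r.
  exists 0; rewrite mulr0; case: (intP n) Pn => [//|j|j] Pj.
    by case: ngood; exists j.+1; apply/asboolP.
  by case: ngood; exists j.+1; apply/asboolP; split=> //; move/PN: Pj; rewrite opprK.
case: (ex_minnP ex) => k /asboolP[k0 Pk] kmin; exists k => n.
split=> [Pn|[m ->]]; last exact: PM.
have kn0 : k%:Z != 0 by rewrite eqz_nat -lt0n.
exists (n %/ k)%Z; rewrite {1}(divz_eq n k) mulrC.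
have : P (n %% k)%Z.
  have := PB _ _ Pn (PM _ (n %/ k)%Z Pk).
  by rewrite {1}(divz_eq n k) mulrC addrC addKr.
have : 0 <= (n %% k)%Z by exact: modz_ge0.
have : (n %% k)%Z < k by apply: ltz_pmod; rewrite ltz_nat.
case: (n %% k)%Z => // -[|j]; first by rewrite addr0.
rewrite ltz_nat => jk _ Pj; have /kmin : good j.+1 by apply/asboolP.
by rewrite leqNgt jk.
Qed.

Section CharacterExtension.
Variables (A D : zmodType).

Record partial_hom (G : A * D -> Prop) : Prop := PartialHom {
  phom0 : G (0, 0);
  phomB : forall a d a' d', G (a, d) -> G (a', d') -> G (a - a', d - d');
  phom_fun : forall d, G (0, d) -> d = 0 }.

Lemma phomN G a d : partial_hom G -> G (a, d) -> G (- a, - d).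
Proof. by move=> pG Gad; have := phomB pG (phom0 pG) Gad; rewrite !sub0r. Qed.

Lemma phomD G a d a' d' : partial_hom G ->
  G (a, d) -> G (a', d') -> G (a + a', d + d').
Proof.
move=> pG Gad /(phomN pG) Gad'.
by have := phomB pG Gad Gad'; rewrite !opprK.
Qed.

Lemma phomM G a d (n : int) : partial_hom G -> G (a, d) -> G (a *~ n, d *~ n).
Proof.
move=> pG Gad; have Gn (m : nat) : G (a *~ m, d *~ m).
  elim: m => [|m IH]; first exact: phom0.
  by rewrite -addn1 PoszD !mulrzDr !mulr1z; apply: phomD.
by case: (intP n) => [|m|m]; rewrite ?mulr0z ?mulrNz;
  [exact: phom0|exact: Gn|apply: phomN => //; exact: Gn].
Qed.

Hypothesis D_div : divisible D.

Lemma phom_extend1 G (a : A) : partial_hom G -> (forall d, ~ G (a, d)) ->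
  exists G', [/\ partial_hom G', forall u, G u -> G' u & exists d, G' (a, d)].
Proof.
move=> pG aG.
have [||k kP] := @int_subgroup (fun n => exists d, G (a *~ n, d)).
- by exists 0; rewrite mulr0z; exact: phom0.
- move=> n m [d Gn] [e Gm]; exists (d - e).
  by rewrite mulrzBr; exact: phomB.
have [dk Gk] : exists d, G (a *~ k, d) by apply/kP; exists 1; rewrite mulr1.
have [d0 d0k] : exists d0 : D, d0 *~ k = dk.
  have [k0|kn0] := eqVneq (k%:Z) 0; last exact: D_div.
  by exists 0; rewrite mul0rz; move: Gk; rewrite k0 mulr0z => /(phom_fun pG).
have d0P m x d : G (x, d) -> x + a *~ m = 0 -> d + d0 *~ m = 0.
  move=> Gx xm; have Gm : G (a *~ m, - d).
    have -> : a *~ m = - x by apply: (addrI x); rewrite xm subrr.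
    exact: phomN.
  have /kP[j mE] : exists e, G (a *~ m, e) by exists (- d).
  have := phomB pG (phomM j pG Gk) Gm.
  rewrite -mulrzA -mE subrr => /(phom_fun pG).
  by rewrite opprK -d0k -mulrzA -mE addrC.
exists (fun u => exists x d m, G (x, d) /\ u = (x + a *~ m, d + d0 *~ m)).
split.
- split.
  + by exists 0, 0, 0; rewrite !mulr0z !addr0; split=> //; exact: phom0.
  + move=> _ _ _ _ [x [d [m [Gx [-> ->]]]]] [y [e [l [Gy [-> ->]]]]].
    exists (x - y), (d - e), (m - l); split; first exact: phomB.
    by rewrite !mulrzBr !opprD !addrA; congr (_, _); rewrite -!addrA;
      congr (_ + _); rewrite addrCA.
  + by move=> d [x [e [m [Gx [xm ->]]]]]; apply: d0P Gx _.
- by move=> [x d] Gx; exists x, d, 0; rewrite !mulr0z !addr0.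
- exists d0, 0, 0, 1; rewrite !mulr1z !add0r; split=> //; exact: phom0.
Qed.

(** Divisible groups are injective: a homomorphism defined on a subgroup of A
    extends to A. The subgroup and the homomorphism are given together, by
    the graph G. *)
Lemma phom_extend (G : A * D -> Prop) : partial_hom G ->
  exists f : ahom A D, forall a d, G (a, d) -> f a = d.
Proof.
move=> pG.
pose P := [set X : set (A * D) | partial_hom (fun u => X u \/ G u)]%classic.
have [|X [PX Xmax]] := @Zorn_bigcup (A * D)%type P.
  move=> F FP Ftot; rewrite /P /=.
  have mem2 u v : ((\bigcup_(X in F) X)%classic u \/ G u) ->
      ((\bigcup_(X in F) X)%classic v \/ G v) ->
      (G u /\ G v) \/ exists2 X, F X & (X u \/ G u) /\ (X v \/ G v).
    move=> [[X FX Xu]|Gu] [[Y FY Yv]|Gv]; last by left.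
    - have [XY|YX] := Ftot _ _ FX FY; right.
        by exists Y => //; split; left=> //; exact: XY.
      by exists X => //; split; left=> //; exact: YX.
    - by right; exists X => //; split; [left|right].
    - by right; exists Y => //; split; [right|left].
  split.
  - by right; exact: phom0.
  - move=> a d a' d' u v; case: (mem2 _ _ u v) => [[Gu Gv]|[X FX [Xu Xv]]].
      by right; exact: phomB.
    case: (phomB (FP _ FX) Xu Xv) => ?; [left|by right].
    by exists X.
  - move=> d u; case: (mem2 _ _ u u) => [[Gu _]|[X FX [Xu _]]].
      exact: phom_fun Gu.
    exact: (phom_fun (FP _ FX) Xu).
have Xtot a : exists d, X (a, d) \/ G (a, d).
  apply: contrapT => /forallNP aX.
  have [G' [pG' XG' [d G'd]]] := phom_extend1 PX aX.
  apply: (Xmax G').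
    split; first by move=> u Xu; apply: XG'; left.
    by move=> /(_ _ G'd) Xad; apply: (aX d); left.
  rewrite /P /=.
  have -> : (fun u => G' u \/ G u) = G' => //.
  by apply/funext => u; apply/propext; split=> [[//|Gu]|]; [apply: XG'; right|left].
have [f fP] := choice Xtot.
have fuq a d : X (a, d) \/ G (a, d) -> f a = d.
  move=> ad; have := phomB PX (fP a) ad; rewrite subrr => /(phom_fun PX).
  exact: subr0_eq.
have fD x y : f (x + y) = f x + f y by apply: fuq; exact: (phomD PX (fP x) (fP y)).
by exists (AHom fD) => a d Gad; apply: fuq; right.
Qed.

Lemma ahom_extend (B : zmodType) (i : B -> A) (f : B -> D) :
  (forall x y, i (x + y) = i x + i y) -> injective i ->
  (forall x y, f (x + y) = f x + f y) ->
  exists g : ahom A D, forall x, g (i x) = f x.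
Proof.
move=> iD i_inj fD.
have [|g gP] := @phom_extend (fun u => exists x, u = (i x, f x)).
  split.
  - by exists 0; rewrite (additive0 iD) (additive0 fD).
  - move=> _ _ _ _ [x [-> ->]] [y [-> ->]]; exists (x - y).
    by rewrite iD fD (additiveN iD) (additiveN fD).
  - move=> d [x []]; rewrite -(additive0 iD) => /i_inj <- ->.
    exact: additive0.
by exists g => x; apply: gP; exists x.
Qed.

End CharacterExtension.

Lemma scale_intE (V : lmodType int) (n : int) (x : V) : n *: x = x *~ n.
Proof. by rewrite -{1}[n]intz scaler_int. Qed.

Definition int_rat : submodule (zmodule rat).
Proof.
apply: (@Submodule int (zmodule rat) (fun x => (x : rat) \is a Num.int)).
  exact: (@rpred0 rat).
move=> a x y xZ yZ; rewrite scalezrE; apply: (@rpredD rat) => //.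
by rewrite -[x *~ a](@mulrzr rat); apply: rpredM => //; exact: rpred_int.
Defined.

Definition QZ : zmodType := quot int_rat.

Lemma QZ_divisible : divisible QZ.
Proof.
move=> n d n0; exists (qpi int_rat (qval d / n%:~R : rat)).
have -> : qpi int_rat (qval d / n%:~R : rat) *~ n =
    n *: qpi int_rat (qval d / n%:~R : rat) by rewrite scale_intE.
rewrite -linearZ -[RHS]qvalK; congr qpi.
by rewrite scalezrE -[_ *~ n](@mulrzr rat) divfK // intr_eq0.
Qed.

Definition character (A : zmodType) := ahom A QZ.

Lemma character_extend (B A : zmodType) (i : B -> A) (f : B -> QZ) :
  (forall x y, i (x + y) = i x + i y) -> injective i ->
  (forall x y, f (x + y) = f x + f y) ->
  exists g : character A, forall x, g (i x) = f x.
Proof. exact: (ahom_extend QZ_divisible). Qed.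

(** Q/Z has elements of every order, so characters separate the points of a
    group from its subgroups. *)
Lemma character_separates (A : zmodType) (S : A -> Prop) (x : A) :
  S 0 -> (forall u v, S u -> S v -> S (u - v)) -> ~ S x ->
  exists2 f : character A, (forall u, S u -> f u = 0) & f x <> 0.
Proof.
move=> S0 SB Sx.
have SN u : S u -> S (- u) by move=> Su; rewrite -sub0r; exact: SB.
have [q [qP q1]] : exists q : rat,
    (forall n : int, S (x *~ n) -> q *~ n \in Num.int) /\ q \isn't a Num.int.
  have [||k kP] := @int_subgroup (fun n => S (x *~ n)).
  - by [].
  - by move=> n m Sn Sm; rewrite mulrzBr; exact: SB.
  have [k0|kn0] := eqVneq k 0%N.
    exists (2%:R^-1); split=> // n /kP[m ->].
    by rewrite k0 mul0r mulr0z rpred0.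
  have kr0 : (k%:R : rat) != 0 by rewrite pnatr_eq0.
  exists (k%:R^-1); split=> [n /kP[m ->]|].
    by rewrite mulrzA -[_ *~ k]mulrzr -pmulrn mulVf // rpred_int.
  apply/negP => /intrP[m mE]; apply: Sx; rewrite -[x]mulr1z; apply/kP.
  exists m; apply/eqP; rewrite -(eqr_int rat) intrM -mE -pmulrn.
  by rewrite mulfV.
pose qz := qpi int_rat (q : zmodule rat).
have qzM n : S (x *~ n) -> (qz : QZ) *~ n = 0.
  move=> /qP qn; have -> : (qz : QZ) *~ n = n *: qz by rewrite scale_intE.
  by rewrite -linearZ; apply/qpi_eq0.
have [|f fP] := @phom_extend A QZ QZ_divisible
    (fun w => exists u (n : int), S u /\ w = (u + x *~ n, (qz : QZ) *~ n)).
  split.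
  - by exists 0, 0; rewrite !mulr0z addr0.
  - move=> _ _ _ _ [u [n [Su [-> ->]]]] [v [m [Sv [-> ->]]]].
    exists (u - v), (n - m); split; first exact: SB.
    by rewrite !mulrzBr opprD addrACA.
  - move=> d [u [n [Su [un ->]]]]; apply: qzM.
    have -> : x *~ n = - u by apply: (addrI u); rewrite -un subrr.
    exact: SN.
exists f => [u Su|]; first by apply: fP; exists u, 0; rewrite !mulr0z addr0.
rewrite (fP x qz); last by exists 0, 1; rewrite !mulr1z add0r.
by move=> /qpi_eq0 /=; apply/negP.
Qed.

Lemma character_nonzero (A : zmodType) (x : A) :
  x <> 0 -> exists f : character A, f x <> 0.
Proof.
move=> x0; have [//|||f _ fx] := @character_separates A (fun u => u = 0) x.
- by move=> u v -> ->; rewrite subr0.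
- by [].
by exists f.
Qed.

Lemma character_factor (B C : zmodType) (p : B -> C) (c : character B) :
  (forall x y, p (x + y) = p x + p y) -> (forall y, exists x, p x = y) ->
  (forall x, p x = 0 -> c x = 0) ->
  exists c' : character C, forall x, c' (p x) = c x.
Proof.
move=> pD p_surj pc; have [s sE] := choice p_surj.
have csE x : c (s (p x)) = c x.
  apply: subr0_eq; rewrite -afB; apply: pc.
  by rewrite pD (additiveN pD) sE subrr.
have c'D x y : c (s (x + y)) = c (s x) + c (s y).
  by rewrite -afD -[RHS]csE pD !sE.
by exists (AHom c'D).
Qed.

(** * Free modules *)

Section FiniteSupport.
Variables (B : choiceType) (Y : zmodType).
Implicit Types h : B -> Y.

Definition finsupp h := exists l : seq B, forall b, b \notin l -> h b = 0.

Definition fsum h : Y :=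
  if pselect (finsupp h) is left hP then \sum_(b <- undup (projT1 (cid hP))) h b
  else 0.

Lemma fsumE h (l : seq B) :
  uniq l -> (forall b, b \notin l -> h b = 0) -> fsum h = \sum_(b <- l) h b.
Proof.
move=> ul hl; rewrite /fsum; case: pselect => [hP|[]]; last by exists l.
case: (cid hP) => l' hl' /=.
have E (s t : seq B) : uniq s -> uniq t -> (forall b, b \notin t -> h b = 0) ->
    \sum_(b <- s) h b = \sum_(b <- [seq x <- s | x \in t]) h b.
  move=> us ut ht; rewrite big_filter [RHS]big_mkcond; apply: eq_bigr => b _.
  by case: ifPn => // /ht.
rewrite (E _ l) ?undup_uniq // (E l (undup l')) ?undup_uniq //; last first.
  by move=> b; rewrite mem_undup => /hl'.
apply: perm_big; apply: uniq_perm; rewrite ?filter_uniq ?undup_uniq //.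
by move=> b; rewrite !mem_filter andbC.
Qed.

Lemma finsupp_common h h' : finsupp h -> finsupp h' ->
  exists l, [/\ uniq l, forall b, b \notin l -> h b = 0
              & forall b, b \notin l -> h' b = 0].
Proof.
move=> [l hl] [l' hl']; exists (undup (l ++ l')).
split; first exact: undup_uniq.
- by move=> b; rewrite mem_undup mem_cat negb_or => /andP[/hl].
- by move=> b; rewrite mem_undup mem_cat negb_or => /andP[_ /hl'].
Qed.

Lemma fsumD h h' : finsupp h -> finsupp h' ->
  fsum (fun b => h b + h' b) = fsum h + fsum h'.
Proof.
move=> hf hf'; have [l [ul hl hl']] := finsupp_common hf hf'.
rewrite (fsumE ul hl) (fsumE ul hl') (fsumE ul) ?big_split // => b bl.
by rewrite hl ?hl' ?addr0.
Qed.

Lemma fsum1 b0 h : (forall b, b != b0 -> h b = 0) -> fsum h = h b0.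
Proof.
move=> h0; rewrite (@fsumE h [:: b0]) ?big_seq1 // => b.
by rewrite inE => /h0.
Qed.

End FiniteSupport.

Lemma fsum_morph (B : choiceType) (Y Y' : zmodType) (f : Y -> Y') (h : B -> Y) :
  (forall x y, f (x + y) = f x + f y) -> finsupp h ->
  f (fsum h) = fsum (fun b => f (h b)).
Proof.
move=> fD hf; have [l [ul hl _]] := finsupp_common hf hf.
rewrite (fsumE ul hl) (fsumE ul); last by move=> b /hl ->; exact: additive0.
elim/big_rec2: _ => [|b y z _ <-]; [exact: additive0|exact: fD].
Qed.

Section FreeModule.
Variables (R : pzRingType) (B : choiceType).

Definition fin_fun : submodule (dprod (fun _ : B => R^o)).
Proof.
apply: (@Submodule R (dprod (fun _ : B => R^o)) (fun f => finsupp f)).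
  by exists [::].
move=> a f g /finsupp_common fg /fg[l [_ fl gl]]; exists l => b bl.
by rewrite dprodDE dprodZE fl // gl // scaler0 addr0.
Defined.

Definition freemod := subm fin_fun.

Definition coef (x : freemod) (b : B) : R := sincl x b.

Lemma coefD x y b : coef (x + y) b = coef x b + coef y b. Proof. by []. Qed.
Lemma coefZ a x b : coef (a *: x) b = a * coef x b. Proof. by []. Qed.

Definition gen (b : B) : freemod.
Proof.
exists (fun b' => (b' == b)%:R); exists [:: b] => b'.
by rewrite inE => /negPf ->.
Defined.

Lemma coef_gen b b' : coef (gen b) b' = (b' == b)%:R. Proof. by []. Qed.

Lemma finsupp_coef (Y : zmodType) (x : freemod) (g : B -> Y) :
  (forall b, coef x b = 0 -> g b = 0) -> finsupp g.
Proof. by move=> xg; have [l xl] := sinclP x; exists l => b /xl /xg. Qed.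

Variable Y : lmodType R.

Lemma free_lift_linear (f : B -> Y) :
  linear (fun x : freemod => fsum (fun b => coef x b *: f b)).
Proof.
move=> a x y.
have F (z : freemod) : finsupp (fun b => coef z b *: f b).
  by apply: (@finsupp_coef _ z) => b ->; rewrite scale0r.
rewrite (fsum_morph (scalerDr a)) // -fsumD //.
  by congr fsum; apply/funext => b; rewrite coefD coefZ scalerDl scalerA.
by apply: (@finsupp_coef _ x) => b ->; rewrite scale0r scaler0.
Qed.

Definition free_lift (f : B -> Y) : {linear freemod -> Y} :=
  lin (free_lift_linear f).

Lemma free_liftE f x : free_lift f x = fsum (fun b => coef x b *: f b).
Proof. by []. Qed.

Lemma free_lift_gen f b : free_lift f (gen b) = f b.
Proof.
rewrite free_liftE (@fsum1 _ _ b) ?coef_gen ?eqxx ?scale1r // => b' /negPf.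
by rewrite coef_gen => ->; rewrite scale0r.
Qed.
End FreeModule.

Lemma free_decomp (R : pzRingType) (B : choiceType) (x : freemod R B) :
  x = fsum (fun b => coef x b *: gen R b).
Proof.
apply: sincl_inj; apply: dprodP => b.
rewrite (@fsum_morph _ _ _ (fun y : freemod R B => sincl y b)) //.
  rewrite (@fsum1 _ _ b) => [|b' /negPf b'b].
    by rewrite -[RHS]/(coef x b * (b == b)%:R) eqxx mulr1.
  by rewrite -[LHS]/(coef x b' * (b == b')%:R) eq_sym b'b mulr0.
by apply: (@finsupp_coef _ _ _ x) => b' ->; rewrite scale0r.
Qed.

(** Additive maps out of a free module that agree on the multiples of the
    generators are equal. *)
Lemma free_additive_ext (R : pzRingType) (B : choiceType) (Y : zmodType)
    (f g : freemod R B -> Y) :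
  (forall x y, f (x + y) = f x + f y) -> (forall x y, g (x + y) = g x + g y) ->
  (forall a b, f (a *: gen R b) = g (a *: gen R b)) -> f =1 g.
Proof.
move=> fD gD fg x; rewrite [x]free_decomp.
have F : finsupp (fun b => coef x b *: gen R b).
  by apply: (@finsupp_coef _ _ _ x) => b ->; rewrite scale0r.
by rewrite !fsum_morph //; congr fsum; apply/funext.
Qed.

Lemma free_projective (R : pzRingType) (B : choiceType) :
  lmod_projective (freemod R B).
Proof.
move=> A C e g e_surj.
have [s sP] := choice (fun b => e_surj (g (gen R b))).
exists (free_lift s); apply: free_additive_ext.
- by move=> x y; rewrite !linearD.
- by move=> x y; rewrite !linearD.
- by move=> a b; rewrite !linearZ free_lift_gen sP.
Qed.

(** * Flat modules *)

Record ses (R : pzRingType) (A B C : lmodType R) (i : {linear A -> B})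
    (p : {linear B -> C}) : Prop := Ses {
  ses_inj : injective i;
  ses_surj : forall y, exists x, p x = y;
  ses_ker : forall x, p x = 0 <-> exists a, i a = x }.

Lemma linear_inj (R : pzRingType) (A B : lmodType R) (f : {linear A -> B}) :
  (forall x, f x = 0 -> x = 0) -> injective f.
Proof. by move=> f0 x y fxy; apply/subr0_eq/f0; rewrite linearB fxy subrr. Qed.

Lemma ses0 (R : pzRingType) (A B C : lmodType R) (i : {linear A -> B})
  (p : {linear B -> C}) a : ses i p -> p (i a) = 0.
Proof. by move=> ip; apply/(ses_ker ip); exists a. Qed.

Definition kernel (R : pzRingType) (A B : lmodType R) (f : {linear A -> B}) :
  submodule A.
Proof.
exists (fun x => f x = 0); first exact: linear0.
by move=> a x y fx fy; rewrite linearP fx fy scaler0 addr0.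
Defined.

Lemma kernel_ses (R : pzRingType) (A B : lmodType R) (f : {linear A -> B}) :
  (forall y, exists x, f x = y) -> ses (sincl (S := kernel f)) f.
Proof.
move=> f_surj; split=> //; first exact: sincl_inj.
by move=> x; split=> [fx|[a <-]]; [by exists (@SubM _ _ (kernel f) x fx)|exact: (sinclP a)].
Qed.

Lemma quot_ses (R : pzRingType) (V : lmodType R) (S : submodule V) :
  ses (sincl (S := S)) (qpi S).
Proof.
split; first exact: sincl_inj.
- by move=> y; exists (qval y); exact: qvalK.
- move=> x; split=> [/qpi_eq0 Sx|[a <-]]; first by exists (SubM Sx).
  by apply/qpi_eq0; exact: (sinclP a).
Qed.

Lemma subm_lift (R : pzRingType) (V W : lmodType R) (S : submodule V)
    (f : {linear W -> V}) : (forall x, S (f x)) ->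
  exists g : {linear W -> subm S}, forall x, sincl (g x) = f x.
Proof.
move=> fS; have gL : linear (fun x => SubM (fS x)).
  by move=> a x y; apply: sincl_inj; rewrite /= linearP.
by exists (lin gL).
Qed.

Section CharacterFlat.
Variable R : pzRingType.
Implicit Types (M F : lmodType R) (A B U : lmodType R^c).

(** By adjunction, the statement that the right module of characters of M is
    injective. *)
Definition charflat M : Prop :=
  forall A B (j : {linear A -> B}), injective j ->
  forall b : A -> M -> QZ, balanced b ->
  exists2 b' : B -> M -> QZ, balanced b' & forall a m, b' (j a) m = b a m.

Lemma balanced0l A M (G : zmodType) (b : A -> M -> G) m : balanced b -> b 0 m = 0.
Proof. by move=> bb; apply: (@additive0 _ _ (b^~ m)) => x y; rewrite balancedDl. Qed.
Lemma balanced0r A M (G : zmodType) (b : A -> M -> G) a : balanced b -> b a 0 = 0.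
Proof. by move=> bb; apply: (@additive0 _ _ (b a)) => x y; rewrite balancedDr. Qed.
Lemma balancedNl A M (G : zmodType) (b : A -> M -> G) a m :
  balanced b -> b (- a) m = - b a m.
Proof. by move=> bb; apply: (@additiveN _ _ (b^~ m)) => x y; rewrite balancedDl. Qed.
Lemma balancedNr A M (G : zmodType) (b : A -> M -> G) a m :
  balanced b -> b a (- m) = - b a m.
Proof. by move=> bb; apply: (@additiveN _ _ (b a)) => x y; rewrite balancedDr. Qed.

Lemma balanced_comp A M (G H : zmodType) (b : A -> M -> G) (f : ahom G H) :
  balanced b -> balanced (fun a m => f (b a m)).
Proof.
move=> [bDl bDr bZ]; split=> *; first by rewrite bDl raddfD.
  by rewrite bDr raddfD.
by rewrite bZ.
Qed.

Lemma balanced_pre A A' M M' (G : zmodType) (b : A -> M -> G)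
    (f : {linear A' -> A}) (g : {linear M' -> M}) :
  balanced b -> balanced (fun a m => b (f a) (g m)).
Proof.
move=> [bDl bDr bZ]; split=> *; first by rewrite linearD bDl.
  by rewrite linearD bDr.
by rewrite !linearZ bZ.
Qed.

Lemma balancedB A M (G : zmodType) (b b' : A -> M -> G) :
  balanced b -> balanced b' -> balanced (fun a m => b a m - b' a m).
Proof.
move=> [bDl bDr bZ] [bDl' bDr' bZ']; split=> *.
- by rewrite bDl bDl' opprD addrACA.
- by rewrite bDr bDr' opprD addrACA.
- by rewrite bZ bZ'.
Qed.

Lemma balancedD A M (G : zmodType) (b b' : A -> M -> G) :
  balanced b -> balanced b' -> balanced (fun a m => b a m + b' a m).
Proof.
move=> [bDl bDr bZ] [bDl' bDr' bZ']; split=> *.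
- by rewrite bDl bDl' addrACA.
- by rewrite bDr bDr' addrACA.
- by rewrite bZ bZ'.
Qed.

(** The tensor product of A and M embeds in the product of copies of Q/Z
    indexed by the balanced maps, since characters separate points. A balanced
    map on A x M is a character of the image of A (x) M, which is a subgroup of
    that product when M is flat. *)
Lemma flat_charflat M : lmod_flat M <-> charflat M.
Proof.
split=> [Mflat A B j j_inj b bb|Mflat A B j j_inj s js G b bb]; last first.
  apply: contrapT => /character_nonzero[f]; rewrite raddf_sum; apply.
  have [b' bb' b'E] := Mflat A B j j_inj _ (balanced_comp f bb).
  have := js _ b' bb'; rewrite big_map => js0; rewrite -[RHS]js0.
  by apply: eq_bigr => u _; rewrite b'E.
pose Bal := {b : B -> M -> QZ | balanced b}.
pose bal (c : Bal) : balanced (projT1 c) := projT2 c.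
pose univ (x : B) (m : M) : dprod (fun _ : Bal => QZ) := fun c => projT1 c x m.
have univB : balanced univ.
  split=> [x x' m|x m m'|r x m]; apply: dprodP => c;
    rewrite /univ ?dprodDE.
  - exact: (balancedDl (bal c)).
  - exact: (balancedDr (bal c)).
  - exact: (balancedZ (bal c)).
have [|f fP] := @phom_extend (dprod (fun _ : Bal => QZ)) QZ QZ_divisible
  (fun w => exists s : seq (A * M), w = (\sum_(u <- s) univ (j u.1) u.2,
                                        \sum_(u <- s) b u.1 u.2)).
  split.
  - by exists [::]; rewrite !big_nil.
  - move=> _ _ _ _ [s [-> ->]] [t [-> ->]].
    exists (s ++ [seq (- u.1, u.2) | u <- t]).
    rewrite !big_cat !big_map -!sumrN /=; congr (_ + _, _ + _).
      by apply: eq_bigr => u _; rewrite linearN balancedNl.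
    by apply: eq_bigr => u _; rewrite balancedNl.
  - move=> d [s [s0 ->]]; apply: (Mflat A B j j_inj s) => // G c cb.
    rewrite big_map; apply: contrapT => /character_nonzero[f]; apply.
    rewrite raddf_sum /=.
    pose c' : Bal := exist _ _ (balanced_comp f cb).
    have := congr1 (fun w : dprod (fun _ : Bal => QZ) => w c') s0.
    by rewrite dprod_sumE dprod0E => /esym.
exists (fun x m => f (univ x m)); first exact: balanced_comp.
by move=> a m; apply: fP; exists [:: (a, m)]; rewrite !big_seq1.
Qed.

Lemma charflat_retract M M' (i : {linear M -> M'}) (p : {linear M' -> M}) :
  (forall x, p (i x) = x) -> charflat M' -> charflat M.
Proof.
move=> pi M'flat A B j j_inj b bb.
have [b' bb' b'E] := M'flat A B j j_inj _ (balanced_pre idfun p bb).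
exists (fun x m => b' x (i m)); first exact: (balanced_pre idfun i bb').
by move=> a m; rewrite b'E /= pi.
Qed.

(** A balanced map on A and a free module is a family of characters of A, one
    for each generator. *)
Lemma charflat_free (B : choiceType) : charflat (freemod R B).
Proof.
move=> U V j j_inj b bb.
have [f fP] := choice (fun e => @character_extend U V j (b^~ (gen R e))
  (fun x y => linearD j x y) j_inj (fun x y => balancedDl bb x y _)).
have F (x : freemod R B) y : finsupp (fun e => f e ((coef x e : R^c) *: y)).
  by apply: (@finsupp_coef _ _ _ x) => e ->; rewrite scale0r raddf0.
exists (fun (y : V) (x : freemod R B) => fsum (fun e => f e ((coef x e : R^c) *: y))).
  split=> [y y' x|y x x'|a y x].
  - rewrite -fsumD //; congr fsum; apply/funext => e.
    by rewrite scalerDr raddfD.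
  - rewrite -fsumD //; congr fsum; apply/funext => e.
    by rewrite coefD scalerDl raddfD.
  - by congr fsum; apply/funext => e; rewrite coefZ scalerA.
move=> u; apply: free_additive_ext.
- move=> x y; rewrite -fsumD //; congr fsum; apply/funext => e.
  by rewrite coefD scalerDl raddfD.
- by move=> x y; rewrite balancedDr.
move=> a e; rewrite (@fsum1 _ _ e) => [|e' /negPf e'e].
  by rewrite coefZ coef_gen eqxx mulr1 -linearZ fP balancedZ.
by rewrite coefZ coef_gen e'e mulr0 scale0r raddf0.
Qed.

(** Ext^1(F, U^+) = 0 for the module U^+ of characters of any right module U:
    a balanced map on U x M is extended after U is covered by a free right
    module, and the defect lives on the kernel of the cover and F. *)
Lemma charflat_ext_pairing (M M' F : lmodType R) (i : {linear M -> M'})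
    (p : {linear M' -> F}) : ses i p -> charflat F ->
  forall U (b : U -> M -> QZ), balanced b ->
  exists2 b' : U -> M' -> QZ, balanced b' & forall u m, b' u (i m) = b u m.
Proof.
move=> ip Fflat U b bb.
have [f fP] := choice (fun u : U => @character_extend M M' i (b u)
  (fun x y => linearD i x y) (ses_inj ip) (fun x y => balancedDr bb _ x y)).
pose Fr := freemod R^c U; pose cov : {linear Fr -> U} := free_lift id.
pose c (k : Fr) (x : M') := fsum (fun u => f u ((coef k u : R) *: x)).
have Fi (k : Fr) x : finsupp (fun u => f u ((coef k u : R) *: x)).
  by apply: (@finsupp_coef _ _ _ k) => u ku; rewrite [coef k u]ku scale0r raddf0.
have cb : balanced c.
  split=> [k k' x|k x x'|a k x].
  - rewrite /c -fsumD //; congr fsum; apply/funext => u.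
    by rewrite coefD scalerDl raddfD.
  - rewrite /c -fsumD //; congr fsum; apply/funext => u.
    by rewrite scalerDr raddfD.
  - by congr fsum; apply/funext => u; rewrite coefZ scalerA.
have ci k m : c k (i m) = b (cov k) m.
  move: k; apply: free_additive_ext => [k k'|k k'|a u].
  - exact: (balancedDl cb).
  - by rewrite linearD balancedDl.
  rewrite linearZ free_lift_gen /c (@fsum1 _ _ u) => [|u' /negPf u'u].
    by rewrite coefZ coef_gen eqxx mulr1 -linearZ fP balancedZ.
  by rewrite coefZ coef_gen u'u mulr0 scale0r raddf0.
have [sec secP] := choice (ses_surj ip).
have csec (k : subm (kernel cov)) x : c (sincl k) (sec (p x)) = c (sincl k) x.
  apply: subr0_eq; rewrite -balancedNr // -balancedDr //.
  have /(ses_ker ip)[m <-] : p (sec (p x) - x) = 0 by rewrite linearB secP subrr.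
  by rewrite ci (sinclP k) balanced0l.
have c'b : balanced (fun (k : subm (kernel cov)) y => c (sincl k) (sec y)).
  split=> [k k' y|k y y'|a k y].
  - exact: (balancedDl cb).
  - by rewrite -(balancedDr cb) -[RHS]csec linearD !secP.
  - by rewrite (balancedZ cb) -[LHS]csec linearZ secP.
have [g gb gE] := Fflat _ _ _ (@sincl_inj _ _ (kernel cov)) _ c'b.
pose h k x := c k x - g k (p x).
have hb : balanced h by apply: balancedB => //; exact: (balanced_pre idfun p gb).
have h0 k x : cov k = 0 -> h k x = 0.
  move=> k0; pose k' := @SubM _ _ (kernel cov) k k0.
  by rewrite /h (gE k') /= -(csec k') subrr.
have hcov k k' x : cov k = cov k' -> h k x = h k' x.
  move=> kk'; apply: subr0_eq; rewrite -balancedNl // -balancedDl //.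
  by apply: h0; rewrite linearB kk' subrr.
exists (fun u x => h (gen _ u) x).
  split=> [u u' x|u x x'|a u x].
  - by rewrite -(balancedDl hb); apply: hcov; rewrite linearD !free_lift_gen.
  - exact: (balancedDr hb).
  - by rewrite -(balancedZ hb); apply: hcov; rewrite linearZ !free_lift_gen.
by move=> u m; rewrite /h ci free_lift_gen (ses0 _ ip) balanced0r ?subr0.
Qed.

Section FlatExtension.
Variables (M M' F : lmodType R) (i : {linear M -> M'}) (p : {linear M' -> F}).
Hypotheses (ip : ses i p) (Fflat : charflat F).

Lemma charflat_extension : charflat M -> charflat M'.
Proof.
move=> Mflat A B j j_inj b bb.
have [g gb gE] := Mflat A B j j_inj _ (balanced_pre idfun i bb).
have [g' gb' gE'] := charflat_ext_pairing ip Fflat gb.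
have [sec secP] := choice (ses_surj ip).
pose h a x := b a x - g' (j a) x.
have hb : balanced h by apply: balancedB => //; exact: (balanced_pre j idfun gb').
have hsec a x : h a (sec (p x)) = h a x.
  apply: subr0_eq; rewrite -balancedNr // -balancedDr //.
  have /(ses_ker ip)[m <-] : p (sec (p x) - x) = 0 by rewrite linearB secP subrr.
  by rewrite /h gE' gE subrr.
have h'b : balanced (fun a y => h a (sec y)).
  split=> [a a' y|a y y'|r a y].
  - exact: (balancedDl hb).
  - by rewrite -(balancedDr hb) -[RHS]hsec linearD !secP.
  - by rewrite (balancedZ hb) -[LHS]hsec linearZ secP.
have [k kb kE] := Fflat j_inj h'b.
exists (fun y x => g' y x + k y (p x)).
  by apply: balancedD => //; exact: (balanced_pre idfun p kb).
by move=> a x; rewrite kE hsec addrC subrK.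
Qed.

Lemma charflat_kernel : charflat M' -> charflat M.
Proof.
move=> M'flat A B j j_inj b bb.
have [g gb gE] := charflat_ext_pairing ip Fflat bb.
have [h hb hE] := M'flat A B j j_inj _ gb.
exists (fun y m => h y (i m)); first exact: (balanced_pre idfun i hb).
by move=> a m; rewrite hE gE.
Qed.
End FlatExtension.
End CharacterFlat.

(** * Flat dimension *)

Section FlatDimension.
Variable R : pzRingType.
Implicit Types M A B F G Z : lmodType R.

(** Flat dimension at most k, in the form in which it is used: every flat cover
    has a kernel of smaller dimension. *)
Fixpoint flatdim (k : nat) M : Prop :=
  if k is k'.+1 then
    forall F Z (i : {linear Z -> F}) (p : {linear F -> M}),
      ses i p -> charflat F -> flatdim k' Z
  else charflat M.

Lemma free_cover M : exists (e : {linear freemod R M -> M}),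
  forall y, exists x, e x = y.
Proof. by exists (free_lift id) => y; exists (gen R y); exact: free_lift_gen. Qed.

(** The kernel of G -> B -> F is an extension of M by Z. *)
Lemma ses_comp_ker M B F G Z (i : {linear M -> B}) (p : {linear B -> F})
    (e : {linear G -> B}) (z : {linear Z -> G}) : ses i p -> ses z e ->
  exists (G' : lmodType R) (i' : {linear G' -> G}) (p' : {linear G -> F})
    (z' : {linear Z -> G'}) (e' : {linear G' -> M}), ses i' p' /\ ses z' e'.
Proof.
move=> ip ze; pose p' : {linear G -> F} := p \o e.
have p'_surj y : exists x, p' x = y.
  by have [b <-] := ses_surj ip y; have [g <-] := ses_surj ze b; exists g.
have [s sP] := choice (fun g : subm (kernel p') =>
  (ses_ker ip (e (sincl g))).1 (sinclP g)).
have sL : linear s.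
  move=> a x y; apply: (ses_inj ip); rewrite linearP !sP.
  by rewrite -linearP.
have [z' z'E] := @subm_lift _ _ _ (kernel p') z (fun x =>
  etrans (congr1 p (ses0 x ze)) (linear0 p)).
exists (subm (kernel p')), (sincl (S := _)), p', z', (lin sL).
split; first exact: kernel_ses.
split.
- by move=> x y /(congr1 (sincl (S := _))); rewrite !z'E => /(ses_inj ze).
- move=> m; have [g eg] := ses_surj ze (i m).
  have p'g : p' g = 0 by rewrite /p' /= eg (ses0 _ ip).
  by exists (@SubM _ _ (kernel p') g p'g); apply: (ses_inj ip); rewrite sP.
- move=> g; split=> [sg|[x <-]].
    have /(ses_ker ze)[x xg] : e (sincl g) = 0.
      by rewrite -sP -[s g]/(lin sL g) sg linear0.
    by exists x; apply: sincl_inj; rewrite z'E.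
  by apply: (ses_inj ip); rewrite linear0 sP z'E (ses0 _ ze).
Qed.

Lemma flatdim_extension k M B F (i : {linear M -> B}) (p : {linear B -> F}) :
  ses i p -> charflat F -> flatdim k M -> flatdim k B.
Proof.
case: k => [|k] ip Fflat; first exact: charflat_extension ip Fflat.
move=> Mk G Z z e ze Gflat.
have [G' [i' [p' [z' [e' [ip' ze']]]]]] := ses_comp_ker ip ze.
exact: Mk ze' (charflat_kernel ip' Fflat Gflat).
Qed.

(** A cover of M by G and a free cover of B together cover B. The kernel of this
    cover contains the kernel Z of G -> M, and the quotient is the kernel of the
    map from the free module onto F, which is flat. *)
Lemma flatdim_kernel k M B F (i : {linear M -> B}) (p : {linear B -> F}) :
  ses i p -> charflat F -> flatdim k B -> flatdim k M.
Proof.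
elim: k M B F i p => [|k IH] M B F i p ip Fflat.
  exact: charflat_kernel ip Fflat.
move=> Bk G Z z e ze Gflat.
have [c c_surj] := free_cover B.
have eL : linear (fun x : (G * freemod R B)%type => i (e x.1) + c x.2).
  by move=> a [x y] [x' y'] /=; rewrite !linearP scalerDr addrACA.
pose e2 := lin eL.
have e2_surj y : exists x, e2 x = y.
  by have [x <-] := c_surj y; exists (0, x); rewrite /= !linear0 add0r.
have k1 := kernel_ses e2_surj.
have G2flat : charflat (G * freemod R B)%type.
  have l1 : linear (fun x : G => (x, 0 : freemod R B)).
    by move=> a x y; congr (_, _); rewrite /= scaler0 addr0.
  have l2 : linear (fun x : (G * freemod R B)%type => x.2) by [].
  apply: (@charflat_extension _ _ _ _ (lin l1) (lin l2)) Gflat.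
    split.
    - by move=> x y [].
    - by move=> y; exists (0, y).
    - by move=> [x y]; split=> [/= ->|[a [_ <-]]] //; exists x.
  exact: charflat_free.
have ZBk := Bk _ _ _ _ k1 G2flat.
pose pc : {linear freemod R B -> F} := p \o c.
have pc_surj y : exists x, pc x = y.
  by have [b <-] := ses_surj ip y; have [x <-] := c_surj b; exists x.
have k2 := kernel_ses pc_surj.
have K2flat := charflat_kernel k2 Fflat (@charflat_free R B).
have zK x : kernel e2 (z x, 0) by rewrite /= (ses0 _ ze) !linear0 addr0.
have z1L : linear (fun x : Z => (z x, 0 : freemod R B)).
  by move=> a x y; rewrite linearP; congr (_, _); rewrite /= scaler0 addr0.
have [z2 z2E] := @subm_lift _ _ _ (kernel e2) (lin z1L) zK.
have sK (x : subm (kernel e2)) : kernel pc (sincl x).2.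
  rewrite /= /pc /=; have := sinclP x => /= /(congr1 p).
  by rewrite linearD (ses0 _ ip) add0r linear0.
have s1L : linear (fun x : subm (kernel e2) => (sincl x).2) by [].
have [s2 s2E] := @subm_lift _ _ _ (kernel pc) (lin s1L) sK.
apply: (IH Z _ _ z2 s2) K2flat ZBk; split.
- by move=> x y /(congr1 (fun w => (sincl w).1)); rewrite !z2E => /(ses_inj ze).
- move=> y; have /(ses_ker ip)[m im] : p (- c (sincl y)) = 0.
    by rewrite linearN; have := sinclP y => /= ->; rewrite oppr0.
  have [g gm] := ses_surj ze m.
  have gyK : kernel e2 (g, sincl y) by rewrite /= gm im addNr.
  by exists (SubM gyK); apply: sincl_inj; rewrite s2E.
- move=> x; split=> [s2x|[w <-]].
    have x2 : (sincl x).2 = 0 by have := s2E x; rewrite s2x.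
    have /(ses_ker ze)[w wx] : e (sincl x).1 = 0.
      apply: (ses_inj ip); rewrite linear0.
      by have := sinclP x; rewrite /= x2 linear0 addr0.
    exists w; apply: sincl_inj; rewrite z2E /= wx.
    by case: (sincl x) x2 => u v /= ->.
  by apply: sincl_inj; rewrite s2E /= z2E.
Qed.

(** Schanuel's lemma: two flat covers of the same module have kernels of the
    same flat dimension, by comparison with the pullback of the covers. *)
Lemma flatdim_cover k M F Z (i : {linear Z -> F}) (p : {linear F -> M}) :
  ses i p -> charflat F -> flatdim k Z -> flatdim k.+1 M.
Proof.
move=> ip Fflat Zk F' Z' i' p' ip' F'flat.
have dL : linear (fun x : (F * F')%type => p x.1 - p' x.2).
  by move=> a [x y] [x1 y1] /=; rewrite (linearP p) (linearP p') scalerBr opprD addrACA.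
pose P := kernel (lin dL).
have f1 : linear (fun x : subm P => (sincl x).1) by [].
have f2 : linear (fun x : subm P => (sincl x).2) by [].
have pP (x : subm P) : p (sincl x).1 = p' (sincl x).2.
  by apply: subr0_eq; exact: (sinclP x).
have i1L : linear (fun x : Z => (i x, 0 : F')).
  by move=> a x y; rewrite linearP; congr (_, _); rewrite /= scaler0 addr0.
have i2L : linear (fun x : Z' => (0 : F, i' x)).
  by move=> a x y; rewrite linearP; congr (_, _); rewrite /= scaler0 addr0.
have [j1 j1E] := @subm_lift _ _ _ P (lin i1L)
  (fun x => etrans (congr1 (fun t => t - p' 0) (ses0 x ip))
                   (etrans (congr1 (fun t => 0 - t) (linear0 p')) (subr0 0))).
have [j2 j2E] := @subm_lift _ _ _ P (lin i2L)
  (fun x => etrans (congr1 (fun t => p 0 - t) (ses0 x ip'))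
                   (etrans (congr1 (fun t => t - 0) (linear0 p)) (subr0 0))).
have s1 : ses j1 (lin f2).
  split.
  - by move=> x y /(congr1 (fun w => (sincl w).1)); rewrite !j1E => /(ses_inj ip).
  - move=> y; have [x xy] := ses_surj ip (p' y).
    have xyP : P (x, y) by rewrite /= xy subrr.
    by exists (SubM xyP).
  - move=> x; split=> [/= x2|[a <-]]; last by rewrite /= j1E.
    have /(ses_ker ip)[a ax] : p (sincl x).1 = 0 by rewrite pP x2 linear0.
    exists a; apply: sincl_inj; rewrite j1E /= ax.
    by case: (sincl x) x2 => u v /= ->.
have s2 : ses j2 (lin f1).
  split.
  - by move=> x y /(congr1 (fun w => (sincl w).2)); rewrite !j2E => /(ses_inj ip').
  - move=> x; have [y yx] := ses_surj ip' (p x).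
    have xyP : P (x, y) by rewrite /= yx subrr.
    by exists (SubM xyP).
  - move=> x; split=> [/= x1|[a <-]]; last by rewrite /= j2E.
    have /(ses_ker ip')[a ax] : p' (sincl x).2 = 0 by rewrite -pP x1 linear0.
    exists a; apply: sincl_inj; rewrite j2E /= ax.
    by case: (sincl x) x1 => u v /= ->.
exact: flatdim_kernel s2 Fflat (flatdim_extension s1 F'flat Zk).
Qed.

Lemma flatdim_resolution n M (F : nat -> lmodType R)
    (d : forall i, {linear F i.+1 -> F i}) (e : {linear F 0%N -> M}) :
  (forall i, charflat (F i)) -> (forall i, (n < i)%N -> forall x : F i, x = 0) ->
  (forall m, exists x, e x = m) -> (forall x, e x = 0 <-> exists y, d 0%N y = x) ->
  (forall i x, d i x = 0 <-> exists y, d i.+1 y = x) -> flatdim n M.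
Proof.
elim: n M F d e => [|n IH] M F d e Fflat F0 e_surj e_ker d_ker.
  have [s sP] := choice e_surj.
  have e_inj : injective e.
    by apply: linear_inj => x /e_ker[y <-]; rewrite (F0 1%N isT y) linear0.
  have sL : linear s by move=> a x y; apply: e_inj; rewrite linearP !sP.
  exact: (@charflat_retract _ _ _ (lin sL) e sP).
have [d0 d0E] := @subm_lift _ _ _ (kernel e) (d 0%N)
  (fun y => (e_ker (d 0%N y)).2 (ex_intro _ y erefl)).
apply: (flatdim_cover (kernel_ses e_surj)) => //.
apply: (IH _ (fun i => F i.+1) (fun i => d i.+1) d0) => //.
- by move=> i ni; exact: F0.
- move=> m; have /e_ker[y ym] := sinclP m.
  by exists y; apply: sincl_inj; rewrite d0E.
- move=> x; split=> [x0|/d_ker x0].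
    by apply/d_ker; rewrite -d0E x0.
  by apply: sincl_inj; rewrite d0E.
Qed.

Lemma weak_gldim_flatdim : finite_weak_gldim R ->
  exists n, forall M, flatdim n M.
Proof.
move=> [n nP]; exists n => M; have [F [d [e [Fflat F0 e1 e2 e3]]]] := nP M.
by apply: (flatdim_resolution (e := e)) => // i; exact/flat_charflat.
Qed.

(** Ext^1(Y, M) = 0 for every flat module Y, as an extension property. *)
Definition cotorsion_module M : Prop :=
  forall (A B Y : lmodType R) (i : {linear A -> B}) (p : {linear B -> Y}), ses i p ->
  charflat Y -> forall f : {linear A -> M},
  exists g : {linear B -> M}, forall a, g (i a) = f a.

Lemma cotorsion_retract M M' (i : {linear M -> M'}) (p : {linear M' -> M}) :
  (forall x, p (i x) = x) -> cotorsion_module M' -> cotorsion_module M.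
Proof.
move=> pi M'c A B Y j q jq Yflat f.
have [g gE] := M'c _ _ _ _ _ jq Yflat (i \o f : {linear A -> M'}).
by exists (p \o g) => a; rewrite /= gE /= pi.
Qed.
End FlatDimension.

(** * The abelian category of additive functors *)

Lemma comp0m (Q : preadditive) (p q r : Q) (f : mor p q) : (0 : mor q r) \oc f = 0.
Proof. by apply: (@additive0 _ _ (fun g : mor q r => g \oc f)) => x y; exact: compDl. Qed.

Definition comp_ahoml (Q : preadditive) (p q r : Q) (g : mor q r) :
  ahom (mor p q) (mor p r) := AHom (compDr g).
Definition comp_ahomr (Q : preadditive) (p q r : Q) (f : mor p q) :
  ahom (mor q r) (mor p r) := AHom (fun g g' => compDl g g' f).

Section Functors.
Variables (Q : preadditive) (R : pzRingType).
Implicit Types X Y Z N M : qmod Q R.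

Definition mact_ahom X p q (x : X p) : ahom (mor p q) (X q) :=
  AHom (fun f g => mactD f g x).

Lemma mact0 X p q (x : X p) : mact X (0 : mor p q) x = 0.
Proof. exact: (raddf0 (mact_ahom q x)). Qed.

Definition qmk X Y (f : forall q, X q -> Y q) (fL : forall q, linear (f q))
    (fN : forall p q (u : mor p q) x, f q (mact X u x) = mact Y u (f p x)) :
  qhom X Y := @QHom Q R X Y (fun q => lin (fL q)) fN.

Definition qid X : qhom X X.
Proof. by apply: (@qmk X X (fun q x => x)). Defined.

Definition qcomp X Y Z (g : qhom Y Z) (f : qhom X Y) : qhom X Z.
Proof.
apply: (@qmk X Z (fun q x => g q (f q x))) => [q a x y|p q u x].
  by rewrite !linearP.
by rewrite !qnat.
Defined.

Definition qsubh X Y (f g : qhom X Y) : qhom X Y.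
Proof.
apply: (@qmk X Y (fun q x => f q x - g q x)) => [q a x y|p q u x].
  by rewrite (linearP (f q)) (linearP (g q)) scalerBr opprD addrACA.
by rewrite !qnat linearB.
Defined.

Record subfunctor X := Subfunctor {
  sfob :> forall q, submodule (X q);
  sfact : forall p q (u : mor p q) x, sfob p x -> sfob q (mact X u x) }.

Section SubQuotient.
Variables (X : qmod Q R) (S : subfunctor X).

Definition qsub_act p q (u : mor p q) (x : subm (S p)) : subm (S q) :=
  SubM (sfact u (sinclP x)).
Lemma qsub_act_linear p q (u : mor p q) : linear (qsub_act u).
Proof. by move=> a x y; apply: sincl_inj; rewrite /= linearP. Qed.
Definition qsub : qmod Q R.
Proof.
apply: (@QMod Q R (fun q => subm (S q)) (fun p q u => lin (@qsub_act_linear p q u))).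
- by move=> p q f g x; apply: sincl_inj; rewrite /= mactD.
- by move=> q x; apply: sincl_inj; rewrite /= mact1.
- by move=> p q r g f x; apply: sincl_inj; rewrite /= mactM.
Defined.

Definition qincl : qhom qsub X.
Proof. by apply: (@qmk qsub X (fun q => sincl (S := S q))). Defined.

Definition qquot_act p q (u : mor p q) (x : quot (S p)) : quot (S q) :=
  qpi (S q) (mact X u (qval x)).
Lemma qquot_actE p q (u : mor p q) x :
  qquot_act u (qpi (S p) x) = qpi (S q) (mact X u x).
Proof.
by apply: qpi_eq; rewrite -linearB; apply: sfact; exact: qval_qpi.
Qed.
Lemma qquot_act_linear p q (u : mor p q) : linear (qquot_act u).
Proof.
move=> a x y; rewrite -[x]qvalK -[y]qvalK -linearP !qquot_actE.
by rewrite !linearP.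
Qed.
Definition qquot : qmod Q R.
Proof.
apply: (@QMod Q R (fun q => quot (S q)) (fun p q u => lin (@qquot_act_linear p q u))).
- by move=> p q f g x; rewrite -[x]qvalK /= !qquot_actE mactD linearD.
- by move=> q x; rewrite -[x]qvalK /= qquot_actE mact1.
- by move=> p q r g f x; rewrite -[x]qvalK /= !qquot_actE mactM.
Defined.

Definition qproj : qhom X qquot.
Proof.
apply: (@qmk X qquot (fun q => qpi (S q))) => [q|p q u x].
  exact: qpi_linear.
by rewrite /= qquot_actE.
Defined.
End SubQuotient.

Definition qkernel X Y (f : qhom X Y) : subfunctor X.
Proof.
exists (fun q => kernel (f q)) => p q u x /= fx.
by rewrite qnat fx linear0.
Defined.

Definition image_submod (A B : lmodType R) (f : {linear A -> B}) : submodule B.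
Proof.
exists (fun y => exists x, f x = y); first by exists 0; exact: linear0.
by move=> a _ _ [x <-] [y <-]; exists (a *: x + y); rewrite linearP.
Defined.

Definition qimage X Y (f : qhom X Y) : subfunctor Y.
Proof.
exists (fun q => image_submod (f q)) => p q u _ [x <-] /=.
by exists (mact X u x); rewrite qnat.
Defined.

Definition qses X Y Z (i : qhom X Y) (p : qhom Y Z) : Prop :=
  forall q, ses (i q) (p q).

Lemma qses_split X Y Z (i : qhom X Y) (p : qhom Y Z) :
  qses i p <-> [/\ qmono i, qexact i p & qepi p].
Proof.
split=> [ip|[im ex ep] q]; last by split; [exact: im|exact: ep|exact: ex].
split=> q; [exact: ses_inj (ip q)|move=> y; exact: (ses_ker (ip q))|].
exact: (ses_surj (ip q)).
Qed.

Lemma qkernel_ses X Y (f : qhom X Y) : qepi f -> qses (qincl (qkernel f)) f.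
Proof. by move=> f_epi q; have [a b c] := kernel_ses (f_epi q); split. Qed.

Lemma qimage_ses X Y (f : qhom X Y) : qmono f -> qses f (qproj (qimage f)).
Proof.
move=> f_mono q; split; first exact: f_mono.
- by move=> y; exists (qval y); exact: qvalK.
- by move=> x; exact: qpi_eq0.
Qed.

Lemma qses_factor X Y Z W (i : qhom X Y) (p : qhom Y Z) (h : qhom Y W) :
  qses i p -> (forall q x, h q (i q x) = 0) ->
  exists k : qhom Z W, forall q y, k q (p q y) = h q y.
Proof.
move=> ip hi.
have [s sP] := dchoice2 (fun q => ses_surj (ip q)).
have sE q y : h q (s q (p q y)) = h q y.
  apply: subr0_eq; rewrite -linearB.
  have /(ses_ker (ip q))[x <-] : p q (s q (p q y) - y) = 0.
    by rewrite linearB sP subrr.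
  exact: hi.
have kL q : linear (fun z => h q (s q z)).
  by move=> a x y; rewrite -linearP -[RHS]sE linearP !sP.
have kN p' q (u : mor p' q) z : h q (s q (mact Z u z)) = mact W u (h p' (s p' z)).
  by rewrite -qnat -[RHS]sE qnat sP.
by exists (qmk kL kN).
Qed.

Lemma qses_lift X Y Z W (i : qhom X Y) (p : qhom Y Z) (h : qhom W Y) :
  qses i p -> (forall q x, p q (h q x) = 0) ->
  exists k : qhom W X, forall q x, i q (k q x) = h q x.
Proof.
move=> ip ph.
have [s sP] := dchoice2 (fun q x => (ses_ker (ip q) (h q x)).1 (ph q x)).
have i_inj q := ses_inj (ip q).
have kL q : linear (s q).
  by move=> a x y; apply: (i_inj q); rewrite linearP !sP linearP.
have kN p' q (u : mor p' q) x : s q (mact W u x) = mact X u (s p' x).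
  by apply: (i_inj q); rewrite qnat !sP qnat.
by exists (qmk kL kN).
Qed.

(** * Extensions *)

Definition qprod_act X Y p q (u : mor p q) (x : X p * Y p) : X q * Y q :=
  (mact X u x.1, mact Y u x.2).
Lemma qprod_act_linear X Y p q (u : mor p q) : linear (@qprod_act X Y p q u).
Proof.
move=> a x y; rewrite /qprod_act.
by congr (_, _); rewrite /= linearP.
Qed.
Definition qprod X Y : qmod Q R.
Proof.
apply: (@QMod Q R (fun q => (X q * Y q)%type)
  (fun p q u => lin (@qprod_act_linear X Y p q u))).
- by move=> p q f g x; rewrite /= /qprod_act !mactD.
- by move=> q [x y]; rewrite /= /qprod_act !mact1.
- by move=> p q r g f x; rewrite /= /qprod_act !mactM.
Defined.

Lemma Ext1_zero_retract M N E (i : qhom N E) (p : qhom E M) :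
  Ext1_zero M N -> qses i p -> exists r : qhom E N, forall q x, r q (i q x) = x.
Proof.
move=> MN ip; have [im ex ep] := (qses_split i p).1 ip.
have [s sP] := MN E i p im ex ep.
have [|r rE] := @qses_lift _ _ _ _ i p (qsubh (qid E) (qcomp s p)) ip.
  by move=> q x; rewrite /= linearB sP subrr.
exists r => q x; apply: im; rewrite rE /=.
by rewrite (ses0 _ (ip q)) linear0 subr0.
Qed.

Lemma Ext1_zero_of_retract M N :
  (forall E (i : qhom N E) (p : qhom E M), qses i p ->
     exists r : qhom E N, forall q x, r q (i q x) = x) -> Ext1_zero M N.
Proof.
move=> H E i p im ex ep; have ip : qses i p by apply/qses_split.
have [r rP] := H E i p ip.
have [|k kE] := @qses_factor _ _ _ _ i p (qsubh (qid E) (qcomp i r)) ip.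
  by move=> q x; rewrite /= rP subrr.
exists k => q y; have [x <-] := ep q y.
by rewrite kE /= linearB (ses0 _ (ip q)) subr0.
Qed.

(** By pushout of the extension along f. *)
Lemma Ext1_zero_extend M N A B (i : qhom A B) (p : qhom B M) (f : qhom A N) :
  Ext1_zero M N -> qses i p ->
  exists g : qhom B N, forall q x, g q (i q x) = f q x.
Proof.
move=> MN ip.
have dL q : linear (fun x : A q => (f q x, - i q x) : qprod N B q).
  move=> a x y; congr (_, _); first by rewrite linearP.
  by rewrite /= linearP opprD scalerN.
have dN p' q (u : mor p' q) (x : A p') : (f q (mact A u x), - i q (mact A u x)) =
    mact (qprod N B) u ((f p' x, - i p' x) : qprod N B p').
  by rewrite !qnat -linearN.
pose d : qhom A (qprod N B) := qmk dL dN; pose E := qquot (qimage d).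
have jL q : linear (fun x : N q => qpi (qimage d q) ((x, 0) : qprod N B q) : E q).
  move=> a x y; rewrite -[RHS]linearP; congr qpi; congr (_, _).
  by rewrite /= scaler0 addr0.
have jN p' q (u : mor p' q) (x : N p') :
    qpi (qimage d q) ((mact N u x, 0) : qprod N B q) =
    mact E u (qpi (qimage d p') ((x, 0) : qprod N B p')).
  rewrite /= qquot_actE; congr qpi; congr (_, _).
  by rewrite /= linear0.
pose j : qhom N E := qmk jL jN.
have tL q : linear (fun x : qprod N B q => p q x.2).
  by move=> a x y; rewrite /= linearP.
have tN p' q (u : mor p' q) (x : qprod N B p') :
    p q (mact (qprod N B) u x).2 = mact M u (p p' x.2) by rewrite qnat.
have prE : qses (qincl (qimage d)) (qproj (qimage d)).
  by move=> q; have [a b c] := quot_ses (qimage d q); split.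
have [|k kE] := @qses_factor _ _ _ _ _ _ (qmk tL tN) prE.
  by move=> q [w [x wx]] /=; rewrite -wx /= linearN (ses0 _ (ip q)) oppr0.
have jk : qses j k.
  move=> q; split.
  - apply: linear_inj => x /= /qpi_eq0 [a [<- ia]].
    have a0 : a = 0 by apply: (ses_inj (ip q)); rewrite linear0 -[LHS]opprK ia oppr0.
    by rewrite a0 linear0.
  - move=> m; have [b <-] := ses_surj (ip q) m.
    by exists (qproj (qimage d) q (0, b)); rewrite kE.
  - move=> x; rewrite -[x]qvalK -[qpi _ (qval x)]/(qproj (qimage d) q (qval x)).
    rewrite kE /=; case: (qval x) => n b /=; split.
      move=> /(ses_ker (ip q))[a <-]; exists (n + f q a).
      by apply: qpi_eq; exists a; congr (_, _); rewrite /= ?addrK ?sub0r // addrC addKr.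
    move=> [m mE]; have /= := congr1 (k q) mE.
    rewrite -[qpi _ (m, 0)]/(qproj (qimage d) q (m, 0)).
    rewrite -[qpi _ (n, b)]/(qproj (qimage d) q (n, b)) !kE /= linear0.
    by move=> <-.
have [r rP] := Ext1_zero_retract MN jk.
have gL q : linear (fun b : B q => r q (qproj (qimage d) q (0, b))).
  move=> a x y; rewrite -!linearP; congr (r q _); congr (qproj _ q _).
  by congr (_, _); rewrite /= scaler0 addr0.
have gN p' q (u : mor p' q) (b : B p') :
    r q (qproj (qimage d) q (0, mact B u b)) =
    mact N u (r p' (qproj (qimage d) p' (0, b))).
  rewrite -!qnat; congr (r q _); congr (qproj _ q _).
  by congr (_, _); rewrite /= linear0.
exists (qmk gL gN) => q x; rewrite /= -[RHS]rP; congr (r q _).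
apply: qpi_eq; exists (- x); congr (_, _).
  by rewrite /= linearN sub0r.
by rewrite /= linearN opprK subr0.
Qed.

(** By pullback of the extension along g. *)
Lemma Ext1_zero_lift M N B C (i : qhom N B) (p : qhom B C) (g : qhom M C) :
  Ext1_zero M N -> qses i p ->
  exists h : qhom M B, forall q x, p q (h q x) = g q x.
Proof.
move=> MN ip.
have dL q : linear (fun x : qprod B M q => p q x.1 - g q x.2).
  move=> a x y; rewrite /= (linearP (p q)) (linearP (g q)).
  by rewrite scalerBr opprD addrACA.
have dN p' q (u : mor p' q) (x : qprod B M p') :
    p q (mact (qprod B M) u x).1 - g q (mact (qprod B M) u x).2 =
    mact C u (p p' x.1 - g p' x.2) by rewrite /= !qnat linearB.
pose d : qhom (qprod B M) C := qmk dL dN; pose E := qsub (qkernel d).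
have jL q : linear (fun x : N q => (i q x, 0) : qprod B M q).
  move=> a x y; congr (_, _); first by rewrite linearP.
  by rewrite /= scaler0 addr0.
have jN p' q (u : mor p' q) (x : N p') : ((i q (mact N u x), 0) : qprod B M q) =
    mact (qprod B M) u ((i p' x, 0) : qprod B M p').
  by rewrite qnat; congr (_, _); rewrite /= linear0.
pose j : qhom N (qprod B M) := qmk jL jN.
have k1 : qses (qincl (qkernel d)) (qproj (qkernel d)).
  by move=> q; have [a b c] := quot_ses (qkernel d q); split.
have [|j' j'E] := @qses_lift _ _ _ _ _ _ j k1.
  by move=> q x; apply/qpi_eq0; rewrite /= (ses0 _ (ip q)) linear0 subrr.
have tL q : linear (fun x : E q => (sincl x).2) by [].
have tN p' q (u : mor p' q) (x : E p') :
  (sincl (mact E u x)).2 = mact M u (sincl x).2 by [].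
pose t : qhom E M := qmk tL tN.
have EP q (x : E q) : p q (sincl x).1 = g q (sincl x).2.
  by apply: subr0_eq; exact: (sinclP x).
have [|||s sP] := MN E j' t.
- move=> q x y /(congr1 (fun w => (sincl w).1)).
  rewrite -![sincl (j' _ _)]/(qincl (qkernel d) q (j' q _)) !j'E.
  exact: (ses_inj (ip q)).
- move=> q y; split=> [y2|[x <-]]; last first.
    by rewrite /= -[sincl _]/(qincl (qkernel d) q (j' q x)) j'E.
  have /(ses_ker (ip q))[x xy] : p q (sincl y).1 = 0.
    by rewrite EP -[(sincl y).2]/(t q y) y2 linear0.
  exists x; apply: sincl_inj.
  rewrite -[sincl (j' _ _)]/(qincl (qkernel d) q (j' q _)) j'E /= xy.
  by move: y2 => /=; case: (sincl y) => u v /= ->.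
- move=> q m; have [b bm] := ses_surj (ip q) (g q m).
  have bmP : qkernel d q (b, m) by rewrite /= bm subrr.
  by exists (SubM bmP).
have hL q : linear (fun m : M q => (sincl (s q m)).1).
  by move=> a x y; rewrite linearP.
have hN p' q (u : mor p' q) (m : M p') :
    (sincl (s q (mact M u m))).1 = mact B u (sincl (s p' m)).1.
  by rewrite qnat.
by exists (qmk hL hN) => q m; rewrite /= EP; congr (g q _); exact: sP.
Qed.
End Functors.

(** * Coinduced functors *)

Definition ahom_comp (A B C : zmodType) (g : ahom B C) (f : ahom A B) : ahom A C.
Proof. by exists (fun x => g (f x)) => x y; rewrite !raddfD. Defined.

Section Coinduced.
Variables (Q : preadditive) (R : pzRingType) (J : Type) (o : J -> Q).
Variable M : J -> lmodType R.

Definition coind_ob (p : Q) := dprod (fun j => ahom (mor p (o j)) (M j)).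

Definition coind_act p q (u : mor p q) (l : coind_ob p) : coind_ob q :=
  fun j => ahom_comp (l j) (comp_ahomr _ u).

Lemma coind_act_linear p q (u : mor p q) : linear (coind_act u).
Proof. by move=> a x y; apply: dprodP => j; apply: ahomP. Qed.

Definition coind : qmod Q R.
Proof.
apply: (@QMod Q R (fun p => coind_ob p) (fun p q u => lin (@coind_act_linear p q u))).
- move=> p q f g x; apply: dprodP => j; apply: ahomP => y.
  by rewrite /= compDr raddfD.
- by move=> q x; apply: dprodP => j; apply: ahomP => y; rewrite /= compm1.
- by move=> p q r g f x; apply: dprodP => j; apply: ahomP => y; rewrite /= Defs.compA.
Defined.

Lemma coindP p (l l' : coind p) : (forall j x, l j x = l' j x) -> l = l'.
Proof. by move=> ll'; apply: dprodP => j; apply: ahomP => x; exact: ll'. Qed.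

Lemma coev_linear j : linear (fun l : coind (o j) => l j (idm (o j))).
Proof. by []. Qed.
Definition coev j : {linear coind (o j) -> M j} := lin (@coev_linear j).

(** The functors coind are right adjoint to evaluation at the objects o j. *)
Definition coind_map (Y : qmod Q R) (g : forall j, {linear Y (o j) -> M j}) :
  qhom Y coind.
Proof.
apply: (@qmk _ _ Y coind (fun p y j => ahom_comp
   (AHom (fun a b => linearD (g j) a b)) (mact_ahom (o j) y))).
- move=> p a x y; apply: coindP => j u.
  by rewrite /= !linearP.
- by move=> p q u x; apply: coindP => j v; rewrite /= mactM.
Defined.

Lemma coind_mapE (Y : qmod Q R) (g : forall j, {linear Y (o j) -> M j}) p y j x :
  coind_map g p y j x = g j (mact Y x y).
Proof. by []. Qed.

Lemma coind_homE (Y : qmod Q R) (h : qhom Y coind) p y j x :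
  h p y j x = coev j (h (o j) (mact Y x y)).
Proof. by rewrite qnat /= comp1m. Qed.

Lemma coind_hom_ext (Y : qmod Q R) (h h' : qhom Y coind) :
  (forall j y, coev j (h (o j) y) = coev j (h' (o j) y)) ->
  forall p y, h p y = h' p y.
Proof. by move=> hh' p y; apply: coindP => j x; rewrite !coind_homE hh'. Qed.
End Coinduced.

Definition coind_functor (Q : preadditive) (R : pzRingType) (J : Type) (o : J -> Q)
    (M N : J -> lmodType R) (g : forall j, {linear M j -> N j}) :
  qhom (coind o M) (coind o N) := coind_map (fun j => g j \o coev o M j).

(** * Duality data *)

(** The part of a Serre functor that the argument uses: a perfect natural
    pairing between mor q p and mor p (dob q), made explicit by dual bases,
    for which every object is a retract of a value of dob. In this form it
    passes to the opposite category. *)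
Record duality (Q : preadditive) := Duality {
  dob : Q -> Q;
  dpair : forall q p, mor q p -> mor p (dob q) -> int;
  dpairDl : forall q p (f g : mor q p) x, dpair (f + g) x = dpair f x + dpair g x;
  dpairDr : forall q p (f : mor q p) x y, dpair f (x + y) = dpair f x + dpair f y;
  dpair_nat : forall q p p' (u : mor p p') (f : mor q p) (x : mor p' (dob q)),
    dpair (u \oc f) x = dpair f (x \oc u);
  dnum : Q -> Q -> nat;
  dbas : forall q p, 'I_(dnum q p) -> mor q p;
  dcobas : forall q p, 'I_(dnum q p) -> mor p (dob q);
  dexpr : forall q p (x : mor p (dob q)),
    x = \sum_i dcobas i *~ dpair (dbas i) x;
  dexpl : forall q p (g : mor q p), g = \sum_i dbas i *~ dpair g (dcobas i);
  dretr : forall p, exists q (a : mor p (dob q)) (b : mor (dob q) p),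
    b \oc a = idm p }.

Definition locally_finite (Q : preadditive) (J : Type) (ob : J -> Q) : Prop :=
  forall p, exists n (s : 'I_n -> J), injective s /\
    forall j, (exists f : mor (ob j) p, f <> 0) -> exists k, s k = j.

Section InducedFunctors.
Variables (Q : preadditive) (d : duality Q).
Variables (J : Type) (ob : J -> Q) (obfin : locally_finite ob).

Definition near_num p := projT1 (cid (obfin p)).
Definition near p : 'I_(near_num p) -> J := projT1 (cid (projT2 (cid (obfin p)))).
Arguments near : clear implicits.
Lemma near_inj p : injective (near p).
Proof. exact: (projT2 (cid (projT2 (cid (obfin p))))).1. Qed.
Lemma nearP p j (f : mor (ob j) p) : f <> 0 -> exists k, near p k = j.
Proof.
by move=> f0; apply: (projT2 (cid (projT2 (cid (obfin p))))).2; exists f.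
Qed.

Definition basis p := {k : 'I_(near_num p) & 'I_(dnum d (ob (near p k)) p)}.
Definition bix p (t : basis p) : J := near p (tag t).
Definition bas p (t : basis p) : mor (ob (bix t)) p := dbas (tagged t).
Definition cobas p (t : basis p) : mor p (dob d (ob (bix t))) := dcobas (tagged t).

Section OverRing.
Variables (R : pzRingType) (M : J -> lmodType R).

(** By duality the coinduced functor on the objects dob (ob j) is also induced
    from the objects ob j: it is generated by the elements igen f m, which
    stand for f (x) m, subject only to biadditivity. *)
Definition ind : qmod Q R := coind (fun j => dob d (ob j)) M.

Definition pair_ahom p j (f : mor (ob j) p) (m : M j) :
  ahom (mor p (dob d (ob j))) (M j).
Proof.
by exists (fun x => m *~ dpair f x) => x y; rewrite dpairDr mulrzDr.
Defined.

Definition igen p j (f : mor (ob j) p) (m : M j) : ind p :=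
  dsingle (V := fun j => ahom (mor p (dob d (ob j))) (M j)) (pair_ahom f m).

Lemma igenE p j (f : mor (ob j) p) (m : M j) x : igen f m j x = m *~ dpair f x.
Proof. by rewrite /igen dsingle_same. Qed.

Lemma igen_neq p j j' (f : mor (ob j) p) (m : M j) x :
  j <> j' -> igen f m j' x = 0.
Proof. by move=> jj'; rewrite /igen dsingle_neq. Qed.

Lemma igenP p j (f : mor (ob j) p) (m : M j) (l : ind p) :
  (forall x, l j x = m *~ dpair f x) -> (forall j' x, j <> j' -> l j' x = 0) ->
  l = igen f m.
Proof.
move=> lj l0; apply: coindP => j' x.
have [jj'|jj'] := pselect (j = j'); last by rewrite l0 // igen_neq.
by subst j'; rewrite igenE.
Qed.

Lemma igen_linear p j (f : mor (ob j) p) : linear (@igen p j f).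
Proof.
move=> a x y; symmetry; apply: igenP => [z|j' z jj'].
  by rewrite dprodDE dprodZE ahomDE ahomZE !igenE mulrzDl scalerMzr.
by rewrite dprodDE dprodZE ahomDE ahomZE !igen_neq // scaler0 addr0.
Qed.

Lemma igenDr p j (f : mor (ob j) p) m m' : igen f (m + m') = igen f m + igen f m'.
Proof. exact: (linearD (lin (@igen_linear p j f))). Qed.

Lemma igenDl p j (f g : mor (ob j) p) m : igen (f + g) m = igen f m + igen g m.
Proof.
symmetry; apply: igenP => [z|j' z jj'].
  by rewrite dprodDE ahomDE !igenE dpairDl mulrzDr.
by rewrite dprodDE ahomDE !igen_neq // addr0.
Qed.

Lemma igen_act p q (u : mor p q) j (f : mor (ob j) p) m :
  mact ind u (igen f m) = igen (u \oc f) m.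
Proof.
apply: igenP => [x|j' x jj'].
  by rewrite -[LHS]/(igen f m j (x \oc u)) igenE dpair_nat.
by rewrite -[LHS]/(igen f m j' (x \oc u)) igen_neq.
Qed.

Lemma dpair0l q p (x : mor p (dob d q)) : dpair (0 : mor q p) x = 0.
Proof. by apply: (@additive0 _ _ (fun f => dpair f x)) => f g; exact: dpairDl. Qed.

Lemma ind_expand p (l : ind p) :
  l = \sum_(t : basis p) igen (bas t) (l (bix t) (cobas t)).
Proof.
apply: coindP => j x.
have -> : (\sum_(t : basis p) igen (bas t) (l (bix t) (cobas t))) j x =
    \sum_(t : basis p) igen (bas t) (l (bix t) (cobas t)) j x.
  rewrite (dprod_sumE (V := fun j => ahom (mor p (dob d (ob j))) (M j))).
  by elim/big_rec2: _ => // t y z _ <-.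
transitivity (\sum_(k < near_num p) \sum_(i < dnum d (ob (near p k)) p)
    igen (dbas i) (l (near p k) (dcobas i)) j x); last first.
  by rewrite sig_big_dep.
have [[k kj]|jnear] := pselect (exists k, near p k = j); last first.
  have j0 (f : mor (ob j) p) : f = 0.
    by apply: contrapT => /nearP.
  rewrite [x]dexpr big1 => [|i _]; last by rewrite (j0 (dbas i)) dpair0l mulr0z.
  rewrite raddf0 big1 // => k _; rewrite big1 // => i _.
  by rewrite igen_neq // => kj; apply: jnear; exists k.
subst j; rewrite (bigD1 k) //= [X in _ + X]big1 ?addr0 => [|k' k'k]; last first.
  rewrite big1 // => i _; rewrite igen_neq // => /near_inj kk'.
  by rewrite kk' eqxx in k'k.
rewrite {1}[x]dexpr raddf_sum; apply: eq_bigr => i _.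
by rewrite igenE raddfMz.
Qed.

Lemma ind_additive_ext (A : zmodType) p (F G : ind p -> A) :
  (forall x y, F (x + y) = F x + F y) -> (forall x y, G (x + y) = G x + G y) ->
  (forall j (f : mor (ob j) p) m, F (igen f m) = G (igen f m)) -> F =1 G.
Proof.
move=> FD GD FG l; rewrite [l]ind_expand.
elim/big_ind: _ => [|x y Fx Fy|t _]; [|by rewrite FD GD Fx Fy|exact: FG].
by rewrite (additive0 FD) (additive0 GD).
Qed.

Section Lift.
Variables (A : zmodType) (p : Q) (b : forall j, mor (ob j) p -> M j -> A).
Hypothesis bDl : forall j (f g : mor (ob j) p) m, b (f + g) m = b f m + b g m.
Hypothesis bDr : forall j (f : mor (ob j) p) m m', b f (m + m') = b f m + b f m'.

Definition ind_eval (l : ind p) : A :=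
  \sum_(t : basis p) b (bas t) (l (bix t) (cobas t)).

Lemma ind_evalD x y : ind_eval (x + y) = ind_eval x + ind_eval y.
Proof.
by rewrite -big_split; apply: eq_bigr => t _; rewrite dprodDE ahomDE bDr.
Qed.

Lemma ind_eval_gen j (f : mor (ob j) p) m : ind_eval (igen f m) = b f m.
Proof.
pose bl m' : ahom (mor (ob j) p) A := AHom (fun f g => @bDl j f g m').
pose br k f' : ahom (M k) A := AHom (@bDr k f').
rewrite /ind_eval; transitivity (\sum_(k < near_num p)
    \sum_(i < dnum d (ob (near p k)) p) b (dbas i) (igen f m (near p k) (dcobas i))).
  by rewrite sig_big_dep.
have [[k kj]|jnear] := pselect (exists k, near p k = j); last first.
  have f0 : f = 0 by apply: contrapT => /nearP.
  rewrite -[RHS]/(bl m f) {2}f0 raddf0.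
  rewrite big1 // => k _; rewrite big1 // => i _.
  rewrite igen_neq; last by move=> kj; apply: jnear; exists k.
  exact: (raddf0 (br _ _)).
subst j; rewrite (bigD1 k) //= [X in _ + X]big1 ?addr0 => [|k' k'k]; last first.
  rewrite big1 // => i _; rewrite igen_neq; last first.
    by move=> /near_inj kk'; rewrite kk' eqxx in k'k.
  exact: (raddf0 (br _ _)).
transitivity (bl m (\sum_i dbas i *~ dpair (d := d) f (dcobas i))).
  rewrite raddf_sum; apply: eq_bigr => i _.
  by rewrite igenE raddfMz -[b _ _]/(br _ _ _) raddfMz.
by rewrite -dexpl.
Qed.
End Lift.
End OverRing.
End InducedFunctors.

Section InducedAdjunction.
Variables (Q : preadditive) (d : duality Q).
Variables (J : Type) (ob : J -> Q) (obfin : locally_finite ob).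
Variables (R : pzRingType) (M : J -> lmodType R).
Notation I := (ind d ob M).
Notation igen := (@igen Q d J ob R M _ _).

Lemma ind_hom_ext (Y : qmod Q R) (h h' : qhom I Y) :
  (forall j m, h (ob j) (igen (idm _) m) = h' (ob j) (igen (idm _) m)) ->
  forall p l, h p l = h' p l.
Proof.
move=> hh' p; apply: (ind_additive_ext obfin) => [x y|x y|j f m].
- exact: linearD.
- exact: linearD.
by rewrite -[f]compm1 -igen_act !qnat hh'.
Qed.

(** The functors ind are left adjoint to evaluation at the objects ob j. *)
Lemma ind_lift (Y : qmod Q R) (g : forall j, {linear M j -> Y (ob j)}) :
  exists h : qhom I Y, forall p j (f : mor (ob j) p) m,
    h p (igen f m) = mact Y f (g j m).
Proof.
pose b p j (f : mor (ob j) p) m := mact Y f (g j m).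
have bDl p j (f f' : mor (ob j) p) m : b p j (f + f') m = b p j f m + b p j f' m.
  exact: mactD.
have bDr p j (f : mor (ob j) p) m m' : b p j f (m + m') = b p j f m + b p j f m'.
  by rewrite /b !linearD.
pose F p (l : I p) := ind_eval obfin (b p) l.
have FD p x y : F p (x + y) = F p x + F p y by exact: (ind_evalD obfin (bDr p)).
have Fgen p j (f : mor (ob j) p) m : F p (igen f m) = b p j f m.
  exact: (ind_eval_gen d obfin (bDl p) (bDr p)).
have FL p : linear (F p).
  move=> a x y; rewrite FD; congr (_ + _).
  rewrite /F /ind_eval scaler_sumr; apply: eq_bigr => t _.
  by rewrite dprodZE ahomZE /b !linearZ.
have FN p q (u : mor p q) l : F q (mact I u l) = mact Y u (F p l).
  move: l; apply: (ind_additive_ext obfin) => [x y|x y|j f m].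
  - by rewrite linearD FD.
  - by rewrite FD linearD.
  by rewrite igen_act !Fgen /b mactM.
by exists (qmk FL FN).
Qed.

Lemma ind_lift_epi (A B : qmod Q R) (e : qhom A B) (g : qhom I B) :
  (forall j, exists h : {linear M j -> A (ob j)},
     forall m, e _ (h m) = g _ (igen (idm _) m)) ->
  exists h : qhom I A, forall p l, e p (h p l) = g p l.
Proof.
move=> /dchoice[h hP]; have [k kE] := ind_lift h; exists k.
apply: (ind_hom_ext (h := qcomp e k)) => j m /=.
by rewrite kE mact1 hP.
Qed.

Lemma ind_projective : (forall j, lmod_projective (M j)) -> qprojective I.
Proof.
move=> Mproj A B e g e_epi; apply: ind_lift_epi => j.
pose g' : {linear M j -> B (ob j)} := g (ob j) \o lin (igen_linear d (idm (ob j))).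
by have [h hE] := Mproj j _ _ (e (ob j)) g' (e_epi (ob j)); exists h.
Qed.

(** Values of ind inherit properties of the modules M j, because by the
    expansion on a basis they are retracts of finite direct sums. *)
Lemma ind_ob_projective p :
  (forall j, lmod_projective (M j)) -> lmod_projective (I p).
Proof.
move=> Mproj A B e g e_surj.
have [h hP] := dchoice (fun t : basis d obfin p => Mproj (bix t) _ _ e
  (g \o lin (igen_linear d (bas t)) : {linear M (bix t) -> B}) e_surj).
have kL : linear (fun l : I p => \sum_(t : basis d obfin p) h t (l (bix t) (cobas t))).
  move=> a x y; rewrite scaler_sumr -big_split; apply: eq_bigr => t _.
  by rewrite dprodDE dprodZE ahomDE ahomZE linearP.
exists (lin kL) => l; rewrite {2}(ind_expand obfin l) /= (linear_sum e) (linear_sum g).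
by apply: eq_bigr => t _; rewrite hP.
Qed.

Lemma ind_ob_flat p : (forall j, charflat (M j)) -> charflat (I p).
Proof.
move=> Mflat A B i i_inj b bb.
have [c cP] := dchoice (fun t : basis d obfin p =>
  let: ex_intro2 c cb cE := Mflat (bix t) _ _ i i_inj _
    (balanced_pre idfun (lin (igen_linear d (bas t))) bb) in
  ex_intro (fun c => balanced c /\ _) c (conj cb cE)).
exists (fun x (l : I p) =>
    \sum_(t : basis d obfin p) c t x (l (bix t) (cobas t))).
  split=> [x x' l|x l l'|a x l].
  - rewrite -big_split; apply: eq_bigr => t _.
    exact: balancedDl (cP t).1 _ _ _.
  - rewrite -big_split; apply: eq_bigr => t _.
    by rewrite dprodDE ahomDE (balancedDr (cP t).1).
  - apply: eq_bigr => t _.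
    by rewrite dprodZE ahomZE (balancedZ (cP t).1).
move=> a l; rewrite {2}(ind_expand obfin l).
pose ba := AHom (fun x y => balancedDr bb a x y).
rewrite -[RHS]/(ba _) raddf_sum; apply: eq_bigr => t _.
by rewrite (cP t).2.
Qed.

Lemma ind_ob_cotorsion p :
  (forall j, cotorsion_module (M j)) -> cotorsion_module (I p).
Proof.
move=> Mcot A B Y i q iq Yflat f.
have vL (t : basis d obfin p) : linear (fun a => f a (bix t) (cobas t)).
  by move=> a x y; rewrite linearP.
have [h hP] := dchoice (fun t : basis d obfin p =>
  Mcot (bix t) _ _ _ _ _ iq Yflat (lin (vL t))).
have kL : linear (fun x : B => \sum_(t : basis d obfin p) igen (bas t) (h t x)).
  move=> a x y; rewrite scaler_sumr -big_split; apply: eq_bigr => t _.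
  by rewrite linearP igen_linear.
exists (lin kL) => a; rewrite [RHS](ind_expand obfin) /=.
by apply: eq_bigr => t _; rewrite hP.
Qed.
End InducedAdjunction.

Section EnoughObjects.
Variables (Q : preadditive) (d : duality Q) (Qfin : locally_finite (fun q : Q => q)).
Variables (R : pzRingType).
Implicit Types X Y : qmod Q R.

(** Every functor embeds in a coinduced functor, and is covered by an induced
    one; both maps split at every object. *)
Definition emb_ob Y := ind d (fun q : Q => q) (fun q => Y (dob d q)).
Definition emb Y : qhom Y (emb_ob Y) :=
  coind_map (o := dob d) (M := fun q => Y (dob d q)) (fun q => idfun).

Lemma emb_retract Y p : exists r : {linear emb_ob Y p -> Y p},
  forall y, r (emb Y p y) = y.
Proof.
have [q [a [b ba]]] := dretr d p.
have rL : linear (fun l : emb_ob Y p => mact Y b (l q a)).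
  by move=> c x y; rewrite linearP.
by exists (lin rL) => y; rewrite /= -mactM ba mact1.
Qed.

Lemma emb_mono Y : qmono (emb Y).
Proof.
move=> p x y xy; have [r rE] := emb_retract Y p.
by rewrite -[x]rE -[y]rE xy.
Qed.

Definition cosyz Y := qquot (qimage (emb Y)).
Definition cosyz_proj Y : qhom (emb_ob Y) (cosyz Y) := qproj (qimage (emb Y)).

Lemma cosyz_ses Y : qses (emb Y) (cosyz_proj Y).
Proof. exact: (qimage_ses (@emb_mono Y)). Qed.

Lemma cosyz_retract Y p : exists s : {linear cosyz Y p -> emb_ob Y p},
  forall z, cosyz_proj Y p (s z) = z.
Proof.
have [r rE] := emb_retract Y p.
have hL : linear (fun l : emb_ob Y p => l - emb Y p (r l)).
  move=> a x y; rewrite (linearP r) (linearP (emb Y p)).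
  by rewrite opprD addrACA -scalerBr.
have [|s sE] := quot_lift (S := qimage (emb Y) p) (f := lin hL).
  by move=> _ [y <-]; rewrite /= rE subrr.
exists s => z; rewrite -[z]qvalK sE /=.
by apply: qpi_eq; exists (- r (qval z)); rewrite linearN addrAC subrr sub0r.
Qed.

Definition cov_ob X := ind d (fun q : Q => q) (fun q => X q).

Lemma cov_exists X : exists (e : qhom (cov_ob X) X)
    (s : forall p, {linear X p -> cov_ob X p}), forall p x, e p (s p x) = x.
Proof.
have [e eE] := ind_lift d Qfin (fun q => idfun : {linear X q -> X q}).
exists e, (fun p =>
  lin (@igen_linear Q d Q (fun q => q) R (fun q => X q) p p (idm p))) => p x.
by rewrite /= eE mact1.
Qed.

Definition free_ob X := ind d (fun q : Q => q) (fun q => freemod R (X q)).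

Lemma free_ob_projective X : qprojective (free_ob X).
Proof. by apply: ind_projective => // q; exact: free_projective. Qed.

Lemma free_ob_flat X p : charflat (free_ob X p).
Proof. by apply: ind_ob_flat => // q; exact: charflat_free. Qed.

Lemma free_ob_cover X : exists e : qhom (free_ob X) X, qepi e.
Proof.
have [e eE] := ind_lift d Qfin (fun q => free_lift id : {linear freemod R (X q) -> X q}).
exists e => p x; exists (@igen Q d Q (fun q => q) R _ p p (idm p) (gen R x)).
by rewrite eE mact1 free_lift_gen.
Qed.
End EnoughObjects.

(** * Duality data from a Serre functor *)

Definition opcat (Q : preadditive) : preadditive.
Proof.
apply: (@Preadditive Q (fun p q => mor q p) (@idm Q)
  (fun p q r (g : mor r q) (f : mor q p) => f \oc g)).
- by move=> p q f; rewrite compm1.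
- by move=> p q f; rewrite comp1m.
- by move=> p q r s h g f; rewrite Defs.compA.
- by move=> p q r g g' f; rewrite compDr.
- by move=> p q r g f f'; rewrite compDl.
Defined.

Lemma dual_basis (A : zmodType) :
  lmod_fg (zmodule A) -> lmod_projective (zmodule A) ->
  exists n (h : 'I_n -> A) (l : 'I_n -> ahom A int),
    forall x, x = \sum_i h i *~ l i x.
Proof.
move=> [n [e eP]] Aproj.
have eL : linear (fun c : dprod (fun _ : 'I_n => int^o) => \sum_i c i *: e i).
  move=> a x y; rewrite scaler_sumr -big_split; apply: eq_bigr => i _.
  by rewrite dprodDE dprodZE scalerDl scalerA.
have [|s sP] := Aproj _ _ (lin eL) idfun.
  by move=> x; have [c ->] := eP x; exists c.
have lD i : forall x y : A, s (x + y) i = s x i + s y i.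
  by move=> x y; rewrite (linearD s).
exists n, e, (fun i => AHom (lD i)) => x.
by rewrite -[LHS]sP.
Qed.

Section SerreDuality.
Variables (Q : preadditive) (S : addfun Q Q).
Hypotheses (Qhom : hom_finite Q) (SS : serre_functor S).

(** A finitely generated projective group has dual bases, which the bijections of
    the Serre functor carry to each other. *)
Lemma serre_duality : inhabited (duality Q) /\ inhabited (duality (opcat Q)).
Proof.
have [[T [TS ST]] [phi [phiD phi_uniq phi_nat _]]] := SS.
have cas q p : exists n (f : 'I_n -> mor q p) (h : 'I_n -> mor p (S q)),
    (forall x, x = \sum_i h i *~ phi q p (f i) x) /\
    (forall g, g = \sum_i f i *~ phi q p g (h i)).
  have [fg pr] := Qhom p (S q).
  have [n [h [l lP]]] := dual_basis fg pr.
  have [f fP] := choice (fun i => phi_uniq q p (af (l i) : {additive _ -> _})).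
  have E x : x = \sum_i h i *~ phi q p (f i) x.
    by rewrite {1}[x]lP; apply: eq_bigr => i _; rewrite (fP i).1.
  exists n, f, h; split=> // g.
  have [g0 [_ guniq]] := phi_uniq q p (phi q p g).
  transitivity g0; first by symmetry; apply: guniq.
  apply: guniq => x.
  pose phix : ahom (mor q p) int := AHom (fun a b => phiD q p a b x).
  rewrite -[LHS]/(phix _) raddf_sum [in RHS](E x) raddf_sum.
  apply: eq_bigr => i _; rewrite (raddfMz phix) (raddfMz (phi q p g)).
  exact: (etrans (mulrzz _ _) (etrans (mulrC _ _) (esym (mulrzz _ _)))).
have [n casn] := dchoice2 cas; have [f casf] := dchoice2 casn.
have [h cash] := dchoice2 casf.
have [a [b [_ ba ab]]] := TS; have [a' [b' [_ _ ab']]] := ST.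
have ret p : exists q (a : mor p (S q)) (b : mor (S q) p), b \oc a = idm p.
  by exists (T p), (b p), (a p); exact: ab.
pose d := @Duality Q S (fun q p g x => phi q p g x) phiD
  (fun q p g x y => raddfD (phi q p g) x y)
  (fun q p p' u g x => phi_nat q p p' u g x) n f h
  (fun q p => (cash q p).1) (fun q p => (cash q p).2) ret.
split; constructor; first exact: d.
(* The inverse equivalence T is a Serre functor for the opposite category. *)
apply: (@Duality (opcat Q) T (fun q p g x => dpair (d := d) x (b q \oc g))
  _ _ _ (fun q p => n (T q) p) (fun q p i => a q \oc h (T q) p i)
  (fun q p i => f (T q) p i)).
- by move=> q p g g' x; rewrite compDr dpairDr.
- by move=> q p g x y; rewrite dpairDl.
- move=> q p p' u g x.
  apply: etrans (esym (@dpair_nat Q d (T q) p' p u x (@hcomp Q _ _ _ (b q) g))).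
  exact: congr1 (@Defs.compA Q _ _ _ _ (b q) g u).
- move=> q p x; rewrite {1}(dexpl d x); apply: eq_bigr => i _.
  by rewrite (@Defs.compA Q) ba (@comp1m Q).
- move=> q p g; rewrite -[LHS](@comp1m Q p q) -(ab q) -(@Defs.compA Q).
  apply: etrans (congr1 (comp_ahoml _ (a q)) (dexpr (d := d) (@hcomp Q _ _ _ (b q) g))) _.
  rewrite raddf_sum.
  by apply: eq_bigr => i _; rewrite raddfMz.
- by move=> p; exists (S p), (a' p), (b' p); exact: ab'.
Qed.
End SerreDuality.

(** * Relative injectivity *)

Lemma projective_retract (R : pzRingType) (P P' : lmodType R)
    (i : {linear P -> P'}) (r : {linear P' -> P}) :
  (forall x, r (i x) = x) -> lmod_projective P' -> lmod_projective P.
Proof.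
move=> ri P'proj A B e g e_surj.
have [h hE] := P'proj A B e (g \o r : {linear P' -> B}) e_surj.
by exists (h \o i) => x; rewrite /= hE /= ri.
Qed.

Section RelativeInjectivity.
Variables (Q : preadditive) (d : duality Q) (Qfin : locally_finite (fun q : Q => q)).
Implicit Types V W X Y : qmod Q int.

(** Vanishing of Ext^1(W'', V) for every functor W'' with projective values. By
    dimension shifting along the embeddings emb it says the same of all higher
    Ext groups, which gives the closure properties below. *)
Definition relinj V : Prop :=
  forall W' W (u : qhom W' W), (forall q, lmod_projective (W q)) ->
  (forall q, exists r : {linear W q -> W' q}, forall x, r (u q x) = x) ->
  forall f : qhom W' V, exists g : qhom W V, forall q x, g q (u q x) = f q x.

Lemma relinj_retract V V' (i : qhom V V') (r : qhom V' V) :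
  (forall q x, r q (i q x) = x) -> relinj V' -> relinj V.
Proof.
move=> ri V'inj W' W u Wproj usplit f.
have [g gE] := V'inj W' W u Wproj usplit (qcomp i f).
by exists (qcomp r g) => q x; rewrite /= gE /= ri.
Qed.

Section ShortExact.
Variables (V' V V'' : qmod Q int) (i : qhom V' V) (p : qhom V V'').
Hypothesis ip : qses i p.

(** The map f is lifted to V on a cover of W'. On the kernel of the cover the lift
    takes values in V', and by subtracting an extension of that part to the cover
    it descends to W'. *)
Lemma relinj_quotient : relinj V' -> relinj V -> relinj V''.
Proof.
move=> V'inj Vinj W' W u Wproj usplit f.
have W'proj q : lmod_projective (W' q).
  by have [r rE] := usplit q; exact: (projective_retract rE).
have [e [s se]] := cov_exists d Qfin W'.
have e_epi : qepi e by move=> q y; exists (s q y).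
have keS := qkernel_ses e_epi.
have [k kE] := ind_projective Qfin W'proj (qcomp f e) (fun q => ses_surj (ip q)).
have [|m mE] := @qses_lift _ _ _ _ _ _ i p (qcomp k (qincl (qkernel e))) ip.
  by move=> q x; rewrite [LHS]kE /= (sinclP x : e q _ = 0) linear0.
have [||m' m'E] := V'inj _ _ (qincl (qkernel e)) _ _ m.
- by move=> q; exact: ind_ob_projective.
- move=> q; have rL : linear (fun x : cov_ob d W' q => x - s q (e q x)).
    by move=> a x y; rewrite (linearP (e q)) (linearP (s q)) opprD addrACA -scalerBr.
  have [|r rE] := @subm_lift _ _ _ (kernel (e q)) (lin rL).
    by move=> x; rewrite /= linearB se subrr.
  exists r => x; apply: sincl_inj; rewrite rE /=.
  by rewrite (sinclP x : e q _ = 0) linear0 subr0.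
have [|n nE] := @qses_factor _ _ _ _ _ _ _ _ (qsubh k (qcomp i m')) keS.
  by move=> q x; rewrite /= m'E mE subrr.
have [g gE] := Vinj W' W u Wproj usplit n.
exists (qcomp p g) => q x; have [y <-] := e_epi q x.
by rewrite /= gE nE /= linearB kE (ses0 _ (ip q)) subr0.
Qed.

(** An extension of i f to W induces a map from W / W' to V''. This map factors
    through the embedding of W / W' in an induced functor with projective
    values, which is projective; so it lifts to V and can be subtracted. *)
Lemma relinj_kernel : relinj V -> relinj V'' -> relinj V'.
Proof.
move=> Vinj V''inj W' W u Wproj usplit f.
have u_mono : qmono u.
  move=> q x y xy; have [r rE] := usplit q.
  by rewrite -[x]rE xy rE.
have uS := qimage_ses u_mono; set c := qproj (qimage u) in uS.
have [g gE] := Vinj W' W u Wproj usplit (qcomp i f).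
have [|g' g'E] := @qses_factor _ _ _ _ _ _ _ _ (qcomp p g) uS.
  by move=> q x; rewrite /= gE /= (ses0 _ (ip q)).
have Cproj q : lmod_projective (qquot (qimage u) q).
  have [r rE] := usplit q.
  have hL : linear (fun x : W q => x - u q (r x)).
    by move=> a x y; rewrite (linearP r) (linearP (u q)) opprD addrACA -scalerBr.
  have [|s sE] := quot_lift (S := qimage u q) (f := lin hL).
    by move=> _ [y <-]; rewrite /= rE subrr.
  apply: (@projective_retract _ _ _ s (c q)) (Wproj q) => z.
  rewrite -[z]qvalK sE /=; apply: qpi_eq; exists (- r (qval z)).
  by rewrite linearN addrAC subrr sub0r.
have [||k kE] := V''inj _ _ (emb d (qquot (qimage u))) _ _ g'.
- by move=> q; apply: ind_ob_projective => // q'; exact: Cproj.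
- by move=> q; exact: emb_retract.
have [k' k'E] := @ind_projective _ d _ _ Qfin _ _ (fun q => Cproj (dob d q)) _ _ p k
  (fun q => ses_surj (ip q)).
have [|h hE] := @qses_lift _ _ _ _ _ _ i p
    (qsubh g (qcomp (qcomp k' (emb d _)) c)) ip.
  move=> q x; rewrite [LHS]linearB /=.
  by rewrite [X in _ - X]k'E [X in _ - X]kE [X in _ - X]g'E subrr.
exists h => q x; apply: (ses_inj (ip q)); rewrite hE.
rewrite -[LHS]/(g q (u q x) - k' q (emb d _ q (c q (u q x)))).
by rewrite gE (ses0 x (uS q)) linear0 linear0 subr0.
Qed.
End ShortExact.
End RelativeInjectivity.

(** * Acyclic functors *)

Lemma additive_int_linear (A B : lmodType int) (f : A -> B) :
  (forall x y, f (x + y) = f x + f y) -> linear f.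
Proof.
move=> fD a x y; pose f' := AHom fD.
by rewrite fD !scale_intE -[f (x *~ a)]/(f' _) raddfMz.
Qed.

Section Acyclic.
Variables (Q : preadditive).

Section CharacterFunctor.
Variable R : pzRingType.
Implicit Types X Y : qmod Q R.

Definition ahom_of_linear (A B : lmodType R) (f : {linear A -> B}) : ahom A B :=
  AHom (fun x y => linearD f x y).

Definition cdual_act X (p q : opcat Q) (u : mor p q)
    (c : zmodule (character (X p))) : zmodule (character (X q)) :=
  ahom_comp c (ahom_of_linear (mact X (u : @mor Q q p))).

Lemma cdual_act_linear X (p q : opcat Q) (u : mor p q) : linear (cdual_act (X := X) u).
Proof. by apply: additive_int_linear => x y; exact: ahomP. Qed.

Definition cdual X : qmod (opcat Q) int.
Proof.
apply: (@QMod (opcat Q) int (fun q => zmodule (character (X q)))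
  (fun p q u => lin (@cdual_act_linear X p q u))).
- by move=> p q f g c; apply: ahomP => x; rewrite /= mactD raddfD.
- by move=> q c; apply: ahomP => x; rewrite /= mact1.
- by move=> p q r g f c; apply: ahomP => x; rewrite /= -mactM.
Defined.

Definition cdual_map X Y (f : qhom X Y) : qhom (cdual Y) (cdual X).
Proof.
apply: (@qmk _ _ (cdual Y) (cdual X) (fun q (c : cdual Y q) =>
  ahom_comp c (ahom_of_linear (f q)) : cdual X q)).
- by move=> q; apply: additive_int_linear => x y; exact: ahomP.
- by move=> p q u c; apply: ahomP => x; rewrite /= qnat.
Defined.

Lemma cdual_ses X Y Z (i : qhom X Y) (p : qhom Y Z) :
  qses i p -> qses (cdual_map p) (cdual_map i).
Proof.
move=> ip q; split.
- move=> c c' cc'; apply: ahomP => z; have [y <-] := ses_surj (ip q) z.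
  exact: (congr1 (fun w : character (Y q) => w y) cc').
- move=> c; have [c' c'E] := @character_extend _ _ (i q) c
    (fun x y => linearD (i q) x y) (ses_inj (ip q)) (@afD _ _ c).
  by exists c'; apply: ahomP.
- move=> c; split=> [c0|[c' <-]]; last first.
    by apply: ahomP => x; rewrite /= (ses0 _ (ip q)) raddf0.
  have ci x : af c (i q x) = 0.
    exact: (congr1 (fun w : character (X q) => w x) c0).
  have [|c' c'E] := @character_factor _ _ (p q) c (fun x y => linearD (p q) x y)
    (ses_surj (ip q)).
    by move=> y /(ses_ker (ip q))[x <-]; exact: ci.
  by exists c'; apply: ahomP.
Qed.

(** Acyclicity stands for exactness: the functors Tor_i(W, X) with i > 0 vanish
    for every right functor W with projective values. It depends only on the
    underlying abelian groups. *)
Definition acyclic X : Prop := relinj (cdual X).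

Lemma acyclic_retract X Y (i : qhom X Y) (r : qhom Y X) :
  (forall q x, r q (i q x) = x) -> acyclic Y -> acyclic X.
Proof.
move=> ri; apply: (@relinj_retract _ _ _ (cdual_map r) (cdual_map i)) => q c.
by apply: ahomP => x /=; rewrite ri.
Qed.
End CharacterFunctor.

Lemma acyclic_forget (R : pzRingType) (X : qmod Q R) :
  acyclic (forget X) -> acyclic X.
Proof.
have iL q : linear (fun c : cdual X q => c : cdual (forget X) q).
  by apply: additive_int_linear.
have rL q : linear (fun c : cdual (forget X) q => c : cdual X q).
  by apply: additive_int_linear.
have iN (p q : opcat Q) (u : mor p q) (c : cdual X p) :
    (mact (cdual X) u c : cdual (forget X) q) =
    mact (cdual (forget X)) u (c : cdual (forget X) p) by exact: ahomP.
have rN (p q : opcat Q) (u : mor p q) (c : cdual (forget X) p) :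
    (mact (cdual (forget X)) u c : cdual X q) =
    mact (cdual X) u (c : cdual X p) by exact: ahomP.
exact: (@relinj_retract _ _ _ (qmk iL iN) (qmk rL rN)).
Qed.

Variables (d : duality Q) (Qfin : locally_finite (fun q : Q => q)).
Variables (d' : duality (opcat Q)) (Q'fin : locally_finite (fun q : opcat Q => q)).

(** A natural pairing of W with an induced functor is determined by its
    restriction to the generators, where the retraction of W on W' extends
    it. *)
Lemma acyclic_ind (R : pzRingType) (J : Type) (ob : J -> Q)
    (obfin : locally_finite ob) (M : J -> lmodType R) : acyclic (ind d ob M).
Proof.
move=> W' W u Wproj usplit f; have [r rE] := dchoice usplit.
pose ev q (c : cdual (ind d ob M) q) (l : ind d ob M q) : QZ := af c l.
have evD q c c' l : ev q (c + c') l = ev q c l + ev q c' l by [].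
have evDr q c l l' : ev q c (l + l') = ev q c l + ev q c l'.
  exact: (@afD _ _ c).
pose b p (w : W p) j (h : @mor Q (ob j) p) (m : M j) : QZ :=
  ev (ob j) (f (ob j) (r (ob j) (mact W (h : @mor (opcat Q) p (ob j)) w)))
     (igen d (idm (ob j)) m).
have bDl p w j (h h' : @mor Q (ob j) p) m : b p w j (h + h') m = b p w j h m + b p w j h' m.
  rewrite /b -evD -!linearD; congr (ev _ (f _ (r _ _)) _).
  exact: (@mactD _ _ W).
have bDr p w j (h : @mor Q (ob j) p) m m' : b p w j h (m + m') = b p w j h m + b p w j h m'.
  by rewrite /b igenDr evDr.
have bDw p w w' j (h : @mor Q (ob j) p) m : b p (w + w') j h m = b p w j h m + b p w' j h m.
  by rewrite /b -evD -!linearD.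
pose g p (w : W p) : cdual (ind d ob M) p := AHom (ind_evalD obfin (bDr p w)).
have gE p w j (h : @mor Q (ob j) p) m : ev p (g p w) (igen d h m) = b p w j h m.
  exact: (ind_eval_gen d obfin (bDl p w) (bDr p w)).
have chext p (c c' : cdual (ind d ob M) p) :
    (forall j (h : @mor Q (ob j) p) m, ev p c (igen d h m) = ev p c' (igen d h m)) ->
    c = c'.
  move=> cc'; apply: ahomP; apply: (ind_additive_ext obfin) => //.
  - exact: (@afD _ _ c).
  - exact: (@afD _ _ c').
have gL p : linear (g p).
  apply: additive_int_linear => w w'; apply: chext => j h m.
  by rewrite evD !gE bDw.
have gN p q (v : @mor (opcat Q) p q) w : g q (mact W v w) = mact (cdual _) v (g p w).
  apply: chext => j h m; rewrite gE.
  rewrite -[RHS]/(ev p (g p w) (mact (ind d ob M) (v : @mor Q q p) (igen d h m))).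
  rewrite igen_act gE /b; congr (ev _ (f _ (r _ _)) _).
  by rewrite -mactM.
exists (qmk gL gN) => p w; apply: chext => j h m; rewrite gE /b -qnat rE qnat.
rewrite -[LHS]/(ev p (f p w) (mact (ind d ob M) h (igen d (idm (ob j)) m))).
by rewrite igen_act compm1.
Qed.

Section ShortExact.
Variables (R : pzRingType) (X Y Z : qmod Q R) (i : qhom X Y) (p : qhom Y Z).
Hypothesis ip : qses i p.

Lemma acyclic_kernel : acyclic Y -> acyclic Z -> acyclic X.
Proof.
move=> Yac Zac; exact: (relinj_quotient d' Q'fin (cdual_ses ip) Zac Yac).
Qed.

Lemma acyclic_quotient : acyclic X -> acyclic Y -> acyclic Z.
Proof.
move=> Xac Yac; exact: (relinj_kernel d' Q'fin (cdual_ses ip) Yac Xac).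
Qed.
End ShortExact.

Lemma acyclic_projective (P : qmod Q int) : qprojective P -> acyclic P.
Proof.
move=> Pproj; have [e [s se]] := cov_exists d Qfin P.
have [t tE] := Pproj _ _ e (qid P) (fun q y => ex_intro _ (s q y) (se q y)).
apply: (acyclic_retract (i := t) (r := e) tE); exact: acyclic_ind.
Qed.

Lemma acyclic_injective (E : qmod Q int) : qinjective E -> acyclic E.
Proof.
move=> Einj; have [t tE] := Einj _ _ (emb d E) (qid E) (@emb_mono _ d _ E).
apply: (acyclic_retract (i := emb d E) (r := t) tE); exact: acyclic_ind.
Qed.

Lemma acyclic_finite_pd (X : qmod Q int) : finite_pd X -> acyclic X.
Proof.
case=> n; elim: n X => [|n IH] X [P [f [e [Pproj P0 e_epi ex0 exS]]]].
  have e_inj q : injective (e q).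
    apply: linear_inj => x /(ex0 q)[y <-].
    by rewrite (P0 1%N isT q y) linear0.
  have [s sE] := dchoice2 e_epi.
  have sL q : linear (s q) by move=> a x y; apply: (e_inj q); rewrite linearP !sE.
  have sN p q (u : mor p q) x : s q (mact X u x) = mact (P 0%N) u (s p x).
    by apply: (e_inj q); rewrite qnat !sE.
  exact: (acyclic_retract (i := qmk sL sN) sE (acyclic_projective (Pproj 0%N))).
have kS := qkernel_ses e_epi.
have [|e' e'E] := @qses_lift _ _ _ _ _ _ _ _ (f 0%N) kS.
  by move=> q x; apply/(ex0 q); exists x.
apply: (acyclic_quotient kS); last exact: acyclic_projective.
apply: IH; exists (fun i => P i.+1), (fun i => f i.+1), e'; split=> //.
- by move=> i ni; exact: P0.
- move=> q y; have /(ex0 q)[x xy] := sinclP y.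
  by exists x; apply: sincl_inj; exact: etrans (e'E q x) xy.
- move=> q y; split=> [y0|/(exS 0%N q) y0].
    by apply/(exS 0%N q); rewrite -e'E y0 linear0.
  by apply: sincl_inj; exact: etrans (e'E q y) y0.
Qed.

Lemma acyclic_finite_id (X : qmod Q int) : finite_id X -> acyclic X.
Proof.
case=> n; elim: n X => [|n IH] X [I [f [e [Iinj I0 e_mono ex0 exS]]]].
  have e_surj q y : exists x, e q x = y.
    by apply/(ex0 q); exact: (I0 1%N isT q).
  have [s sE] := dchoice2 e_surj.
  have sL q : linear (s q) by move=> a x y; apply: (e_mono q); rewrite linearP !sE.
  have sN p q (u : mor p q) x : s q (mact (I 0%N) u x) = mact X u (s p x).
    by apply: (e_mono q); rewrite qnat !sE.
  apply: (@acyclic_retract _ _ _ e (qmk sL sN)); last exact: acyclic_injective.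
  by move=> q x; apply: (e_mono q); rewrite /= sE.
have cS := qimage_ses e_mono.
have [|e' e'E] := @qses_factor _ _ _ _ _ _ _ _ (f 0%N) cS.
  by move=> q x; apply/(ex0 q); exists x.
apply: (acyclic_kernel cS); first exact: acyclic_injective.
apply: IH; exists (fun i => I i.+1), (fun i => f i.+1), e'; split=> //.
- by move=> i ni; exact: I0.
- move=> q; apply: linear_inj => z; have [y <-] := ses_surj (cS q) z.
  by rewrite e'E => /(ex0 q)[x <-]; exact: ses0 (cS q).
- move=> q y; split=> [/(exS 0%N q)[x <-]|[z <-]].
    by exists (qproj (qimage e) q x); rewrite e'E.
  have [x <-] := ses_surj (cS q) z; rewrite e'E.
  by apply/(exS 0%N q); exists x.
Qed.

(** Projective and injective functors are retracts of induced ones, and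
    acyclicity passes along finite resolutions in both directions. *)
Lemma acyclic_exact (R : pzRingType) (X : qmod Q R) : exact_object X -> acyclic X.
Proof.
move=> Xex; apply: acyclic_forget.
by case: Xex => [/acyclic_finite_pd|/acyclic_finite_id].
Qed.
End Acyclic.

(** * The pseudo-radical *)

Section PseudoRadical.
Variables (Q : preadditive) (r : forall q : Q, set (mor q q)).
Arguments r : clear implicits.
Hypothesis rP : strong_retraction r.

Notation rad := (pseudo_radical r).

Lemma rad_diagE q (f : mor q q) : rad f <-> r q f.
Proof.
split=> [|rf]; last exact: prad_diag.
suff H p p' (g : mor p p') : rad g ->
    forall e : p = p', r p' (eq_rect p (fun x => mor x p' : Type) g p' e).
  by move=> /H /(_ erefl).
case=> [{}q {}f rf e|{}p {}p' {}g pp' //].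
by rewrite (Prop_irrelevance e erefl).
Qed.

Lemma r0 q : r q 0. Proof. by have [_ [/(_ q)[]]] := rP. Qed.
Lemma rB q f g : r q f -> r q g -> r q (f - g).
Proof. by have [_ [/(_ q)[_]]] := rP; move=> rB' _ _ _ _; exact: rB'. Qed.
Lemma r_decomp q (f : mor q q) : exists (n : int) g, r q g /\ f = idm q *~ n + g.
Proof. by have [_ [_ + _ _ _]] := rP; apply. Qed.
Lemma rN q f : r q f -> r q (- f).
Proof. by move=> rf; rewrite -sub0r; apply: rB => //; exact: r0. Qed.
Lemma rD q f g : r q f -> r q g -> r q (f + g).
Proof. by move=> rf rg; rewrite -[g]opprK; apply: rB => //; exact: rN. Qed.
Lemma rM q f (n : int) : r q f -> r q (f *~ n).
Proof.
move=> rf; have rn (m : nat) : r q (f *~ m).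
  elim: m => [|m IH]; first exact: r0.
  by rewrite -addn1 PoszD mulrzDr mulr1z; exact: rD.
by case: (intP n) => [|m|m]; [exact: r0|exact: rn|rewrite mulrNz; exact/rN/rn].
Qed.

(** The coefficient of the identity in the decomposition of an endomorphism is
    unique, hence additive. *)
Lemma id_coef q : exists rho : ahom (mor q q) int,
  rho (idm q) = 1 /\ forall f, r q f <-> rho f = 0.
Proof.
have [[]] := (rP.1 q, rP.2); move=> s sE _; have [_ _ idr _ _] := rP.2.
have id0 n : r q (idm q *~ n) -> n = 0.
  by move=> /idr idn; rewrite -(sE n) idn raddf0.
have uq n m g h : r q g -> r q h -> idm q *~ n + g = idm q *~ m + h -> n = m.
  move=> rg rh E; apply: subr0_eq; apply: id0.
  rewrite mulrzBr; have -> : idm q *~ n - idm q *~ m = h - g; last exact: rB.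
  by apply/eqP; rewrite subr_eq addrAC eq_sym subr_eq [h + _]addrC E.
have [c cP] := choice (@r_decomp q).
have cE n f g : r q g -> f = idm q *~ n + g -> c f = n.
  move=> rg fE; have [h [rh fE']] := cP f.
  by apply: (uq _ _ h g) => //; rewrite -fE -fE'.
have cD f g : c (f + g) = c f + c g.
  have [f' [rf fE]] := cP f; have [g' [rg gE]] := cP g.
  apply: (cE _ _ (f' + g')); first exact: rD.
  by rewrite {1}fE {1}gE mulrzDr addrACA.
exists (AHom cD); split=> [|f] /=.
  by apply: (cE _ _ 0); [exact: r0|rewrite mulr1z addr0].
split=> [rf|f0]; first by apply: (cE _ _ f) => //; rewrite mulr0z add0r.
by have [g [rg ->]] := cP f; rewrite f0 mulr0z add0r.
Qed.

Lemma rad0 p q : rad (0 : mor p q).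
Proof.
have [pq|pq] := pselect (p = q); last exact: prad_offdiag.
by subst q; apply/rad_diagE; exact: r0.
Qed.

Lemma radB p q (f g : mor p q) : rad f -> rad g -> rad (f - g).
Proof.
have [pq|pq] := pselect (p = q); last by move=> _ _; exact: prad_offdiag.
by subst q => /rad_diagE rf /rad_diagE rg; apply/rad_diagE; exact: rB.
Qed.

Lemma radD p q (f g : mor p q) : rad f -> rad g -> rad (f + g).
Proof.
move=> rf rg; rewrite -[g]opprK; apply: radB => //.
by rewrite -sub0r; apply: radB => //; exact: rad0.
Qed.

Lemma rad_comp p q s (u : mor q s) (f : mor p q) : rad u -> rad (u \oc f).
Proof.
move=> ru; have [ps|ps] := pselect (p = s); last exact: prad_offdiag.
subst s; apply/rad_diagE; have [_ [_ _ _ rr roff]] := rP.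
have [pq|pq] := pselect (p = q); last exact: roff.
subst q; have [n [g [rg ->]]] := r_decomp f; move/rad_diagE: ru => ru.
rewrite compDr -[u \oc (idm p *~ n)]/(comp_ahoml p u _) raddfMz /= compm1.
by apply: rD; [exact: rM|exact: rr].
Qed.

Lemma endo_decomp q (f : mor q q) : exists (n : int) g, rad g /\ f = idm q *~ n + g.
Proof. by have [n [g [rg fE]]] := r_decomp f; exists n, g; split=> //; apply/rad_diagE. Qed.

(** The right functor Q(-,q). *)
Definition repr_act (q : Q) (p p' : opcat Q) (u : mor p p')
    (f : zmodule (@mor Q p q)) : zmodule (@mor Q p' q) := @hcomp Q _ _ _ f u.
Lemma repr_act_linear q (p p' : opcat Q) (u : mor p p') : linear (@repr_act q p p' u).
Proof. by apply: additive_int_linear => f g; exact: (@compDl Q). Qed.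
Definition repr (q : Q) : qmod (opcat Q) int.
Proof.
apply: (@QMod (opcat Q) int (fun p => zmodule (@mor Q p q))
  (fun p p' u => lin (@repr_act_linear q p p' u))).
- by move=> p p' u v f; exact: (@compDr Q).
- by move=> p f; exact: (@compm1 Q).
- by move=> p p' p'' u v f; exact: (@Defs.compA Q).
Defined.

Definition rad_submodule (q : Q) (p : opcat Q) : submodule (repr q p).
Proof.
exists (fun f : @mor Q p q => rad f); first exact: rad0.
move=> a f g rf rg; apply: radD => //.
suff -> : a *: (f : repr q p) = @hcomp Q _ _ _ f (idm (p : Q) *~ a) by exact: rad_comp.
by rewrite scale_intE -[RHS]/(comp_ahoml _ f _) raddfMz /= compm1.
Defined.

Definition rad_functor (q : Q) : subfunctor (repr q).
Proof.
exists (rad_submodule q) => p p' u f rf.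
exact: rad_comp.
Defined.

(** Off the diagonal the radical is everything; on the diagonal the coefficient
    of the identity splits it off. *)
Lemma rad_split q p :
  exists s : {linear repr q p -> subm (rad_functor q p)}, forall x, s (sincl x) = x.
Proof.
have [pq|pq] := pselect ((p : Q) = q); last first.
  have [|s sE] := @subm_lift _ _ _ (rad_functor q p) (idfun : {linear _ -> _}).
    by move=> f; exact: prad_offdiag.
  by exists s => x; apply: sincl_inj; rewrite sE.
subst q; have [rho [rho1 rhoP]] := id_coef p.
have sL : linear (fun f : repr p p => f - idm (p : Q) *~ rho f).
  apply: additive_int_linear => f g.
  by rewrite (@afD _ _ rho) mulrzDr opprD addrACA.
have [|s sE] := @subm_lift _ _ _ (rad_functor p p) (lin sL).
  move=> f; apply/rad_diagE/rhoP; rewrite /= afB afMz rho1.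
  by rewrite [X in _ - X]intz subrr.
exists s => x; apply: sincl_inj; rewrite sE /=.
have /rad_diagE /rhoP x0 := sinclP x.
by rewrite [af rho _]x0 mulr0z subr0.
Qed.

(** Tor_1(Q(-,q) / rad(-,q), K) = 0: a relation among elements of rad K is a
    consequence of the relations in rad (x) K. This is the relative injectivity
    of the characters of K, applied to the radical inside Q(-,q). *)
Lemma rad_extend (R : pzRingType) (K : qmod Q R) (q : Q)
    (c : forall p, mor p q -> character (K p)) : hom_finite Q -> acyclic K ->
  (forall p (u v : mor p q), rad u -> rad v ->
     forall x, c p (u + v) x = c p u x + c p v x) ->
  (forall p p' (u : mor p q) (w : mor p' p), rad u ->
     forall x, c p' (u \oc w) x = c p u (mact K w x)) ->
  exists v : character (K q), forall p (u : mor p q), rad u ->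
    forall x, c p u x = v (mact K u x).
Proof.
move=> Qhom Kac cD cN.
pose f (p : opcat Q) (u : qsub (rad_functor q) p) : cdual K p := c p (sincl u).
have fL p : linear (f p).
  apply: additive_int_linear => u v; apply: ahomP => x.
  exact: cD (sinclP u) (sinclP v) x.
have fN (p p' : opcat Q) (w : mor p p') u :
    f p' (mact (qsub (rad_functor q)) w u) = mact (cdual K) w (f p u).
  by apply: ahomP => x; exact: cN (sinclP u) x.
have [||g gE] := Kac _ _ (qincl (rad_functor q)) _ _ (qmk fL fN).
- by move=> p; exact: (Qhom p q).2.
- by move=> p; exact: rad_split.
exists (g q (idm q)) => p u ru x.
pose u' : qsub (rad_functor q) p := @SubM _ _ (rad_functor q p) u ru.
have -> : c p u = g p u by exact: esym (gE p u').
have -> : g p u = mact (cdual K) (u : @mor (opcat Q) q p) (g q (idm q)).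
  by rewrite -qnat; congr (g p _); rewrite /= /repr_act (@comp1m Q).
by [].
Qed.

(** * Tops of functors *)

Section Top.
Variables (R : pzRingType).
Implicit Types X Y K : qmod Q R.

Inductive rad_span X q : X q -> Prop :=
| rad_span0 : rad_span (0 : X q)
| rad_spanD p (u : mor p q) (x : X p) y :
    rad u -> rad_span y -> rad_span (mact X u x + y).

Lemma rad_span_gen X p q (u : mor p q) (x : X p) : rad u -> rad_span (mact X u x).
Proof. by move=> ru; rewrite -[mact _ _ _]addr0; apply: rad_spanD => //; exact: rad_span0. Qed.

Lemma rad_spanA X q (x y : X q) : rad_span x -> rad_span y -> rad_span (x + y).
Proof.
move=> + ry; elim=> [|p u z w ru _ IH]; first by rewrite add0r.
by rewrite -addrA; exact: rad_spanD.
Qed.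

Definition rad_sub X q : submodule (X q).
Proof.
exists (@rad_span X q); first exact: rad_span0.
move=> a x y rx ry; apply: rad_spanA => //.
elim: rx => [|p u z w ru _ IH]; first by rewrite scaler0; exact: rad_span0.
by rewrite scalerDr -linearZ; exact: rad_spanD.
Defined.

Definition top X q : lmodType R := quot (rad_sub X q).

Lemma rad_span_kill X q (A : zmodType) (f : X q -> A) :
  (forall x y, f (x + y) = f x + f y) ->
  (forall p (u : mor p q) x, rad u -> f (mact X u x) = 0) ->
  forall x, rad_span x -> f x = 0.
Proof.
move=> fD fu x; elim=> [|p u z w ru _ IH]; first exact: additive0.
by rewrite fD fu // add0r.
Qed.

Lemma rad_span_map X Y (f : qhom X Y) q x : rad_span x -> rad_span (f q x).
Proof.
elim=> [|p u z w ru _ IH]; first by rewrite linear0; exact: rad_span0.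
by rewrite linearD qnat; exact: rad_spanD.
Qed.

Lemma rad_span_lift X Y (f : qhom X Y) q y : qepi f -> rad_span y ->
  exists2 x, rad_span x & f q x = y.
Proof.
move=> f_epi; elim=> [|p u z w ru _ [x rx <-]].
  by exists 0; [exact: rad_span0|exact: linear0].
have [z' <-] := f_epi p z; exists (mact X u z' + x); first exact: rad_spanD.
by rewrite linearD qnat.
Qed.

Section TopInduced.
Variables (d : duality Q) (Qfin : locally_finite (fun q : Q => q)).
Variable M : Q -> lmodType R.
Notation I := (ind d (fun q : Q => q) M).

(** Only the coefficient of the identity survives modulo the radical, so the top
    of an induced functor at q is the module M q that it is induced from. *)
Lemma top_ind q : exists t : {linear I q -> M q},
  [/\ forall m, t (@igen _ d _ (fun q => q) _ M q q (idm q) m) = m,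
      forall l, rad_span l -> t l = 0
    & forall l : I q, rad_span (l - igen d (ob := fun q => q) (idm q) (t l))].
Proof.
have [rho [rho1 rhoP]] := id_coef q.
pose V (j : Q) := mor j q -> M j -> M q.
pose b0 : V q := fun f m => m *~ rho f.
pose b (j : Q) : V j :=
  if pselect (q = j) is left e then eq_rect q V b0 j e else fun _ _ => 0.
have bq : b q = b0.
  by rewrite /b; case: pselect => // e; rewrite (Prop_irrelevance e erefl).
have bneq j f m : q <> j -> b j f m = 0 by rewrite /b; case: pselect.
have bDl j f g m : b j (f + g) m = b j f m + b j g m.
  have [qj|qj] := pselect (q = j); last by rewrite !bneq // addr0.
  by subst j; rewrite bq /b0 raddfD mulrzDr.
have bL j f a m m' : b j f (a *: m + m') = a *: b j f m + b j f m'.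
  have [qj|qj] := pselect (q = j); last by rewrite !bneq // scaler0 addr0.
  by subst j; rewrite bq /b0 mulrzDl scalerMzr.
have bDr j f m m' : b j f (m + m') = b j f m + b j f m'.
  by rewrite -[m]scale1r bL !scale1r.
pose F (l : I q) := ind_eval Qfin b l.
have FD x y : F (x + y) = F x + F y by exact: (ind_evalD Qfin bDr).
have FL : linear F.
  move=> a x y; rewrite FD; congr (_ + _).
  rewrite /F /ind_eval scaler_sumr; apply: eq_bigr => t _.
  rewrite dprodZE ahomZE -[a *: af _ _]addr0 bL.
  by rewrite -[X in _ + X](addrK (b _ (bas t) 0)) -bDr addr0 subrr addr0.
have Fgen j (f : mor j q) m : F (igen d f m) = b j f m.
  exact: (ind_eval_gen d Qfin bDl bDr).
exists (lin FL); split=> [m|l|l].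
- by rewrite /= Fgen bq /b0 rho1 mulr1z.
- apply: (rad_span_kill (f := F)) => [x y|p u x ru].
    exact: FD.
  move: x; apply: (ind_additive_ext Qfin) => [x y|//|j f m].
  + by rewrite linearD FD.
  + by rewrite addr0.
  rewrite igen_act Fgen.
  have [qj|qj] := pselect (q = j); last by rewrite bneq.
  subst j; rewrite bq /b0; have /rad_diagE/rhoP -> := rad_comp f ru.
  by rewrite mulr0z.
- apply/(qpi_eq0 (rad_sub I q)); rewrite linearB; apply/subr0_eq.
  rewrite subr0; apply/eqP; rewrite subr_eq0; apply/eqP; move: l.
  apply: (ind_additive_ext Qfin) => [x y|x y|j f m].
  + exact: linearD.
  + by rewrite linearD igenDr linearD.
  rewrite -[lin FL _]/(F _) Fgen.
  have [qj|qj] := pselect (q = j); last first.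
    pose gq : {linear M q -> I q} :=
      lin (@igen_linear Q d Q (fun q => q) R M q q (idm q)).
    rewrite bneq // -[X in _ = qpi _ X]/(gq 0) (linear0 gq) linear0; apply/(qpi_eq0 (rad_sub I q)).
    rewrite -[f]compm1 -igen_act; apply: rad_span_gen.
    by apply: prad_offdiag => jq; exact: qj.
  subst j; rewrite bq /b0; have [n [g [rg fE]]] := endo_decomp f.
  have rho_f : rho f = n.
    rewrite fE afD afMz rho1; have /rad_diagE/rhoP -> := rg.
    by rewrite addr0 intz.
  rewrite rho_f fE igenDl linearD.
  have qg0 : qpi (rad_sub I q) (@igen Q d Q (fun q => q) R M q q g m) = 0.
    apply/(qpi_eq0 (rad_sub I q)); rewrite -[g]compm1 -igen_act.
    exact: rad_span_gen.
  rewrite [X in _ + X]qg0 addr0; congr qpi.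
  pose gl : ahom (mor q q) (I q) := AHom (fun f g => @igenDl _ d _ (fun q => q) _ M q q f g m).
  pose gr : ahom (M q) (I q) := AHom (@igenDr _ d _ (fun q => q) _ M q q (idm q)).
  by rewrite -[LHS]/(gl _) -[RHS]/(gr _) !raddfMz.
Qed.
End TopInduced.
End Top.
End PseudoRadical.

Section FlatTop.
Variables (Q : preadditive) (r : forall q : Q, set (mor q q)).
Arguments r : clear implicits.
Hypotheses (rP : strong_retraction r) (Qhom : hom_finite Q).
Notation rad := (pseudo_radical r).
Variables (d : duality Q) (Qfin : locally_finite (fun q : Q => q)).
Variables (d' : duality (opcat Q)) (Q'fin : locally_finite (fun q : opcat Q => q)).
Variable R : pzRingType.
Implicit Types K X Y : qmod Q R.

Lemma acyclic_emb K : acyclic (emb_ob d K).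
Proof. exact: acyclic_ind. Qed.

Lemma acyclic_cosyz K : acyclic K -> acyclic (cosyz d K).
Proof.
move=> Kac; exact: (acyclic_quotient d' Q'fin (cosyz_ses d K) Kac (@acyclic_emb K)).
Qed.

Lemma cosyz_flat K : (forall q, charflat (K q)) -> forall q, charflat (cosyz d K q).
Proof.
move=> Kflat q; have [s sE] := cosyz_retract d K q.
by apply: (charflat_retract sE); apply: ind_ob_flat.
Qed.

(** The vanishing of Tor_1(Q(-,q) / rad(-,q), cosyz K). If x is not in the
    radical of K, a character c of K q kills that radical but not x. An extension
    of c to emb_ob K is corrected by a character of cosyz K so as to kill the
    radical of emb_ob K; the correction does not change it on K. *)
Lemma top_emb_inj K q x : acyclic (cosyz d K) ->
  rad_span r (emb d K q x) -> rad_span r x.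
Proof.
move=> K1ac ex; apply: contrapT => xr.
have [||c c0 cx] := @character_separates _ (@rad_span Q r R K q) x _ _ xr.
- exact: rad_span0.
- by move=> u v ru rv; exact: (@smemB _ _ (rad_sub r K q) u v ru rv).
have kS := cosyz_ses d K; set p := cosyz_proj d K in kS.
have [c' c'E] := character_extend (fun x y => linearD (emb d K q) x y)
  (@emb_mono _ d _ K q) (@afD _ _ c).
pose ac p' (u : mor p' q) : character (emb_ob d K p') :=
  ahom_comp c' (ahom_of_linear (mact (emb_ob d K) u)).
have descend p' (u : mor p' q) :
    exists e : character (cosyz d K p'), rad u -> forall y, e (p p' y) = ac p' u y.
  have [ru|] := pselect (rad u); last by exists 0.
  have [|e eE] := (ses_ker (cdual_ses kS p') (ac p' u)).1.
    apply: ahomP => y.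
    rewrite -[LHS]/(c' (mact (emb_ob d K) u (emb d K p' y))) -qnat c'E.
    rewrite -[RHS]/(0 : QZ); apply: c0.
    exact: rad_span_gen.
  by exists e => _ y; rewrite -eE.
have [e eE] := dchoice2 descend.
have p_epi q' := ses_surj (kS q').
have [||v vE] := @rad_extend Q r rP R (cosyz d K) q e Qhom K1ac.
- move=> p' u w ru rw y; have [y' <-] := p_epi p' y.
  rewrite !eE //; last by apply: radD.
  by rewrite -[LHS]/(c' (mact (emb_ob d K) (u + w) y')) mactD afD.
- move=> p' p'' u w ru y; have [y' <-] := p_epi p'' y.
  rewrite -qnat !eE //; last exact: rad_comp.
  by rewrite -[LHS]/(c' (mact (emb_ob d K) (u \oc w) y')) mactM.
pose psi : character (emb_ob d K q) := c' - ahom_comp v (ahom_of_linear (p q)).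
have psi0 : psi (emb d K q x) = 0.
  apply: (rad_span_kill (f := psi)) ex => [y z|p' u y ru]; first exact: afD.
  rewrite ahomDE ahomNE -[X in _ - X]/(v (p q (mact (emb_ob d K) u y))).
  by rewrite qnat -vE // eE // subrr.
apply: cx; rewrite -c'E; move: psi0.
rewrite ahomDE ahomNE -[X in _ - X]/(v (p q (emb d K q x))).
by rewrite (ses0 x (kS q)) af0 subr0.
Qed.

(** Tensoring 0 -> K -> emb_ob K -> cosyz K -> 0 with the top of Q(-,q)
    preserves exactness, and the middle term becomes K (dob q). *)
Lemma top_ses K q : acyclic (cosyz d K) ->
  exists (i : {linear top r K q -> K (dob d q)})
    (p : {linear K (dob d q) -> top r (cosyz d K) q}), ses i p.
Proof.
move=> K1ac; have kS := cosyz_ses d K; set p := cosyz_proj d K in kS.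
have [t [t1 t0 tE]] := top_ind rP d Qfin (fun q => K (dob d q)) q.
pose gq : {linear K (dob d q) -> emb_ob d K q} :=
  lin (@igen_linear Q d Q (fun q => q) R (fun q => K (dob d q)) q q (idm q)).
have [|i iE] := quot_lift (S := rad_sub r K q) (f := t \o emb d K q : {linear _ -> _}).
  by move=> x rx; apply: t0; exact: rad_span_map.
pose p' : {linear K (dob d q) -> top r (cosyz d K) q} :=
  (qpi (rad_sub r (cosyz d K) q) \o p q) \o gq.
have p'E m : p' m = qpi (rad_sub r (cosyz d K) q) (p q (gq m)) by [].
have p't l : p' (t l) = qpi (rad_sub r (cosyz d K) q) (p q l).
  rewrite p'E; symmetry; apply: qpi_eq; rewrite -linearB.
  apply: rad_span_map; exact: tE.
exists i, p'; split.
- apply: linear_inj => x; rewrite -[x]qvalK iE /= => tx.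
  apply/(qpi_eq0 (rad_sub r K q)); apply: top_emb_inj => //.
  have := tE (emb d K q (qval x)); rewrite tx.
  by rewrite -[igen _ _ 0]/(gq 0) linear0 subr0.
- move=> z; have [l lz] := ses_surj (kS q) (qval z).
  by exists (t l); rewrite p't lz qvalK.
- move=> m; split=> [|[x <-]]; last first.
    rewrite -[x]qvalK iE -[LHS]/(p' (t (emb d K q (qval x)))) p't.
    by rewrite (ses0 _ (kS q)) linear0.
  rewrite p'E => /qpi_eq0 rm.
  have [y ry yE] := rad_span_lift (fun q => ses_surj (kS q)) rm.
  have /(ses_ker (kS q))[x xE] : p q (gq m - y) = 0 by rewrite linearB yE subrr.
  exists (qpi _ x); rewrite iE -[LHS]/(t (emb d K q x)) xE linearB (t0 y ry) subr0.
  exact: t1.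
Qed.

(** By the exact sequence, top K is the kernel of a flat cover of the top of
    cosyz K, which satisfies the same hypotheses; so a common bound on the flat
    dimension of all these tops can be lowered down to 0. *)
Lemma top_flat n : (forall M : lmodType R, flatdim n M) ->
  forall K q, acyclic K -> (forall q, charflat (K q)) -> charflat (top r K q).
Proof.
move=> Rn K q Kac Kflat.
suff H m : (forall K q, acyclic K -> (forall q, charflat (K q)) ->
      flatdim m (top r K q)) ->
    forall K q, acyclic K -> (forall q, charflat (K q)) ->
      flatdim 0 (top r K q).
  by apply: (H n) => // *; exact: Rn.
elim: m => [//|m IH] Hm; apply: IH => {}K {}q {}Kac {}Kflat.
have K1ac := acyclic_cosyz Kac.
have [i [p ip]] := top_ses q K1ac.
exact: (Hm _ _ K1ac (cosyz_flat Kflat) _ _ _ _ ip).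
Qed.

End FlatTop.

(** * A flatness criterion *)

Section RightDual.
Variables (R : pzRingType) (V : lmodType R).

Definition rdual := character V.
HB.instance Definition _ := GRing.Zmodule.on rdual.

Definition rdual_scale (a : R^c) (c : rdual) : rdual.
Proof.
exists (fun x => c ((a : R) *: x)) => x y.
by rewrite scalerDr afD.
Defined.

Let scaleA a b c : rdual_scale a (rdual_scale b c) = rdual_scale (a * b) c.
Proof. by apply: ahomP => x /=; rewrite scalerA. Qed.
Let scale1 : left_id 1 rdual_scale.
Proof. by move=> c; apply: ahomP => x /=; rewrite scale1r. Qed.
Let scaleDr : right_distributive rdual_scale +%R.
Proof. by move=> a c c'; apply: ahomP. Qed.
Let scaleDl c : {morph rdual_scale^~ c : a b / a + b}.
Proof. by move=> a b; apply: ahomP => x /=; rewrite scalerDl afD. Qed.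
HB.instance Definition _ := GRing.Zmodule_isLmodule.Build R^c rdual
  scaleA scale1 scaleDr scaleDl.

Lemma rdualZE (a : R) (c : rdual) x : ((a : R^c) *: c) x = c (a *: x).
Proof. by []. Qed.
End RightDual.

Lemma sub_sub_cancel (V : zmodType) (a b c : V) : (c - b) - (c - a) = a - b.
Proof. by rewrite opprB [LHS]addrC addrA subrK. Qed.

Section CharacterRetraction.
Variables (Q : preadditive) (r : forall q : Q, set (mor q q)).
Arguments r : clear implicits.
Hypotheses (rP : strong_retraction r) (Qhom : hom_finite Q).
Notation rad := (pseudo_radical r).
Hypothesis rnil : ideal_nilpotent rad.
Variables (R : pzRingType) (K M : qmod Q R) (e : qhom M K).
Hypotheses (e_epi : qepi e) (Kac : acyclic K).
Hypothesis Ktop : forall q, charflat (top r K q).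

Definition cact (X : qmod Q R) p q (u : mor p q) (c : rdual (X q)) : rdual (X p) :=
  ahom_comp c (ahom_of_linear (mact X u)).
Definition pull q (c : character (K q)) : rdual (M q) :=
  ahom_comp c (ahom_of_linear (e q)).

Lemma cactE (X : qmod Q R) p q (u : mor p q) (c : rdual (X q)) x :
  cact u c x = c (mact X u x).
Proof. by []. Qed.
Lemma pullE q (c : character (K q)) x : pull c x = c (e q x).
Proof. by []. Qed.

Lemma cactD' (X : qmod Q R) p q (u : mor p q) (c c' : rdual (X q)) :
  cact u (c + c') = cact u c + cact u c'.
Proof. exact: ahomP. Qed.

Lemma cact_pull p q (u : mor p q) (c : character (K q)) :
  cact u (pull c) = pull (cact u c).
Proof. by apply: ahomP => x; rewrite !cactE !pullE qnat. Qed.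
Lemma cact1 (X : qmod Q R) q (c : rdual (X q)) : cact (idm q) c = c.
Proof. by apply: ahomP => x; rewrite cactE mact1. Qed.
Lemma cactM (X : qmod Q R) p q s (v : mor q s) (u : mor p q) (c : rdual (X s)) :
  cact u (cact v c) = cact (v \oc u) c.
Proof. by apply: ahomP => x; rewrite !cactE mactM. Qed.
Lemma cactD (X : qmod Q R) p q (u v : mor p q) (c : rdual (X q)) :
  cact (u + v) c = cact u c + cact v c.
Proof. by apply: ahomP => x; rewrite ahomDE !cactE mactD afD. Qed.
Lemma cactB (X : qmod Q R) p q (u : mor p q) (c c' : rdual (X q)) :
  cact u (c - c') = cact u c - cact u c'.
Proof. by apply: ahomP. Qed.

Lemma cact0 (X : qmod Q R) p q (u : mor p q) : cact u (0 : rdual (X q)) = 0.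
Proof. exact: ahomP. Qed.
Lemma pull0 q : pull (0 : character (K q)) = 0. Proof. exact: ahomP. Qed.
Lemma pullD q (c c' : character (K q)) : pull (c + c') = pull c + pull c'.
Proof. exact: ahomP. Qed.
Lemma pullB q (c c' : character (K q)) : pull (c - c') = pull c - pull c'.
Proof. exact: ahomP. Qed.

(** The socle of the right functor of characters of K consists of the
    characters of the tops of K, and these form injective modules. *)
Definition socle q : submodule (rdual (K q)).
Proof.
apply: (@Submodule R^c (rdual (K q))
  (fun c => forall x, rad_span r x -> af c x = 0)); first by [].
move=> a c c' c0 c'0 x rx.
rewrite ahomDE rdualZE c'0 // addr0; apply: c0.
exact: (smemZ (S := rad_sub r K q)).
Defined.

(** The characters of the top of K form an injective module, so the inclusion of
    the socle in the characters of M q has a retraction. *)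
Lemma socle_retraction q : exists eps : rdual (M q) -> character (K q),
  [/\ forall c c', eps (c + c') = eps c + eps c',
      forall (a : R) c x, eps ((a : R^c) *: c) x = eps c (a *: x),
      forall c x, rad_span r x -> eps c x = 0
    & forall c, socle q c -> eps (pull c) = c].
Proof.
have jL : linear (fun c : subm (socle q) => pull (sincl c)).
  by move=> a c c'; apply: ahomP => x; rewrite pullE !ahomDE !rdualZE !pullE linearZ.
have j_inj : injective (lin jL).
  move=> c c' cc'; apply: sincl_inj; apply: ahomP => x; have [y <-] := e_epi x.
  exact: (congr1 (fun w : rdual (M q) => w y) cc').
have cE (c : subm (socle q)) x : af (sincl c) (qval (qpi (rad_sub r K q) x)) = af (sincl c) x.
  apply: subr0_eq; rewrite -afB; apply: (sinclP c); exact: (@qval_qpi _ _ (rad_sub r K q) x).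
have bb : balanced (fun (c : subm (socle q)) (x : top r K q) => af (sincl c) (qval x)).
  split=> [//|c x y|a c x].
  - by rewrite -{1}[x]qvalK -{1}[y]qvalK -linearD cE afD.
  - by rewrite -{2}[x]qvalK -linearZ cE.
have [b b_bal bE] := Ktop j_inj bb.
have epsD c x y : b c (qpi (rad_sub r K q) (x + y)) =
    b c (qpi (rad_sub r K q) x) + b c (qpi (rad_sub r K q) y).
  by rewrite linearD (balancedDr b_bal).
exists (fun c => AHom (epsD c)); split.
- by move=> c c'; apply: ahomP => x; exact: (balancedDl b_bal).
- by move=> a c x; rewrite /= (balancedZ b_bal) linearZ.
- by move=> c x /(qpi_eq0 (rad_sub r K q)) x0; rewrite /= x0 balanced0r.
- move=> c cs; apply: ahomP => x; pose c' := @SubM _ _ (socle q) c cs.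
  by rewrite /= -[pull c]/(lin jL c') bE cE.
Qed.

Section Retraction.
Variable eps : forall q, rdual (M q) -> character (K q).
Hypothesis epsD : forall q (c c' : rdual (M q)), eps (c + c') = eps c + eps c'.
Hypothesis epsZ : forall q (a : R) (c : rdual (M q)) x,
  eps ((a : R^c) *: c) x = eps c (a *: x).
Hypothesis eps_rad : forall q (c : rdual (M q)) x, rad_span r x -> eps c x = 0.
Hypothesis eps_soc : forall q c, socle q c -> eps (pull c) = c.

(** The kernel of the map from the characters of M to the injective hull of the
    socle of the characters of K. *)
Definition null q (c : rdual (M q)) := forall p (u : mor p q), eps (cact u c) = 0.

Lemma eps0 q : eps (0 : rdual (M q)) = 0.
Proof. exact: additive0 (@epsD q). Qed.
Lemma epsN q (c : rdual (M q)) : eps (- c) = - eps c.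
Proof. exact: additiveN (@epsD q) c. Qed.
Lemma epsB q (c c' : rdual (M q)) : eps (c - c') = eps c - eps c'.
Proof. by rewrite epsD epsN. Qed.

Lemma nullB q (c c' : rdual (M q)) : null c -> null c' -> null (c - c').
Proof. by move=> c0 c'0 p u; rewrite cactB epsB c0 c'0 subr0. Qed.

Lemma null0 q : null (0 : rdual (M q)).
Proof. by move=> p u; rewrite cact0 eps0. Qed.

Lemma nullD q (c c' : rdual (M q)) : null c -> null c' -> null (c + c').
Proof. by move=> c0 c'0 p u; rewrite cactD' epsD c0 c'0 addr0. Qed.

Lemma null_act p q (u : mor p q) (c : rdual (M q)) : null c -> null (cact u c).
Proof. by move=> c0 p' v; rewrite cactM. Qed.

(** The socle is essential, by nilpotence. *)
Lemma null_pull_power n q (c : character (K q)) :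
  (forall p (u : mor p q), ideal_exp rad n u -> cact u c = 0) ->
  null (pull c) -> c = 0.
Proof.
elim: n q c => [|n IH] q c cn c0; first by rewrite -(cact1 c); exact: cn.
have cr p (u : mor p q) : rad u -> cact u c = 0.
  move=> ru; apply: IH; last by rewrite -cact_pull; exact: null_act.
  move=> p' v vn; rewrite cactM; apply: cn.
  by rewrite -[_ \oc _]addr0; apply: ideal_mulD => //; exact: ideal_mul0.
have cs : socle q c.
  apply: rad_span_kill => [x y|p u x ru]; first exact: afD.
  exact: (congr1 (fun w : rdual (K p) => w x) (cr p u ru)).
by rewrite -(eps_soc cs) -[pull c]cact1; exact: c0.
Qed.

Lemma null_pull q (c : character (K q)) : null (pull c) -> c = 0.
Proof.
have [n n0] := rnil; apply: (@null_pull_power n) => p u /n0 ->.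
by apply: ahomP => x; rewrite cactE mact0 af0.
Qed.

Lemma null_uniq q (c : rdual (M q)) (k k' : character (K q)) :
  null (c - pull k) -> null (c - pull k') -> k = k'.
Proof.
move=> ck ck'; apply: subr0_eq; apply: null_pull.
have -> : pull (k - k') = (c - pull k') - (c - pull k).
  by rewrite pullB sub_sub_cancel.
exact: nullB.
Qed.

(** The characters of K fill the injective hull of their socle: the vanishing
    of Tor_1 extends a solution from the radical to all of K. *)
Lemma null_approx_power n q (c : rdual (M q)) :
  (forall p (u : mor p q), ideal_exp rad n u -> null (cact u c)) ->
  exists k : character (K q), null (c - pull k).
Proof.
elim: n q c => [|n IH] q c cn.
  by exists 0; rewrite pull0 subr0 -(cact1 c); exact: cn.
have step p (u : mor p q) :
    exists k : character (K p), rad u -> null (cact u c - pull k).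
  have [ru|] := pselect (rad u); last by exists 0.
  have [|k kE] := IH p (cact u c); last by exists k.
  move=> p' v vn; rewrite cactM; apply: cn.
  by rewrite -[_ \oc _]addr0; apply: ideal_mulD => //; exact: ideal_mul0.
have [k kE] := dchoice2 step.
have [||v vE] := @rad_extend Q r rP R K q k Qhom Kac.
- move=> p u w ru rw x; rewrite -[RHS]/((k p u + k p w) x); congr af.
  apply: null_uniq (kE _ _ (radD rP ru rw)) _.
  by rewrite cactD pullD opprD addrACA; apply: nullD; exact: kE.
- move=> p p' u w ru x; rewrite -[RHS]/(cact w (k p u) x); congr af.
  apply: null_uniq (kE _ _ (rad_comp rP w ru)) _.
  by rewrite -cactM -cact_pull -cactB; apply: null_act; exact: kE.
have cv p (u : mor p q) : rad u -> null (cact u (c - pull v)).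
  move=> ru; rewrite cactB cact_pull.
  have -> : cact u v = k p u :> character _.
    by apply: ahomP => x; rewrite vE.
  exact: kE.
pose s := eps (c - pull v).
have ss : socle q s by move=> x; exact: eps_rad.
have srad p (u : mor p q) : rad u -> cact u s = 0.
  move=> ru; apply: ahomP => x; rewrite cactE ss //; exact: rad_span_gen.
have ns p (u : mor p q) : rad u -> eps (cact u (c - pull v - pull s)) = 0.
  move=> ru; rewrite cactB epsB (_ : eps (cact u (c - pull v)) = 0); last first.
    by rewrite -[cact _ _]cact1; exact: cv.
  by rewrite cact_pull srad // pull0 eps0 subr0.
exists (v + s); rewrite pullD opprD addrA => p u.
have [pq|pq] := pselect (p = q); last by apply: ns; exact: prad_offdiag.
subst p; have [m [g [rg ->]]] := endo_decomp rP u.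
rewrite cactD epsD (ns _ g rg) addr0.
have -> : cact (idm q *~ m) (c - pull v - pull s) = (c - pull v - pull s) *~ m.
  pose cl : ahom (mor q q) (rdual (M q)) :=
    AHom (fun u u' => cactD u u' (c - pull v - pull s)).
  by rewrite -[LHS]/(cl _) afMz /= cact1.
pose el : ahom (rdual (M q)) (character (K q)) := AHom (@epsD q).
by rewrite -[LHS]/(el _) afMz /= epsB (eps_soc ss) subrr mul0rz.
Qed.

Lemma null_approx q (c : rdual (M q)) : exists k : character (K q), null (c - pull k).
Proof.
have [n n0] := rnil; apply: (@null_approx_power n) => p u /n0 -> p' v.
rewrite cactM comp0m (_ : cact 0 c = 0) ?eps0 //.
by apply: ahomP => x; rewrite cactE mact0 af0.
Qed.
End Retraction.

(** The right functor of characters of K is injective, so it is a direct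
    summand of that of M. *)
Lemma character_retraction : exists rho : forall q, rdual (M q) -> rdual (K q),
  [/\ forall q (c c' : rdual (M q)), rho q (c + c') = rho q c + rho q c',
      forall q (a : R) (c : rdual (M q)), rho q ((a : R^c) *: c) = (a : R^c) *: rho q c,
      forall p q (u : mor p q) c, rho p (cact u c) = cact u (rho q c)
    & forall q (c : character (K q)), rho q (pull c) = c].
Proof.
have [eps epsP] := dchoice socle_retraction.
have epsD q : forall c c', eps q (c + c') = eps q c + eps q c' by have [] := epsP q.
have epsZ q : forall (a : R) c x, eps q ((a : R^c) *: c) x = eps q c (a *: x).
  by have [] := epsP q.
have eps_rad q : forall c x, rad_span r x -> eps q c x = 0 by have [] := epsP q.
have eps_soc q : forall c, socle q c -> eps q (pull c) = c by have [] := epsP q.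
have [rho rhoP] := dchoice2 (null_approx epsD eps_rad eps_soc).
have uniq q c k : null eps (c - pull k) -> rho q c = k.
  exact: (null_uniq epsD eps_soc (rhoP q c)).
exists rho; split.
- move=> q c c'; apply: uniq.
  rewrite pullD opprD addrACA.
  exact: (nullD epsD (rhoP q c) (rhoP q c')).
- move=> q a c; apply: uniq => p u.
  have -> : cact u ((a : R^c) *: c - pull ((a : R^c) *: (rho q c : rdual (K q)))) =
      (a : R^c) *: cact u (c - pull (rho q c)).
    apply: ahomP => x; rewrite rdualZE !cactE !ahomDE !ahomNE rdualZE.
    by rewrite !pullE rdualZE -!linearZ.
  by apply: ahomP => x; rewrite epsZ (rhoP q c p u).
- move=> p q u c; apply: uniq.
  by rewrite -cact_pull -cactB; apply: null_act; exact: rhoP.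
- by move=> q c; apply: uniq; rewrite subrr; exact: null0.
Qed.
End CharacterRetraction.

Lemma finite_locally_finite (Q : preadditive) n (o : 'I_n -> Q) : locally_finite o.
Proof. by move=> p; exists n, id; split=> // j _; exists j. Qed.

Section FlatnessCriterion.
Variables (Q : preadditive) (r : forall q : Q, set (mor q q)).
Arguments r : clear implicits.
Hypotheses (rP : strong_retraction r) (Qhom : hom_finite Q).
Notation rad := (pseudo_radical r).
Hypothesis rnil : ideal_nilpotent rad.
Variables (d : duality Q) (R : pzRingType).
Implicit Types K M X Y : qmod Q R.

Definition fgfree n (o : 'I_n -> Q) : qmod Q R := ind d o (fun _ => R^o).
Definition fggen n (o : 'I_n -> Q) p j (u : mor (o j) p) (a : R) : fgfree o p :=
  @igen Q d _ o R (fun _ => R^o) p j u a.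

(** By Yoneda's lemma. The lift is chosen as a function of the elements xi j, for
    its additivity in them to make sense. *)
Lemma fgfree_lift n (o : 'I_n -> Q) Y : exists k : dprod (fun j => Y (o j)) ->
  qhom (fgfree o) Y, forall xi p j (u : mor (o j) p) a,
    k xi p (fggen u a) = mact Y u (a *: xi j).
Proof.
suff H (xi : dprod (fun j => Y (o j))) : exists k : qhom (fgfree o) Y,
    forall p j (u : mor (o j) p) a, k p (fggen u a) = mact Y u (a *: xi j).
  by have [k kE] := choice H; exists k.
have gL j : linear (fun a : R^o => (a : R) *: (xi j : Y (o j))).
  by move=> a b c; rewrite scalerDl scalerA.
have [k kE] := ind_lift d (finite_locally_finite o) (fun j => lin (gL j)).
by exists k => p j u a; exact: kE.
Qed.

Lemma fgfree_ext n (o : 'I_n -> Q) (A : zmodType) p (F G : fgfree o p -> A) :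
  (forall x y, F (x + y) = F x + F y) -> (forall x y, G (x + y) = G x + G y) ->
  (forall j (u : mor (o j) p) a, F (fggen u a) = G (fggen u a)) -> F =1 G.
Proof. exact: (ind_additive_ext (finite_locally_finite o)). Qed.

Lemma fgfree_cover X : qfg X -> exists n (o : 'I_n -> Q) (c : qhom (fgfree o) X), qepi c.
Proof.
move=> [n [o [x xP]]]; exists n, o; have [k kE] := fgfree_lift o X.
exists (k x) => q y; apply: (xP (fun q => [set y | exists z, k x q z = y]%classic)).
- by move=> p; exists 0; exact: linear0.
- by move=> p a _ _ [y1 <-] [y2 <-]; exists (a *: y1 + y2); exact: linearP.
- by move=> p p' u _ [z <-]; exists (mact _ u z); exact: qnat.
- by move=> i; exists (fggen (idm _) 1); rewrite kE mact1 scale1r.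
Qed.

(** For T with presentation f : P1 -> P0, a map T -> K lifts to M up to a map from
    P1 to the kernel of e, which has to extend over P0. If it does not, a
    character chi of the values of M separates it from those that do. The
    retraction turns chi into a character of the values of K that agrees with chi
    on all maps P1 -> M that extend over P0; so chi kills the given map, which
    vanishes in K. *)
Lemma qflat_of_top K : acyclic K -> (forall q, charflat (top r K q)) -> qflat K.
Proof.
move=> Kac Ktop M e e_epi T [P1 [P0 [f [c [[P1proj P1fg] [P0proj P0fg] c_epi ex]]]]] g.
have eS := qkernel_ses e_epi; set L := qsub (qkernel e) in eS.
set i := qincl (qkernel e) in eS.
have [g0 g0E] := P0proj _ _ e (qcomp g c) e_epi.
have [m [o [b b_epi]]] := fgfree_cover P0fg.
have [s sE] := P0proj _ _ b (qid P0) b_epi.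
have {P1fg} [n [o1 [x1 x1P]]] := P1fg.
pose y t : fgfree o (o1 t) := s _ (f _ (x1 t)).
pose S (w : dprod (fun t => M (o1 t))) :=
  exists h : qhom P0 L, forall t, w t = i _ (h _ (f _ (x1 t))).
pose l : dprod (fun t => M (o1 t)) := fun t => g0 _ (f _ (x1 t)).
have [[h hE]|Sl] := pselect (S l).
  pose k := qsubh g0 (qcomp i h).
  have kf q z : qcomp k f q z = 0.
    apply: (x1P (fun q => [set z | qcomp k f q z = 0]%classic)).
    - by move=> p; exact: (linear0 (qcomp k f p)).
    - move=> p a u v ku kv; apply: etrans (linearP (qcomp k f p) a u v) _.
      by rewrite [X in _ *: X]ku [X in _ + X]kv scaler0 addr0.
    - move=> p p' u v kv; apply: etrans (qnat (qcomp k f) u v) _.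
      by rewrite [X in mact _ _ X]kv linear0.
    - move=> t; rewrite /= -[LHS]/(l t - i _ (h _ (f _ (x1 t)))).
      by rewrite -hE subrr.
  have [|k' k'E] := @qses_factor _ _ _ _ _ _ _ _ k (qkernel_ses c_epi).
    move=> q z; have /(ex q)[w <-] : c q (qincl (qkernel c) q z) = 0 := sinclP z.
    exact: kf.
  exists k' => q z; have [w <-] := c_epi q z; rewrite k'E.
  rewrite -[k q w]/(g0 q w - i q (h q w)) linearB g0E.
  by rewrite (ses0 _ (eS q)) subr0.
have [||chi chi0 chil] := character_separates _ _ Sl.
- have oL q : linear (fun _ : P0 q => 0 : L q) by move=> a u v; rewrite scaler0 addr0.
  have oN p q (u : mor p q) (x : P0 p) : (0 : L q) = mact L u 0 by rewrite linear0.
  by exists (qmk oL oN).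
- move=> u v [h hE] [k kE]; exists (qsubh h k) => t.
  by rewrite dprodDE dprodNE hE kE -linearB.
(* The components of chi are compared with their images under rho. *)
have [rho [rhoD rhoZ rhoN rho_pull]] := character_retraction rP Qhom rnil e_epi Kac Ktop.
pose chi_ t : rdual (M (o1 t)) := ahom_comp chi
  (AHom (@dsingleD _ (fun t => M (o1 t)) t)).
have chiE w : chi w = \sum_t chi_ t (w t).
  by rewrite {1}[w]dprod_decomp raddf_sum.
have [kM kME] := fgfree_lift o M; have [kK kKE] := fgfree_lift o K.
have [kL kLE] := fgfree_lift o L.
have kMD p z j : {morph (fun x : M (o j) => kM (dsingle x) p z) : x x' / x + x'}.
  move=> x x'; move: z; apply: fgfree_ext => [z z'|z z'|j' u a].
  - exact: linearD.
  - by rewrite !linearD addrACA.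
  by rewrite !kME dsingleD dprodDE scalerDr linearD.
have kKD p z j : {morph (fun x : K (o j) => kK (dsingle x) p z) : x x' / x + x'}.
  move=> x x'; move: z; apply: fgfree_ext => [z z'|z z'|j' u a].
  - exact: linearD.
  - by rewrite !linearD addrACA.
  by rewrite !kKE dsingleD dprodDE scalerDr linearD.
pose DM p (k : rdual (M p)) z j : rdual (M (o j)) := ahom_comp k (AHom (@kMD p z j)).
pose DK p (k : rdual (K p)) z j : rdual (K (o j)) := ahom_comp k (AHom (@kKD p z j)).
have rho0 q : rho q 0 = 0 by exact: additive0 (@rhoD q).
have rhoDM p k z j : rho _ (DM p k z j) = DK p (rho p k) z j.
  move: z; apply: fgfree_ext => [z z'|z z'|j' u a].
  - rewrite -rhoD; congr (rho _); apply: ahomP => x.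
    by rewrite ahomDE /= linearD afD.
  - by apply: ahomP => x; rewrite ahomDE /= linearD afD.
  have [jj'|jj'] := pselect (j = j'); last first.
    have -> : DM p k (fggen u a) j = 0.
      by apply: ahomP => x; rewrite /= kME dsingle_neq // scaler0 linear0 af0.
    rewrite rho0; apply: ahomP => x.
    by rewrite /= kKE dsingle_neq // scaler0 linear0 af0.
  subst j'.
  have -> : DM p k (fggen u a) j = (a : R^c) *: cact u k.
    by apply: ahomP => x; rewrite rdualZE /= kME dsingle_same.
  rewrite rhoZ rhoN; apply: ahomP => x.
  by rewrite rdualZE /= kKE dsingle_same.
have claim1 (k : qhom (fgfree o) L) : \sum_t chi_ t (i _ (k _ (y t))) = 0.
  pose w : dprod (fun t => M (o1 t)) := fun t => i _ (k _ (y t)).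
  have Sw : S w by exists (qcomp k s).
  by rewrite -[RHS](chi0 w Sw) chiE.
have ekM p z j (x : M (o j)) : e p (kM (dsingle x) p z) = kK (dsingle (e _ x)) p z.
  move: z; apply: fgfree_ext => [z z'|z z'|j' u a].
  - by rewrite !linearD.
  - by rewrite !linearD.
  rewrite kME kKE qnat linearZ; apply: (congr1 (fun v => mact K u (a *: v))).
  have [jj'|jj'] := pselect (j = j'); last by rewrite !dsingle_neq // linear0.
  by subst j'; rewrite !dsingle_same.
have claim2 j (x : M (o j)) : \sum_t chi_ t (kM (dsingle x) _ (y t)) =
    \sum_t rho _ (chi_ t) (e _ (kM (dsingle x) _ (y t))).
  pose D : rdual (M (o j)) := \sum_t DM _ (chi_ t) (y t) j.
  have DE z : D z = \sum_t chi_ t (kM (dsingle z) _ (y t)).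
    by rewrite /D; elim/big_rec2: _ => // t u v _ <-.
  have [|k0 k0E] := (ses_ker (cdual_ses eS (o j)) (D : character _)).1.
    apply: ahomP => z; rewrite -[LHS]/(D (i _ z)) DE -[RHS]/(0 : QZ).
    rewrite -[RHS](claim1 (kL (dsingle z))); apply: eq_bigr => t _; congr (chi_ t _).
    move: (y t); apply: fgfree_ext => [u u'|u u'|j' u a].
    - exact: linearD.
    - by rewrite !linearD.
    rewrite kME kLE qnat (linearZZ (i (o j'))); apply: (congr1 (fun v => mact M u (a *: v))).
    have [jj'|jj'] := pselect (j = j'); last by rewrite !dsingle_neq // linear0.
    by subst j'; rewrite !dsingle_same.
  have Dk0 : D = pull e k0 by rewrite -[LHS]k0E.
  rewrite -DE Dk0 -(rho_pull _ k0) -Dk0.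
  have -> : rho _ D = \sum_t DK _ (rho _ (chi_ t)) (y t) j.
    rewrite /D; elim/big_rec2: _ => [|t u v _ <-]; first exact: rho0.
    by rewrite rhoD rhoDM.
  rewrite pullE.
  have -> : (\sum_t DK _ (rho _ (chi_ t)) (y t) j) (e (o j) x) =
      \sum_t rho _ (chi_ t) (kK (dsingle (e _ x)) _ (y t)).
    by elim/big_rec2: _ => // t u v _ <-.
  by apply: eq_bigr => t _; rewrite ekM.
have claim3 (k : qhom (fgfree o) M) : \sum_t chi_ t (k _ (y t)) =
    \sum_t rho _ (chi_ t) (e _ (k _ (y t))).
  pose xi j := k (o j) (fggen (idm (o j)) 1).
  have kE p z : k p z = \sum_j kM (dsingle (xi j)) p z.
    move: z; apply: fgfree_ext => [z z'|z z'|j u a].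
    - exact: linearD.
    - by rewrite -big_split; apply: eq_bigr => j _; rewrite linearD.
    rewrite (bigD1 j) //= big1 ?addr0 => [|j' j'j]; last first.
      rewrite kME dsingle_neq ?scaler0 ?linear0 // => jj'.
      by rewrite jj' eqxx in j'j.
    rewrite kME dsingle_same /xi -linearZ -qnat; congr (k p _).
    have -> : a *: fggen (idm (o j)) 1 = fggen (idm (o j)) (a * 1).
      by symmetry; exact: (linearZZ (lin (igen_linear d (ob := o) (M := fun _ => R^o) (idm (o j)))) a 1).
    by rewrite mulr1 /fggen igen_act compm1.
  transitivity (\sum_j \sum_t chi_ t (kM (dsingle (xi j)) _ (y t))).
    by rewrite exchange_big; apply: eq_bigr => t _; rewrite kE raddf_sum.
  transitivity (\sum_j \sum_t rho _ (chi_ t) (e _ (kM (dsingle (xi j)) _ (y t)))).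
    by apply: eq_bigr => j _; exact: claim2.
  rewrite exchange_big; apply: eq_bigr => t _.
  by rewrite kE linear_sum raddf_sum.
case: chil; rewrite chiE; have := claim3 (qcomp g0 b).
have gby t : qcomp g0 b _ (y t) = l t by rewrite /= sE.
under eq_bigr do rewrite gby.
move=> ->; rewrite big1 // => t _; rewrite gby g0E /=.
have -> : c (o1 t) (f (o1 t) (x1 t)) = 0 by apply/(ex (o1 t)); exists (x1 t).
by rewrite linear0 af0.
Qed.
End FlatnessCriterion.

(** * Cotorsion modules and exactness of coinduction *)

(** The pullback along f of the extension of C by A is an extension of Y by A, so
    it splits. *)
Lemma cotorsion_lift (R : pzRingType) (A B C Y : lmodType R) (i : {linear A -> B})
    (p : {linear B -> C}) (f : {linear Y -> C}) :
  cotorsion_module A -> ses i p -> charflat Y ->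
  exists g : {linear Y -> B}, forall y, p (g y) = f y.
Proof.
move=> Acot ip Yflat.
have dL : linear (fun x : (B * Y)%type => p x.1 - f x.2).
  move=> a [x y] [x1 y1] /=.
  by rewrite (linearP p) (linearP f) scalerBr opprD addrACA.
pose P := kernel (lin dL).
have PE (x : subm P) : p (sincl x).1 = f (sincl x).2.
  by apply: subr0_eq; exact: (sinclP x).
have jL : linear (fun x : A => (i x, 0 : Y)).
  by move=> a x y; rewrite linearP; congr (_, _); rewrite /= scaler0 addr0.
have [|j jE] := @subm_lift _ _ _ P (lin jL).
  by move=> x; rewrite /= (ses0 x ip) linear0 subr0.
have tL : linear (fun x : subm P => (sincl x).2) by [].
have jt : ses j (lin tL).
  split.
  - by move=> x y /(congr1 (fun w => (sincl w).1)); rewrite !jE => /(ses_inj ip).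
  - move=> y; have [b bE] := ses_surj ip (f y).
    have byP : P (b, y) by rewrite /= bE subrr.
    by exists (SubM byP).
  - move=> x; split=> [/= x2|[a <-]]; last by rewrite /= jE.
    have /(ses_ker ip)[a ax] : p (sincl x).1 = 0 by rewrite PE x2 linear0.
    exists a; apply: sincl_inj; rewrite jE /= ax.
    by case: (sincl x) x2 => u v /= ->.
have [rho rhoE] := Acot _ _ _ _ _ jt Yflat idfun.
have [s sE] := choice (ses_surj jt).
have phiL : linear (fun x : subm P => (sincl x).1 - i (rho x)).
  move=> a x y; rewrite (linearP rho) (linearP i) /= scalerBr.
  by rewrite opprD addrACA.
pose phi := lin phiL; have phij a : phi (j a) = 0 by rewrite /= jE rhoE subrr.
have phiE x y : (sincl x).2 = (sincl y).2 -> phi x = phi y.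
  move=> xy; apply: subr0_eq; rewrite -linearB.
  have /(ses_ker jt)[a <-] : lin tL (x - y) = 0 by rewrite linearB /= xy subrr.
  exact: phij.
have gL : linear (fun y => phi (s y)).
  move=> a y y'; rewrite -linearP; apply: phiE.
  by rewrite -[LHS]/(lin tL _) -[RHS]/(lin tL _) linearP !sE.
exists (lin gL) => y; rewrite /= linearB (ses0 _ ip) subr0 PE.
by rewrite -[(sincl (s y)).2]/(lin tL (s y)) sE.
Qed.

Lemma coind_functorE (Q : preadditive) (R : pzRingType) (J : Type) (o : J -> Q)
    (M N : J -> lmodType R) (g : forall j, {linear M j -> N j}) p
    (l : coind o M p) j x :
  coind_functor o g p l j x = g j (l j x).
Proof. by rewrite coind_mapE /= comp1m. Qed.

(** The morphism groups are projective over the integers. *)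
Lemma coind_ses (Q : preadditive) (R : pzRingType) (J : Type) (o : J -> Q)
    (A B C : J -> lmodType R) (i : forall j, {linear A j -> B j})
    (p : forall j, {linear B j -> C j}) :
  hom_finite Q -> (forall j, ses (i j) (p j)) ->
  qses (coind_functor o i) (coind_functor o p).
Proof.
move=> Qhom ip q; split.
- move=> l l' ll'; apply: coindP => j x; apply: (ses_inj (ip j)).
  by rewrite -!coind_functorE ll'.
- move=> l.
  have lift j : exists h : ahom (mor q (o j)) (B j), forall x, p j (h x) = l j x.
    have pL : linear (fun b : zmodule (B j) => p j b : zmodule (C j)).
      by apply: additive_int_linear => x y; exact: linearD.
    have lL : linear (fun x : zmodule (mor q (o j)) => l j x : zmodule (C j)).
      by apply: additive_int_linear => x y; exact: afD.
    have [h hE] := (Qhom q (o j)).2 _ _ (lin pL) (lin lL) (ses_surj (ip j)).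
    have hD (x y : mor q (o j)) : h (x + y) = h x + h y :> B j by exact: (linearD h).
    by exists (@AHom (mor q (o j)) (B j) h hD); exact: hE.
  have [h hE] := dchoice lift; exists h; apply: coindP => j x.
  by rewrite coind_functorE hE.
- move=> l; split=> [l0|[l' <-]]; last first.
    by apply: coindP => j x; rewrite !coind_functorE (ses0 _ (ip j)).
  have ker j x : p j (l j x) = 0 by rewrite -coind_functorE l0.
  have [h hE] := dchoice2 (fun j x => (ses_ker (ip j) (l j x)).1 (ker j x)).
  have hD j x y : h j (x + y) = h j x + h j y.
    by apply: (ses_inj (ip j)); rewrite linearD !hE afD.
  exists (fun j => AHom (hD j)); apply: coindP => j x.
  by rewrite coind_functorE hE.
Qed.

Lemma unit_locally_finite (Q : preadditive) (q : Q) : locally_finite (fun _ : unit => q).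
Proof.
move=> p; exists 1%N, (fun _ => tt); split=> [x y _|[] _]; last by exists ord0.
by rewrite !ord1.
Qed.

(** * Flat-valued functors are orthogonal to exact cotorsion functors *)

Section Converse.
Variables (Q : preadditive) (r : forall q : Q, set (mor q q)).
Arguments r : clear implicits.
Hypotheses (rP : strong_retraction r) (Qhom : hom_finite Q).
Hypothesis rnil : ideal_nilpotent (pseudo_radical r).
Variables (d : duality Q) (Qfin : locally_finite (fun q : Q => q)).
Variables (d' : duality (opcat Q)) (Q'fin : locally_finite (fun q : opcat Q => q)).
Variables (R : pzRingType) (n : nat).
Hypothesis Rn : forall M : lmodType R, flatdim n M.
Implicit Types X Y Z N C : qmod Q R.

Definition flat_valued X := forall q, charflat (X q).

Lemma acyclic_qflat X : acyclic X -> flat_valued X -> qflat X.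
Proof.
move=> Xac Xflat; apply: (qflat_of_top rP Qhom rnil d Xac) => q.
exact: (@top_flat Q r rP Qhom d Qfin d' Q'fin R n Rn X q Xac Xflat).
Qed.

(** The functors induced from a flat module are flat, and induction is left
    adjoint to evaluation. *)
Lemma cotorsion_value N q : cotorsion N -> cotorsion_module (N q).
Proof.
move=> Ncot A B Y i p ip Yflat f.
pose I M := ind d (fun _ : unit => q) (fun _ : unit => M : lmodType R).
have uf := unit_locally_finite q.
have IYflat : qflat (I Y).
  apply: acyclic_qflat; first exact: acyclic_ind.
  by move=> q'; apply: ind_ob_flat.
have Is : qses (coind_functor _ (fun _ : unit => i) : qhom (I A) (I B))
    (coind_functor _ (fun _ : unit => p) : qhom (I B) (I Y)).
  by apply: coind_ses.
have [F FE] := ind_lift d uf (Y := N) (fun _ : unit => f).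
have [G GE] := Ext1_zero_extend F (Ncot _ IYflat) Is.
pose ig (M : lmodType R) : {linear M -> I M q} :=
  lin (@igen_linear Q d unit (fun _ => q) R (fun _ => M) q tt (idm q)).
exists (G q \o ig B) => a; rewrite -[RHS](mact1 (q := q)) -(FE q tt (idm q) a) -GE.
congr (G q _); apply: coindP => -[] x; rewrite coind_functorE.
by rewrite -![ig _ _]/(igen _ _ _) !igenE raddfMz.
Qed.

Definition flat_perp N := forall Y, flat_valued Y -> Ext1_zero Y N.

(** By adjunction with evaluation. *)
Lemma flat_perp_coind (J : Type) (o : J -> Q) (M : J -> lmodType R) :
  (forall j, cotorsion_module (M j)) -> flat_perp (coind o M).
Proof.
move=> Mcot Y Yflat; apply: Ext1_zero_of_retract => E i p ip.
have [g gE] := dchoice (fun j => Mcot j _ _ _ _ _ (ip (o j)) (Yflat (o j)) (coev o M j)).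
exists (coind_map g) => q l.
apply: (coind_hom_ext (h := qcomp (coind_map g) i) (h' := qid _)) => j y.
by rewrite /= mact1 gE.
Qed.

Lemma Ext1_zero_of_lift Y N C N' (i : qhom N C) (p : qhom C N') :
  qses i p -> Ext1_zero Y C ->
  (forall y : qhom Y N', exists z : qhom Y C, forall q x, p q (z q x) = y q x) ->
  Ext1_zero Y N.
Proof.
move=> ip YC lift; apply: Ext1_zero_of_retract => E i0 p0 ip0.
have [h hE] := Ext1_zero_extend i YC ip0.
have [|y yE] := @qses_factor _ _ _ _ _ _ _ _ (qcomp p h) ip0.
  by move=> q x; rewrite /= hE (ses0 _ (ip q)).
have [z zE] := lift y.
have [|k kE] := @qses_lift _ _ _ _ _ _ i p (qsubh h (qcomp z p0)) ip.
  by move=> q x; rewrite /= linearB zE yE subrr.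
exists k => q x; apply: (ses_inj (ip q)); rewrite kE /= hE.
by rewrite (ses0 _ (ip0 q)) linear0 subr0.
Qed.

(** A map Y -> N' extends to emb_ob Y, because cosyz Y is again flat-valued. Maps
    out of the induced functor emb_ob Y lift from N' to C, as they amount to
    maps of modules, where the kernel is cotorsion. *)
Lemma flat_perp_kernel N C N' (i : qhom N C) (p : qhom C N') :
  (forall q, cotorsion_module (N q)) -> qses i p ->
  flat_perp C -> flat_perp N' -> flat_perp N.
Proof.
move=> Ncot ip Cperp N'perp Y Yflat.
apply: (Ext1_zero_of_lift ip (Cperp _ Yflat)) => y.
have [y' y'E] := Ext1_zero_extend y (N'perp _ (cosyz_flat Qfin Yflat)) (cosyz_ses d Y).
have [|z zE] := ind_lift_epi Qfin (e := p) (g := y').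
  move=> q; pose g : {linear Y (dob d q) -> N' q} := y' q \o
    lin (@igen_linear Q d Q (fun q => q) R (fun q => Y (dob d q)) q q (idm q)).
  have [h hE] := cotorsion_lift g (Ncot q) (ip q) (Yflat (dob d q)).
  by exists h.
by exists (qcomp z (emb d Y)) => q x; rewrite /= zE y'E.
Qed.

Section Cosyzygies.
Variable N : qmod Q R.
Hypotheses (Ncot : cotorsion N) (Nac : acyclic N).

Fixpoint cosyzn k : qmod Q R := if k is k'.+1 then cosyz d (cosyzn k') else N.

Lemma cosyzn_acyclic k : acyclic (cosyzn k).
Proof. by elim: k => [//|k IH]; apply: acyclic_cosyz. Qed.

Lemma cosyzn_cotorsion k q : cotorsion_module (cosyzn k q).
Proof.
elim: k q => [|k IH] q; first exact: cotorsion_value.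
have [s sE] := cosyz_retract d (cosyzn k) q.
by apply: (cotorsion_retract sE); apply: ind_ob_cotorsion.
Qed.

Lemma emb_perp k : flat_perp (emb_ob d (cosyzn k)).
Proof. by apply: flat_perp_coind => q; exact: cosyzn_cotorsion. Qed.

(** The iterated extension of cosyzn k.+1 by N through the emb_ob (cosyzn i) is
    trivial on every acyclic functor Z of flat dimension at most k. The proof
    climbs a projective resolution of Z; Y is only compared with Z, because Z
    itself need not be flat-valued. *)
Lemma lift_to_emb k Z Y (z : qhom Z (cosyzn k.+1)) (y : qhom Y Z) :
  acyclic Z -> (forall q, flatdim k (Z q)) -> flat_valued Y ->
  exists h : qhom Y (emb_ob d (cosyzn k)),
    forall q x, cosyz_proj d (cosyzn k) q (h q x) = z q (y q x).
Proof.
elim: k Z Y z y => [|k IH] Z Y z y Zac Zdim Yflat.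
  have Zflat := acyclic_qflat Zac Zdim.
  have [h hE] := Ext1_zero_lift z (Ncot Zflat) (cosyz_ses d N).
  by exists (qcomp h y) => q x; rewrite /= -hE.
have [e e_epi] := free_ob_cover d Qfin Z; have keS := qkernel_ses e_epi.
have [eY eY_epi] := free_ob_cover d Qfin Y; have kYS := qkernel_ses eY_epi.
have free_ac X : acyclic (free_ob d X) by exact: acyclic_ind.
set Z' := qsub (qkernel e) in keS; set W := qsub (qkernel eY) in kYS.
have Z'ac : acyclic Z' by exact: (acyclic_kernel d' Q'fin keS (free_ac _) Zac).
have Z'dim q : flatdim k (Z' q).
  exact: (Zdim q _ _ _ _ (keS q) (@free_ob_flat Q d Qfin R Z q)).
have Wflat : flat_valued W.
  by move=> q; exact: (charflat_kernel (kYS q) (Yflat q) (@free_ob_flat Q d Qfin R Y q)).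
set p1 := cosyz_proj d (cosyzn k.+1); have S1 := cosyz_ses d (cosyzn k.+1).
set p0 := cosyz_proj d (cosyzn k); have S0 := cosyz_ses d (cosyzn k).
have [g1 g1E] := free_ob_projective Qfin (X := Z) (qcomp z e) (fun q => ses_surj (S1 q)).
have [g2 g2E] := free_ob_projective Qfin (X := Y) (qcomp y eY) e_epi.
have [|z' z'E] := @qses_lift _ _ _ _ _ _ _ _ (qcomp g1 (qincl (qkernel e))) S1.
  move=> q x; apply: etrans (g1E q (sincl x)) _.
  by apply: etrans (congr1 (z q) (sinclP x)) (linear0 (z q)).
have [|w wE] := @qses_lift _ _ _ _ _ _ _ _ (qcomp g2 (qincl (qkernel eY))) keS.
  move=> q x; apply: etrans (g2E q (sincl x)) _.
  by apply: etrans (congr1 (y q) (sinclP x)) (linear0 (y q)).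
have [h hE] := IH Z' W z' w Z'ac Z'dim Wflat.
have [h2 h2E] := Ext1_zero_extend h (@emb_perp k Y Yflat) kYS.
have [|w' w'E] := @qses_factor _ _ _ _ _ _ _ _
    (qsubh (qcomp g1 g2) (qcomp (emb d (cosyzn k.+1)) (qcomp p0 h2))) kYS.
  move=> q x; rewrite -[LHS]/(g1 q (g2 q (qincl (qkernel eY) q x)) -
    emb d (cosyzn k.+1) q (p0 q (h2 q (qincl (qkernel eY) q x)))).
  rewrite h2E hE z'E -[g2 q _]/(qcomp g2 (qincl (qkernel eY)) q x) -wE.
  exact: subrr.
exists w' => q x; have [x' <-] := eY_epi q x; rewrite w'E.
rewrite -[qsubh _ _ q x']/(g1 q (g2 q x') - emb d (cosyzn k.+1) q (p0 q (h2 q x'))).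
apply: etrans (linearB (p1 q) _ _) _.
apply: etrans (congr1 (fun v => p1 q (g1 q (g2 q x')) - v) (ses0 _ (S1 q))) _.
rewrite subr0; apply: etrans (g1E q (g2 q x')) _.
exact: (congr1 (z q) (g2E q x')).
Qed.

Lemma flat_perp_exact_cotorsion : flat_perp N.
Proof.
have top_perp : flat_perp (cosyzn n).
  move=> Y Yflat; apply: (Ext1_zero_of_lift (cosyz_ses d (cosyzn n))).
    exact: emb_perp.
  move=> y; have [||//|h hE] := @lift_to_emb n (cosyzn n.+1) Y (qid _) y.
  - exact: (@cosyzn_acyclic n.+1).
  - by move=> q; exact: Rn.
  by exists h.
have descend k : flat_perp (cosyzn k) -> flat_perp (cosyzn 0).
  elim: k => [//|k IH] kperp; apply: IH.
  exact: (flat_perp_kernel (@cosyzn_cotorsion k) (cosyz_ses d _) (@emb_perp k) kperp).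
exact: descend top_perp.
Qed.
End Cosyzygies.
End Converse.

(** * Character modules are cotorsion *)

Section LeftDual.
Variables (R : pzRingType) (C : lmodType R^c).

Definition ldual := character C.
HB.instance Definition _ := GRing.Zmodule.on ldual.

Definition ldual_scale (a : R) (c : ldual) : ldual.
Proof.
exists (fun x => c ((a : R^c) *: x)) => x y.
by rewrite scalerDr afD.
Defined.

Let scaleA a b c : ldual_scale a (ldual_scale b c) = ldual_scale (a * b) c.
Proof. by apply: ahomP => x /=; rewrite scalerA. Qed.
Let scale1 : left_id 1 ldual_scale.
Proof. by move=> c; apply: ahomP => x /=; rewrite scale1r. Qed.
Let scaleDr : right_distributive ldual_scale +%R.
Proof. by move=> a c c'; apply: ahomP. Qed.
Let scaleDl c : {morph ldual_scale^~ c : a b / a + b}.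
Proof. by move=> a b; apply: ahomP => x /=; rewrite scalerDl afD. Qed.
HB.instance Definition _ := GRing.Zmodule_isLmodule.Build R ldual
  scaleA scale1 scaleDr scaleDl.

Lemma ldualZE (a : R) (c : ldual) x : (a *: c) x = c ((a : R^c) *: x).
Proof. by []. Qed.

Lemma balanced_ldual (M : lmodType R) (f : {linear M -> ldual}) :
  balanced (fun (x : C) m => f m x).
Proof.
split=> [x y m|x m m'|a x m]; first exact: afD.
- by rewrite linearD.
- by rewrite linearZ.
Qed.

Lemma ldual_balanced (M : lmodType R) (b : C -> M -> QZ) : balanced b ->
  exists f : {linear M -> ldual}, forall m x, f m x = b x m.
Proof.
move=> bb; pose f m : ldual := AHom (fun x y => balancedDl bb x y m).
have fL : linear f.
  move=> a m m'; apply: ahomP => x.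
  by rewrite ahomDE ldualZE /= (balancedZ bb) (balancedDr bb).
by exists (lin fL).
Qed.
End LeftDual.

Definition ldual_map (R : pzRingType) (A B : lmodType R^c) (f : {linear A -> B}) :
  {linear ldual B -> ldual A}.
Proof.
apply: (@lin _ _ _ (fun c : ldual B =>
  ahom_comp c (AHom (fun x y => linearD f x y)) : ldual A)).
by move=> a c c'; apply: ahomP => x; rewrite !ahomDE !ldualZE /= linearZ.
Defined.

Lemma ldual_ses (R : pzRingType) (A B C : lmodType R^c) (i : {linear A -> B})
    (p : {linear B -> C}) : ses i p -> ses (ldual_map p) (ldual_map i).
Proof.
move=> ip; split.
- move=> c c' cc'; apply: ahomP => z; have [y <-] := ses_surj ip z.
  exact: (congr1 (fun w : ldual B => af w y) cc').
- move=> c; have [c' c'E] := character_extend (fun x y => linearD i x y)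
    (ses_inj ip) (@afD _ _ c).
  by exists c'; apply: ahomP.
- move=> c; split=> [c0|[c' <-]]; last first.
    by apply: ahomP => x; rewrite /= (ses0 _ ip) af0.
  have [|c' c'E] := @character_factor _ _ p c (fun x y => linearD p x y) (ses_surj ip).
    move=> y /(ses_ker ip)[x <-].
    exact: (congr1 (fun w : ldual A => af w x) c0).
  by exists c'; apply: ahomP.
Qed.

(** Purity in terms of systems of linear equations, which links finitely
    presented functors to tensor products. *)
Definition pure_mono (R : pzRingType) (N E : lmodType R) (i : {linear N -> E}) : Prop :=
  forall m n (k : 'I_n -> 'I_m -> R) (e : 'I_m -> E) (v : 'I_n -> N),
  (forall t, \sum_j k t j *: e j = i (v t)) ->
  exists v' : 'I_m -> N, forall t, \sum_j k t j *: v' j = v t.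

(** C (x) N -> C (x) E is injective when N is pure in E. The group C (x) E is a
    quotient of that of the finitely supported functions from C to E, by relations
    that come from the kernel of the free cover of C. The character is constructed
    on all functions from C to E; it is well defined since purity pulls a relation
    between elements of N back to N. *)
Lemma pure_pairing (R : pzRingType) (N E : lmodType R) (i : {linear N -> E}) :
  injective i -> pure_mono i -> forall (C : lmodType R^c) (b : C -> N -> QZ),
  balanced b ->
  exists2 b' : C -> E -> QZ, balanced b' & forall c x, b' c (i x) = b c x.
Proof.
move=> i_inj i_pure C b bb.
pose cov : {linear freemod R^c C -> C} := free_lift id.
pose term (K : freemod R^c C) (e : E) : dprod (fun _ : C => E) :=
  fun c => (coef K c : R) *: e.
pose emb (v : C -> N) : dprod (fun _ : C => E) := fun c => i (v c).
pose val (v : C -> N) := fsum (fun c => b c (v c)).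
have bfin v : finsupp v -> finsupp (fun c => b c (v c)).
  by move=> [l vl]; exists l => c /vl ->; rewrite balanced0r.
have [|f fP] := @phom_extend (dprod (fun _ : C => E)) QZ QZ_divisible
  (fun w => exists (v : C -> N) (s : seq (subm (kernel cov) * E)),
     [/\ finsupp v, w.1 = emb v + \sum_(x <- s) term (sincl x.1) x.2 & w.2 = val v]).
  split.
  - exists (fun=> 0), [::]; split=> /=; first by exists [::].
      by rewrite big_nil addr0; apply: dprodP => c; rewrite /emb linear0.
    by rewrite /val (@fsumE _ _ _ [::]) ?big_nil // => c _; rewrite balanced0r.
  - move=> a x a' x' [v [s [vf /= -> ->]]] [v' [s' [vf' /= -> ->]]].
    exists (fun c => v c - v' c), (s ++ [seq (- y.1, y.2) | y <- s']).
    have [l [ul vl v'l]] := finsupp_common vf vf'.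
    split=> /=; first by exists l => c cl; rewrite vl // v'l // subr0.
      rewrite big_cat big_map /= opprD addrACA; congr (_ + (_ + _)).
        by apply: dprodP => c; rewrite dprodDE dprodNE /emb linearB.
      rewrite -sumrN; apply: eq_bigr => y _; apply: dprodP => c.
      by rewrite dprodNE /term -scaleNr.
    rewrite /val.
    have -> : fsum (fun c => b c (v c - v' c)) =
        fsum (fun c => b c (v c) + b c (- v' c)).
      by congr fsum; apply/funext => c; rewrite (balancedDr bb).
    have nf : finsupp (fun c => b c (- v' c)).
      by have [l' v'l'] := vf'; exists l' => c /v'l' ->; rewrite oppr0 balanced0r.
    rewrite fsumD //; last exact: bfin.
    congr (_ + _); symmetry.
    rewrite (@fsum_morph _ _ _ -%R) //; last exact: bfin.
      by congr fsum; apply/funext => c; rewrite balancedNr.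
    by move=> y z; rewrite opprD.
  - move=> x [v [s [vf /= w0 ->]]].
    pose m := size s; pose K (j : 'I_m) : freemod R^c C := sincl (tnth (in_tuple s) j).1.
    pose e (j : 'I_m) := (tnth (in_tuple s) j).2.
    have Kcov j : cov (K j) = 0 by exact: (sinclP (tnth (in_tuple s) j).1).
    have wE c : i (v c) + \sum_j (coef (K j) c : R) *: e j = 0.
      rewrite -[RHS]/((0 : dprod (fun _ : C => E)) c) [X in _ = X c]w0.
      rewrite dprodDE dprod_sumE; congr (_ + _).
      by rewrite (big_tnth _ _ s).
    have [lv lvP] := vf; have [lK lKP] := choice (fun j => sinclP (K j)).
    pose l := undup (lv ++ flatten [seq lK j | j <- enum 'I_m]).
    have ul : uniq l by exact: undup_uniq.
    have vl c : c \notin l -> v c = 0.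
      by rewrite mem_undup mem_cat negb_or => /andP[/lvP].
    have Kl c j : c \notin l -> coef (K j) c = 0.
      rewrite mem_undup mem_cat negb_or => /andP[_ cl]; apply: lKP.
      apply: contra cl => cK; apply/flattenP; exists (lK j) => //.
      by apply: map_f; rewrite mem_enum.
    have [|v' v'E] := i_pure m (size l) (fun t j => coef (K j) (tnth (in_tuple l) t)) e
        (fun t => - v (tnth (in_tuple l) t)).
      by move=> t; rewrite linearN; apply: (addrI (i (v (tnth (in_tuple l) t))));
        rewrite subrr; exact: wE.
    rewrite /val (fsumE ul) => [|c /vl ->]; last by rewrite balanced0r.
    rewrite big_tnth.
    have E1 t : b (tnth (in_tuple l) t) (v (tnth (in_tuple l) t)) =
        - \sum_j b (coef (K j) (tnth (in_tuple l) t) *: tnth (in_tuple l) t) (v' j).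
      rewrite -[v _]opprK balancedNr // -v'E; congr (- _).
      pose bt := AHom (fun y z => balancedDr bb (tnth (in_tuple l) t) y z).
      rewrite -[LHS]/(bt _) raddf_sum; apply: eq_bigr => j _ /=.
      by rewrite (balancedZ bb).
    under eq_bigr do rewrite E1.
    rewrite sumrN exchange_big big1 ?oppr0 // => j _.
    rewrite -(big_tnth _ _ l predT (fun c => b (coef (K j) c *: c) (v' j))).
    pose bj := AHom (fun y z => balancedDl bb y z (v' j)).
    transitivity (bj (cov (K j))); last by rewrite Kcov af0.
    rewrite [cov _]free_liftE (fsumE ul) ?raddf_sum // => c /(Kl c j) ->.
    by rewrite scale0r.
have fterm (K : freemod R^c C) (e : E) : cov K = 0 -> f (term K e) = 0.
  move=> K0; apply: fP; exists (fun=> 0), [:: (@SubM _ _ (kernel cov) K K0, e)].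
  split=> /=; first by exists [::].
    rewrite big_seq1 /=; apply: dprodP => c.
    by rewrite dprodDE /emb linear0 add0r.
  by rewrite /val (@fsumE _ _ _ [::]) ?big_nil // => c _; rewrite balanced0r.
have termDl (K K' : freemod R^c C) e : term (K + K') e = term K e + term K' e.
  by apply: dprodP => c; rewrite dprodDE -[RHS]scalerDl.
have termDr K e e' : term K (e + e') = term K e + term K e'.
  by apply: dprodP => c; rewrite dprodDE /term scalerDr.
have termZ (a : R) (K : freemod R^c C) (e : E) :
    term ((a : R^c) *: K) e = term K (a *: e).
  by apply: dprodP => c; rewrite [RHS]scalerA.
have fcov K K' e : cov K = cov K' -> f (term K e) = f (term K' e).
  move=> KK'; apply: subr0_eq; rewrite -(fterm (K - K') e); last first.
    by rewrite linearB KK' subrr.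
  rewrite -afB; congr (f _); apply: dprodP => c.
  rewrite dprodDE dprodNE; apply: etrans (esym (scalerDl _ _ _)).
  by congr (_ + _); rewrite -[LHS]scaleNr.
exists (fun c e => f (term (gen _ c) e)).
  split=> [c c' e|c e e'|a c e].
  - by rewrite -afD -termDl; apply: fcov; rewrite linearD !free_lift_gen.
  - by rewrite termDr afD.
  - by rewrite -termZ; apply: fcov; rewrite linearZ !free_lift_gen.
move=> c x; apply: fP.
pose v c' := if c' == c then x else 0; have vn c' : c' != c -> v c' = 0.
  by rewrite /v => /negPf ->.
exists v, [::]; split=> /=.
- by exists [:: c] => c'; rewrite inE => /vn.
- rewrite big_nil addr0; apply: dprodP => c'; rewrite /term /emb coef_gen /v.
  by case: eqP => _; rewrite ?scale1r // scale0r linear0.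
- rewrite /val (@fsum1 _ _ c) ?/v ?eqxx // => c' /negPf ->.
  by rewrite balanced0r.
Qed.

Section FlatQuotients.
Variables (Q : preadditive) (d : duality Q) (R : pzRingType).

Lemma regular_projective : lmod_projective R^o.
Proof.
move=> A B e g e_surj; have [x xE] := e_surj (g 1).
have hL : linear (fun a : R^o => (a : R) *: x).
  by move=> a b c; rewrite scalerDl scalerA.
exists (lin hL) => a; rewrite /= linearZ xE -linearZ; congr (g _).
exact: mulr1.
Qed.

Lemma fgfree_projective n (o : 'I_n -> Q) : qprojective (fgfree d R o).
Proof.
by apply: (ind_projective (finite_locally_finite o)) => j; exact: regular_projective.
Qed.

Lemma fgfree_fg n (o : 'I_n -> Q) : qfg (fgfree d R o).
Proof.
exists n, o, (fun j => fggen d (idm (o j)) (1 : R)) => S S0 SL Sact Sgen p y.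
have Ssum x z : S p x -> S p z -> S p (x + z).
  by move=> Sx Sz; rewrite -[x]scale1r; exact: SL.
rewrite [y](ind_expand (finite_locally_finite o)).
elim/big_ind: _ => [||t _]; [exact: S0|exact: Ssum|].
rewrite -[bas t]compm1 -igen_act; apply: Sact.
set a := y _ _; set j := bix t in a *.
have -> : @igen Q d _ o R (fun _ => R^o) _ j (idm (o j)) a =
    a *: fggen d (idm (o j)) (1 : R) + 0.
  rewrite addr0 -[RHS](linearZZ (lin (igen_linear d (M := fun _ => R^o) (idm (o j))))).
  by congr igen; rewrite -[RHS]/(a * 1) mulr1.
by apply: SL => //; exact: Sgen.
Qed.

(** The finite systems of equations are the maps from finitely presented
    functors. *)
Lemma qflat_pure_mono (N E F : qmod Q R) (i : qhom N E) (p : qhom E F) q :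
  qses i p -> qflat F -> pure_mono (i q).
Proof.
move=> ip Fflat m n k e v kv.
pose o1 (_ : 'I_n) := q; pose o0 (_ : 'I_m) := q.
have [lift0 lift0E] := fgfree_lift d o0 E.
have [lift1 lift1E] := fgfree_lift d o1 (fgfree d R o0).
pose x j : fgfree d R o0 q := @fggen Q d R m o0 q j (idm q) 1.
pose y t : fgfree d R o0 q := \sum_j k t j *: x j.
pose f := lift1 y; pose a := lift0 e.
have ax j : a q (x j) = e j by rewrite /a /x lift0E mact1 scale1r.
have ay t : a q (y t) = i q (v t).
  rewrite -kv linear_sum; apply: eq_bigr => j _.
  by rewrite linearZ ax.
pose T := qquot (qimage f); pose c : qhom _ T := qproj (qimage f).
have cS : qses (qincl (qimage f)) c.
  by move=> q'; have [u1 u2 u3] := quot_ses (qimage f q'); split.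
have paf q' z : p q' (a q' (f q' z)) = 0.
  move: z; apply: (fgfree_ext (d := d) (o := o1)) => [z z'|z z'|t u b].
  - by rewrite !linearD.
  - by rewrite addr0.
  rewrite lift1E !qnat !linearZ ay.
  rewrite (ses0 _ (ip q)) linear0; exact: (scaler0 (F q') b).
have [|g gE] := @qses_factor _ _ _ _ _ _ _ _ (qcomp p a) cS.
  by move=> p' [z [w wz]]; rewrite /= -wz; exact: paf.
have Tfp : qfp T.
  exists (fgfree d R o1), (fgfree d R o0), f, c; split.
  - by split; [exact: fgfree_projective|exact: fgfree_fg].
  - by split; [exact: fgfree_projective|exact: fgfree_fg].
  - by move=> q'; exact: ses_surj (cS q').
  - by move=> q' z; exact: qpi_eq0.
have [h hE] := Fflat _ p (fun q => ses_surj (ip q)) T Tfp g.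
have [|v' v'E] := @dchoice _ (fun _ => N q) (fun j w => i q w = e j - h q (c q (x j))).
  by move=> j; apply/(ses_ker (ip q)); rewrite linearB hE gE /= ax subrr.
exists v' => t; apply: (ses_inj (ip q)); rewrite linear_sum.
have hcy : h q (c q (y t)) = \sum_j k t j *: h q (c q (x j)).
  rewrite !linear_sum; apply: eq_bigr => j _.
  by rewrite !linearZ.
apply: (@etrans _ _ (\sum_j k t j *: e j - h q (c q (y t)))).
  rewrite hcy -sumrB; apply: eq_bigr => j _.
  by rewrite linearZ /= v'E scalerBr.
have -> : c q (y t) = 0.
  apply/(qpi_eq0 (qimage f q)); exists (@fggen Q d R n o1 q t (idm q) 1).
  by rewrite lift1E mact1 scale1r.
by rewrite linear0 subr0 kv.
Qed.
End FlatQuotients.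

(** * Functors coinduced from character modules *)

Lemma image_ses (R : pzRingType) (A B : lmodType R) (f : {linear A -> B}) :
  injective f -> ses f (qpi (image_submod f)).
Proof.
move=> f_inj; split; first exact: f_inj.
- by move=> y; exists (qval y); exact: qvalK.
- by move=> x; exact: qpi_eq0.
Qed.

Lemma coind_divisible_injective (Q : preadditive) (J : Type) (o : J -> Q)
    (M : J -> lmodType int) :
  (forall j, divisible (M j)) -> qinjective (coind o M).
Proof.
move=> Mdiv A B i g i_mono.
have [f fE] := dchoice (fun j => ahom_extend (Mdiv j)
  (fun x y => linearD (i (o j)) x y) (i_mono (o j))
  (fun x y => linearD (coev o M j \o g (o j) : {linear _ -> _}) x y)).
have fL j : linear (f j) by apply: additive_int_linear => x y; exact: afD.
exists (coind_map (fun j => lin (fL j))) => q x.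
apply: (coind_hom_ext (h := qcomp (coind_map (fun j => lin (fL j))) i)) => j y.
by rewrite /= mact1 fE.
Qed.

Section DualCoinduced.
Variables (Q : preadditive) (R : pzRingType) (C : lmodType R^c) (q : Q).

Definition dual_coind : qmod Q R := coind (fun _ : unit => q) (fun _ => ldual C).

(** The pairing of C with N (q), for N = dual_coind, extends to every
    extension of a flat functor by N, and corresponds there to a retraction
    onto N. *)
Lemma dual_coind_cotorsion (d : duality Q) : cotorsion dual_coind.
Proof.
move=> F Fflat; apply: Ext1_zero_of_retract => E i p ip.
have [b' bb' b'E] := pure_pairing (ses_inj (ip q)) (qflat_pure_mono d ip Fflat)
  (balanced_ldual (coev (fun _ : unit => q) (fun _ => ldual C) tt)).
have [g gE] := ldual_balanced bb'.
exists (coind_map (o := fun _ : unit => q) (M := fun _ => ldual C) (fun _ => g)).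
move=> p' l; apply: (coind_hom_ext (h := qcomp (coind_map (fun _ => g)) i)
  (h' := qid _)) => -[] y.
by apply: ahomP => x; rewrite /= mact1 gE b'E.
Qed.

Let V0 : lmodType int := dprod (fun _ : C => zmodule QZ).

Lemma V0_divisible : divisible V0.
Proof.
move=> n w n0; have [w' w'E] := choice (fun x => QZ_divisible (w x) n0).
exists w'; apply: dprodP => x; rewrite -scale_intE dprodZE scale_intE.
exact: w'E.
Qed.

Lemma quot_divisible (V : lmodType int) (S : submodule V) :
  divisible V -> divisible (quot S).
Proof.
move=> Vdiv n x n0; have [y yE] := Vdiv n (qval x) n0.
by exists (qpi S y); rewrite -[RHS]qvalK -yE raddfMz.
Qed.

Let j0_linear : linear (fun c : zmodule (ldual C) => (fun x => af c x) : V0).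
Proof. by apply: additive_int_linear. Qed.
Let j0 := lin j0_linear.
Let V1 : lmodType int := quot (image_submod j0).

Let j0_ses : ses j0 (qpi (image_submod j0)).
Proof.
apply: image_ses => c c' cc'; apply: ahomP => x.
exact: (congr1 (fun w : V0 => w x) cc').
Qed.

(** The group of characters of C is the kernel of an epimorphism between the
    divisible groups V0, of all functions, and V1. *)
Lemma dual_coind_exact : hom_finite Q -> exact_object dual_coind.
Proof.
move=> Qhom; right.
pose o (_ : unit) := q; pose z (f : False) : Q := match f with end.
pose zM (f : False) : lmodType int := match f with end.
pose I i : qmod Q int := match i with
  | 0 => coind o (fun _ => V0) | 1 => coind o (fun _ => V1) | _ => coind z zM end.
have Z p (x y : coind z zM p) : x = y by apply: coindP => -[].
have zero_hom (X Y : qmod Q int) : exists f : qhom X Y, forall p x, f p x = 0.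
  have fL p : linear (fun _ : X p => 0 : Y p) by move=> a x y; rewrite scaler0 addr0.
  have fN p p' (u : mor p p') (x : X p) : 0 = mact Y u 0 by rewrite linear0.
  by exists (qmk fL fN).
pose dI i : qhom (I i) (I i.+1) := match i with
  | 0 => coind_functor o (fun _ => qpi (image_submod j0))
  | _ => projT1 (cid (zero_hom _ _)) end.
have dI0 i p x : dI i.+1 p x = 0 by exact: (projT2 (cid (zero_hom _ _)) p x).
have gL : linear (fun l : forget dual_coind q => j0 (l tt (idm q))).
  by apply: additive_int_linear => x y; rewrite -linearD.
pose e : qhom (forget dual_coind) (I 0) := coind_map (o := o) (fun _ => lin gL).
have eE p l x : e p l tt x = j0 (l tt x).
  by rewrite -[RHS](congr1 (fun y => j0 (l tt y)) (comp1m x)).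
have S := coind_ses o Qhom (fun _ => j0_ses).
exists 1%N, I, dI, e; split.
- case=> [|[|i]]; apply: coind_divisible_injective => //= _.
    exact: V0_divisible.
  exact: quot_divisible V0_divisible.
- by case=> [//|[//|i]] _ p x; exact: Z.
- move=> p l l' ll'; apply: coindP => -[] x.
  by apply: (ses_inj j0_ses); rewrite -!eE ll'.
- move=> p l; split=> [/(ses_ker (S p))[l' l'E]|[l' <-]].
    have l'D (x y : mor p q) : l' tt (x + y) = l' tt x + l' tt y :> ldual C by exact: afD.
    exists (fun _ => AHom l'D); apply: coindP => -[] x.
    by rewrite eE -l'E coind_functorE.
  apply: coindP => -[] x; rewrite coind_functorE eE.
  exact: (ses0 _ j0_ses).
- case=> [|i] p x; split=> _; rewrite ?dI0 //.
    have [y <-] := ses_surj (S p) x; exists y.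
    by [].
  by exists 0; exact: Z.
Qed.
End DualCoinduced.

(** For A inside B with quotient C, the functors coinduced from the character
    modules of C, B, A form an exact sequence. A balanced map on A x X(q) is a
    map to its last term, and lifting it to the middle term extends the
    balanced map to B. *)
Lemma left_perp_flat (Q : preadditive) (R : pzRingType) (d : duality Q)
    (X : qmod Q R) q : hom_finite Q ->
  left_perp (fun N => cotorsion N /\ exact_object N) X -> charflat (X q).
Proof.
move=> Qhom Xperp A B i i_inj b bb.
have iS := image_ses i_inj.
have S := coind_ses (fun _ : unit => q) Qhom (fun _ => ldual_ses iS).
have [g gE] := ldual_balanced bb.
have [|h hE] := Ext1_zero_lift
    (coind_map (o := fun _ : unit => q) (M := fun _ => ldual A) (fun _ => g)) _ S.
  apply: Xperp; split; first exact: (@dual_coind_cotorsion Q R _ q d).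
  exact: dual_coind_exact.
exists (fun x m => coev (fun _ : unit => q) (fun _ => ldual B) tt (h q m) x).
  exact: (balanced_ldual (coev (fun _ : unit => q) (fun _ => ldual B) tt \o h q)).
move=> x m; rewrite -gE -[in RHS](mact1 m).
have E : ldual_map i (h q m tt (idm q)) = g (mact X (idm q) m).
  by rewrite -(coind_mapE (fun _ : unit => g) m (j := tt)) -hE coind_functorE.
exact: (congr1 (fun c : ldual A => af c x) E).
Qed.

(** * Flat values and orthogonality to exact cotorsion functors *)

Lemma finite_set_enum (T : Type) (A : set T) : finite_set A ->
  exists n (s : 'I_n -> T), injective s /\ forall x, A x -> exists k, s k = x.
Proof.
move=> /(@finite_seqP {classic T})[s As].
exists (size (undup s)), (fun k => tnth (in_tuple (undup s)) k); split.
  exact: (elimT (tuple_uniqP (in_tuple (undup s))) (undup_uniq s)).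
move=> x; rewrite As => xs; have /tnthP[k kE] : (x : {classic T}) \in in_tuple (undup s).
  by rewrite mem_undup.
by exists k.
Qed.

Lemma bounded_locally_finite (Q : preadditive) : locally_bounded Q ->
  locally_finite (fun q : Q => q) /\ locally_finite (fun q : opcat Q => q).
Proof.
move=> Qbd; split=> q; have [n [s [s_inj sE]]] := finite_set_enum (Qbd q).
  by exists n, s; split=> // p pq; apply: sE; left.
by exists n, s; split=> // p pq; apply: sE; right.
Qed.

Theorem theorem4 (Q : preadditive) (R : pzRingType)
    (r : forall q : Q, set (mor q q)) :
  hom_finite Q -> locally_bounded Q -> has_serre_functor Q ->
  strong_retraction r -> ideal_nilpotent (pseudo_radical r) ->
  (forall X : qmod Q R, left_perp (fun N => cotorsion N /\ exact_object N) X ->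
     forall q : Q, lmod_flat (X q)) /\
  (finite_weak_gldim R ->
   forall X : qmod Q R, (forall q : Q, lmod_flat (X q)) ->
     left_perp (fun N => cotorsion N /\ exact_object N) X).
Proof.
move=> Qhom Qbd [S SS] rP rnil.
have [[d] [d']] := serre_duality Qhom SS.
have [Qfin Q'fin] := bounded_locally_finite Qbd.
split=> [X Xperp q|/weak_gldim_flatdim[n Rn] X Xflat N [Ncot Nex]].
  by apply/flat_charflat; exact: (@left_perp_flat Q R d X q).
have Nac : acyclic N by exact: (acyclic_exact d Qfin d' Q'fin Nex).
apply: (flat_perp_exact_cotorsion rP Qhom rnil d Qfin d' Q'fin Rn Ncot Nac) => q.
exact/flat_charflat.
Qed.
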